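(* Let $\mathcal M,\mathcal N$ be Hilbert spaces, let $S_\mu(z)$ be an $\mathbf L(\mathcal M,\mathcal N)$-valued DA function on $\Lambda$, and let $\mu>1$. The associated kernel $$K^{S_\mu}(z,w)=\sum_{n=0}^\infty\frac{z^{(n)}\overline{w^{(n)}}I_{\mathcal N}-(Z_+^nS_\mu)(z)(Z_+^nS_\mu)(w)^*}{\mu^{2n}},\qquad z,w\in\mathbf V(\Lambda),$$ is positive if, and only if, the operator $M_{S_\mu}$ defined for $$f(z)=\sum_{n=0}^\infty z^{(n)}\hat f(n)\in\mathbf H^2_\mu(\mathcal M)$$ by $$M_{S_\mu}f(z)=S_\mu\odot f(z)=\sum_{n=0}^\infty Z_+^nS_\mu(z)\hat f(n)$$ is a contraction in $\mathbf L(\mathbf H^2_\mu(\mathcal M),\mathbf H^2_\mu(\mathcal N))$.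
   Context: Rhombic lattice: $\Lambda$ is a monohedral (edge-to-edge) tessellation of $\mathbb C$ by mutually congruent (nondegenerate) rhombi of side length 1, viewed as a planar graph with vertex set $\mathbf V(\Lambda)$, (undirected) edge set $\mathbf E(\Lambda)$ and face set $\mathbf F(\Lambda)$ (the rhombi). $\hat{\mathbf E}(\Lambda)=\{b-a:(a,b)\in\mathbf E(\Lambda)\}$ is the set of edge directions; it is finite and closed under $e\mapsto -e$. A path from $a$ to $b$ is a finite sequence $(z_0=a,z_1,\dots,z_N=b)$ of vertices with consecutive ones adjacent; it is closed if $a=b$. Standing assumptions: $0\in\mathbf V(\Lambda)$; $1\in\hat{\mathbf E}(\Lambda)$; and both sides of every track $F$ in $\Lambda$ contain tracks that are coherent to $F$. Here a track is a sequence $(F_n)_{n\in\mathbb Z}$ of faces such that for every $n$ the faces $F_n,F_{n+1}$ are adjacent and the edges shared by $F_n$ with $F_{n+1}$ and with $F_{n-1}$ are two opposite sides of $F_n$; these shared edges are the ties of the track. The sides of a track are the two connected components of the graph obtained by deleting all ties of the track from $\mathbf E(\Lambda)$. Two tracks are coherent if their ties are parallel. DA functions: for $f:\mathbf V(\Lambda)\to\mathcal V$ ($\mathcal V$ a complex vector space) and a path $\gamma=(z_0,\dots,z_N)$, $\int_\gamma f\,\delta z=\sum_{n=1}^N\frac{f(z_{n-1})+f(z_n)}{2}(z_n-z_{n-1})$. $f$ is discrete analytic (DA) if $\int_\gamma f\,\delta z=0$ for every closed path $\gamma$; $\int_a^b f\,\delta z$ denotes the then path-independent integral along any path from $a$ to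 $b$. The forward shift $Z_+$ on DA functions is $(Z_+f)(z)=\frac{f(0)-f(z)}{2}+\int_0^z f\,\delta z$ (again a DA function). Basis and Hardy space: $z^{(0)}=1$ and $z^{(n)}=Z_+z^{(n-1)}$ for $n\ge1$. $\mathbf L(\mathcal M,\mathcal N)$ is the space of bounded linear operators. For a Hilbert space $\mathcal N$ and $\mu>1$, $\mathbf H^2_\mu(\mathcal N)$ is the reproducing kernel Hilbert space of $\mathcal N$-valued DA functions on $\Lambda$ with kernel $K_\mu(z,w)=\sum_{n\ge0}\mu^{-2n}z^{(n)}\overline{w^{(n)}}I_{\mathcal N}$; it consists of the functions $f(z)=\sum_{n\ge0}z^{(n)}\hat f(n)$, $\hat f(n)\in\mathcal N$, with $\|f\|^2=\sum_{n\ge0}\mu^{2n}\|\hat f(n)\|_{\mathcal N}^2<\infty$ (the coefficients $\hat f(n)$ are uniquely determined by $f$). An $\mathbf L(\mathcal N)$-valued kernel $K$ on $\mathbf V(\Lambda)$ is positive if $\sum_{i,j}\langle K(w_i,w_j)\zeta_j,\zeta_i\rangle_{\mathcal N}\ge0$ for all finite families $w_i\in\mathbf V(\Lambda)$, $\zeta_i\in\mathcal N$. A contraction is a linear operator of norm at most 1. *)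

(* Defs.v *)
From HB Require Import structures.
From mathcomp Require Import all_boot all_order all_algebra.
From mathcomp Require Import complex.
From mathcomp Require Import all_classical all_reals all_analysis.

Set Implicit Arguments.
Unset Strict Implicit.
Unset Printing Implicit Defensive.

Import Order.TTheory GRing.Theory Num.Theory.
Import numFieldNormedType.Exports.

Local Open Scope classical_set_scope.
Local Open Scope ring_scope.
Local Open Scope complex_scope.

Section Tessellation.
Variable R : realType.
Local Notation C := R[i].

Definition segment (x y : C) : set C :=
  [set z | exists2 s : R, 0 <= s <= 1 & z = x + s%:C * (y - x)].

Definition rhombus (p a b : C) : set C :=
  [set z | exists s t : R,
     [/\ 0 <= s <= 1, 0 <= t <= 1 & z = p + s%:C * a + t%:C * b]].

(* [F] is a nondegenerate rhombus of side 1, [p] is one of its four corners and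
   [p + a], [p + b] are the two corners next to [p].  Every corner and every
   side (in both orientations) of [F] is obtained from such a description. *)
Definition rhombus_at (F : set C) (p a b : C) : Prop :=
  [/\ `|a| = 1, `|b| = 1, a <> b, a <> - b & F = rhombus p a b].

Definition corner (F : set C) (z : C) : Prop := exists a b, rhombus_at F z a b.

Definition is_side (F : set C) (x y : C) : Prop :=
  exists b, rhombus_at F x (y - x) b.

Definition congruent (F G : set C) : Prop :=
  exists2 phi : C -> C,
    (forall x y, `|phi x - phi y| = `|x - y|) & phi @` F = G.

(* The edge-to-edge condition forces distinct faces to have disjoint
   interiors. *)
Definition rhombic_tessellation (faces : set (set C)) : Prop :=
  [/\ forall F, faces F -> exists p a b, rhombus_at F p a b,
      forall F G, faces F -> faces G -> congruent F G,
      forall z, exists2 F, faces F & F z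
    & forall F G, faces F -> faces G -> F <> G ->
      [\/ F `&` G = set0,
          exists z, [/\ corner F z, corner G z & F `&` G = [set z]]
        | exists x y,
            [/\ is_side F x y, is_side G x y & F `&` G = segment x y]]].

Definition vertices (faces : set (set C)) : set C :=
  [set z | exists2 F, faces F & corner F z].

Definition edge (faces : set (set C)) (x y : C) : Prop :=
  exists2 F, faces F & is_side F x y.

Definition edge_directions (faces : set (set C)) : set C :=
  [set e | exists x y, edge faces x y /\ e = y - x].

Definition shared_side (F G : set C) (x y : C) : Prop :=
  [/\ F <> G, is_side F x y & is_side G x y].

Definition is_track (faces : set (set C)) (T : int -> set C) : Prop :=
  forall n : int, faces (T n) /\
    exists p a b, [/\ rhombus_at (T n) p a b,
      shared_side (T n) (T (n + 1)) p (p + a)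
    & shared_side (T n) (T (n - 1)) (p + b) (p + b + a)].

Definition tie (T : int -> set C) (x y : C) : Prop :=
  exists n : int, shared_side (T n) (T (n + 1)) x y.

Definition parallel (a b : C) : Prop := exists2 r : R, r != 0 & a = r%:C * b.

Definition coherent (T T' : int -> set C) : Prop :=
  forall x y x' y', tie T x y -> tie T' x' y' -> parallel (y - x) (y' - x').

Definition off_ties (faces : set (set C)) (T : int -> set C) : rel C :=
  fun x y => `[< edge faces x y /\ ~ tie T x y >].

(* Components of the graph left after deleting the ties, as vertex sets. *)
Definition is_track_side (faces : set (set C)) (T : int -> set C)
    (A : set C) : Prop :=
  exists2 z, vertices faces z &
    A = [set w | exists2 s : seq C, path (off_ties faces T) z s & last z s = w].

Definition track_in (T : int -> set C) (A : set C) : Prop :=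
  forall n z, corner (T n) z -> A z.

Record rhombic_lattice := RhombicLattice {
  faces : set (set C);
  facesP : rhombic_tessellation faces;
  vertex0 : vertices faces 0;
  direction1 : edge_directions faces 1;
  coherent_tracks : forall T A, is_track faces T -> is_track_side faces T A ->
    exists T', [/\ is_track faces T', coherent T' T & track_in T' A]
}.

Definition vtx (L : rhombic_lattice) : Type := set_type (vertices (faces L)).

Definition vtx0 (L : rhombic_lattice) : vtx L := SigSub (mem_set (vertex0 L)).

Definition adj (L : rhombic_lattice) : rel (vtx L) :=
  fun x y => `[< edge (faces L) (val x) (val y) >].

End Tessellation.

Section DiscreteAnalytic.
Variables (R : realType) (L : rhombic_lattice R).
Local Notation C := R[i].

(* The path is [z :: s], as in [path] and [last]. *)
Fixpoint path_int (U : lmodType C) (f : vtx L -> U) (z : vtx L)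
    (s : seq (vtx L)) : U :=
  if s is w :: s' then
    (val w - val z) *: (2^-1 *: (f z + f w)) + path_int f w s'
  else 0.

Definition discrete_analytic (U : lmodType C) (f : vtx L -> U) : Prop :=
  forall z s, path (@adj R L) z s -> last z s = z -> path_int f z s = 0.

(* A value of the integral along some path from [a] to [b]; for a discrete
   analytic [f] there is exactly one. *)
Definition integral_between (U : lmodType C) (f : vtx L -> U)
    (a b : vtx L) : U :=
  xget 0 [set v | exists s,
    [/\ path (@adj R L) a s, last a s = b & v = path_int f a s]].

Definition Zplus (U : lmodType C) (f : vtx L -> U) (z : vtx L) : U :=
  2^-1 *: (f (vtx0 L) - f z) + integral_between f (vtx0 L) z.

Definition zpow (n : nat) : vtx L -> C :=
  iter n (@Zplus (C^o : lmodType C)) (fun _ => 1).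

End DiscreteAnalytic.

(* The form is linear in its first argument and conjugate-linear in the
   second. *)
HB.mixin Record NormedModule_isHilbert (R : realType) (H : Type)
    of CompleteNormedModule R[i] H := {
  inner : {dot H for (Num.conj : R[i] -> R[i])};
  inner_norm : forall x : H, inner x x = `|x| ^+ 2
}.

#[short(type="hilbertType")]
HB.structure Definition Hilbert (R : realType) :=
  {H of NormedModule_isHilbert R H & CompleteNormedModule R[i] H}.

Definition hnorm (R : realType) (H : hilbertType R) (x : H) : R :=
  complex.Re `|x|.

Section BoundedOperators.
Variables (R : realType) (M N : hilbertType R).
Local Notation C := R[i].

Definition bounded_linear (T : M -> N) : Prop :=
  linear T /\ exists k : R, forall x, hnorm (T x) <= k * hnorm x.

Definition bounded_linearb : {pred (M -> N)} := fun T => `[< bounded_linear T >].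

Record bounded_op := BoundedOp {
  bop_fun :> M -> N;
  bop_prop : bop_fun \in bounded_linearb
}.

HB.instance Definition _ := [isSub for bop_fun].
HB.instance Definition _ := [Choice of bounded_op by <:].

Lemma normE_hnorm (H : hilbertType R) (x : H) : `|x| = (hnorm x)%:C.
Proof. by rewrite /hnorm RRe_real // normr_real. Qed.

Lemma ler_hnorm (H K : hilbertType R) (x : H) (y : K) (k : R) :
  (hnorm x <= k * hnorm y) = (`|x| <= k%:C * `|y|).
Proof. by rewrite !normE_hnorm -rmorphM lecR. Qed.

Lemma bounded_linear_submod : submod_closed bounded_linearb.
Proof.
split.
  apply/asboolP; split; first by move=> c x y; rewrite /= scaler0 addr0.
  by exists 0 => x; rewrite mul0r /hnorm normr0.
move=> c S T /asboolP[lS [k kS]] /asboolP[lT [l lT']]; apply/asboolP; split.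
  move=> d x y; rewrite !fctE lS lT !scalerDr !scalerA (mulrC c d).
  by rewrite addrACA.
exists (complex.Re `|c| * k + l) => x; rewrite ler_hnorm.
apply: (le_trans (ler_normD _ _)).
have -> : (complex.Re `|c| * k + l)%:C = `|c| * k%:C + l%:C.
  by rewrite -{2}(RRe_real (normr_real c)) -rmorphM -rmorphD.
rewrite mulrDl lerD //.
  by rewrite normrZ -mulrA ler_wpM2l // -ler_hnorm.
by rewrite -ler_hnorm.
Qed.

HB.instance Definition _ :=
  GRing.isSubmodClosed.Build C (M -> N) bounded_linearb bounded_linear_submod.
HB.instance Definition _ :=
  [SubChoice_isSubLmodule of bounded_op by <:].

End BoundedOperators.

Section BoundedOperatorAlgebra.
Variable R : realType.

Lemma bop_id_subproof (N : hilbertType R) : idfun \in @bounded_linearb R N N.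
Proof. by apply/asboolP; split=> //; exists 1 => x; rewrite mul1r. Qed.

Definition bop_id (N : hilbertType R) : bounded_op N N :=
  BoundedOp (bop_id_subproof N).

Lemma bop_comp_subproof (M N P : hilbertType R)
    (S : bounded_op N P) (T : bounded_op M N) :
  (fun x => S (T x)) \in @bounded_linearb R M P.
Proof.
have /asboolP[lS [k kS]] := bop_prop S; have /asboolP[lT [l lT']] := bop_prop T.
apply/asboolP; split; first by move=> c x y; rewrite lT lS.
have hnorm_ge0 (H : hilbertType R) (x : H) : 0 <= hnorm x.
  by rewrite -lecR -normE_hnorm; exact: normr_ge0.
exists (`|k| * l) => x; apply: (le_trans (kS _)); rewrite -mulrA.
apply: (le_trans (ler_wpM2r (hnorm_ge0 _ _) (ler_norm k))).
by rewrite ler_wpM2l.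
Qed.

Definition bop_comp (M N P : hilbertType R)
    (S : bounded_op N P) (T : bounded_op M N) : bounded_op M P :=
  BoundedOp (bop_comp_subproof S T).

(* The value 0 is never used: the adjoint exists by Riesz representation. *)
Definition adjoint (M N : hilbertType R) (T : bounded_op M N) :
    bounded_op N M :=
  xget 0 [set T' : bounded_op N M |
    forall x y, inner (T x) y = inner x (T' y)].

(* Sum of an operator series in the strong operator topology; it is the
   operator-norm sum whenever the latter exists. *)
Definition bop_series (M N : hilbertType R) (T : nat -> bounded_op M N) :
    bounded_op M N :=
  xget 0 [set A : bounded_op M N |
    forall x, series (fun n => T n x) @ \oo --> A x].

End BoundedOperatorAlgebra.

Section HardySpace.
Variables (R : realType) (L : rhombic_lattice R) (mu : R).
Local Notation C := R[i].

Definition coef_norm2 (N : hilbertType R) (a : nat -> N) : \bar R :=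
  (\sum_(0 <= n <oo) (mu ^+ (2 * n) * hnorm (a n) ^+ 2)%:E)%E.

Definition hardy_coef (N : hilbertType R) (f : vtx L -> N) (a : nat -> N) :
    Prop :=
  (coef_norm2 a < +oo)%E /\
  forall z, series (fun n => zpow n z *: a n) @ \oo --> f z.

Definition H2 (N : hilbertType R) : set (vtx L -> N) :=
  [set f | exists a, hardy_coef f a].

(* The coefficient sequence of [f]; it is unique for [f] in [H2]. *)
Definition hardy_hat (N : hilbertType R) (f : vtx L -> N) : nat -> N :=
  xget (fun=> 0) [set a | hardy_coef f a].

Definition H2norm (N : hilbertType R) (f : vtx L -> N) : R :=
  Num.sqrt (fine (coef_norm2 (hardy_hat f))).

Definition H2_contraction (M N : hilbertType R)
    (T : (vtx L -> M) -> vtx L -> N) : Prop :=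
  [/\ forall f, H2 f -> H2 (T f),
      forall (c : C) f g, H2 f -> H2 g -> T (c *: f + g) = c *: T f + T g
    & forall f, H2 f -> H2norm (T f) <= H2norm f].

Definition mul_op (M N : hilbertType R) (S : vtx L -> bounded_op M N)
    (f : vtx L -> M) (z : vtx L) : N :=
  lim (series (fun n => iter n (@Zplus R L _) S z (hardy_hat f n)) @ \oo).

Definition assoc_kernel (M N : hilbertType R) (S : vtx L -> bounded_op M N)
    (z w : vtx L) : bounded_op N N :=
  bop_series (fun n =>
    ((mu ^+ (2 * n))^-1)%:C *:
      ((zpow n z * (zpow n w)^*) *: bop_id N -
       bop_comp (iter n (@Zplus R L _) S z)
                (adjoint (iter n (@Zplus R L _) S w)))).

Definition positive_kernel (N : hilbertType R)
    (K : vtx L -> vtx L -> bounded_op N N) : Prop :=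
  forall (k : nat) (w : 'I_k -> vtx L) (zeta : 'I_k -> N),
    0 <= \sum_i \sum_j inner (K (w i) (w j) (zeta j)) (zeta i).

End HardySpace.

(* Main.v *)
(* Crossing an edge v -> w of direction e = w - v, the iterates of Z_+ satisfy
     w^(n+1) + (1-e)/2 w^(n) = v^(n+1) + (1+e)/2 v^(n),
   and so do the operators Z_+^n S.  Since |e| = 1, walking from 0 to z shows that
   they grow more slowly than r^n for every r > 1, so all series converge for mu > 1.
   For a finite family (w_i, zeta_i) put u_n = sum_i conj(w_i^(n)) zeta_i and
   v_n = sum_i (Z_+^n S)(w_i)^* zeta_i.  The kernel is positive iff
   sum mu^(-2n) |v_n|^2 <= sum mu^(-2n) |u_n|^2 for all families, which says that the
   adjoint of M_S, known on the span of the kernel functions, is a contraction there;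
   the Riesz argument turns this into Taylor coefficients of M_S f.

   Two properties of the lattice enter.
   (1) Z_+ preserves discrete analyticity: a form on edges that is exact on each face
   has a global potential, obtained by integrating along the rays from 0 in small
   steps, because faces met by a small ball always share a corner.
   (2) Coefficients are unique: if sum_n z^(n) d_n = 0 on the lattice, then
   G(z) = sum_n z^(n) d_(n+1) satisfies (1+e) G(v) = (1-e) G(w) on edges.  So G
   vanishes at v whenever v + 1 is adjacent to v, and a zero of G propagates along
   edges of direction other than 1 and -1.  Such edges lead from any vertex to one
   that has a right neighbour: otherwise the hypothesis on coherent tracks yields two
   tracks with horizontal ties, each lying to the right of the other, which is refuted
   on a horizontal line.  Hence G = 0, and induction gives d = 0. *)

Require Import Defs.
From mathcomp Require Import all_boot all_order all_algebra.
From mathcomp Require Import complex.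
From mathcomp Require Import all_classical all_reals all_analysis.
From mathcomp Require Import ring lra zify.

Set Implicit Arguments.
Unset Strict Implicit.
Unset Printing Implicit Defensive.

Import Order.TTheory GRing.Theory Num.Theory.
Import numFieldNormedType.Exports.

Local Open Scope classical_set_scope.
Local Open Scope ring_scope.
Local Open Scope complex_scope.

Local Notation re := complex.Re.
Local Notation im := complex.Im.

(** * Rhombi *)

Section Rhombus.
Variable R : realType.
Local Notation C := R[i].
Implicit Types (F G : set C) (p a b c d x y z : C) (s t : R).

(** Local finiteness and the absence of holonomy are derived from the tessellation axioms.
    Congruence enters through the common area of the faces, which is also their common height
    because sides have length 1; it bounds the number of faces near a point. In place of simple
    connectivity there is a Lebesgue number of a square: flags (point, face, corner) at small
    distance compare their potentials through one shared corner, and the resulting cocycle is summed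
    over thin quadrilaterals. The existence of potentials, applied to an integer form that is 1
    along the ties of a track, also stands in for the Jordan curve theorem. The Hardy space is never
    made into a Hilbert space. The passage from kernel to operator minimises a quadratic functional
    on the span of the kernel functions, which need not be complete, and the limit of a minimising
    sequence is taken coefficient by coefficient; norm bounds survive because they are bounds on
    finite partial sums. Adjoints come from the same minimisation. *)

Definition cross a b : R := re a * im b - im a * re b.

Lemma complex_eqP x y : re x = re y -> im x = im y -> x = y.
Proof. by case: x => a b; case: y => c d /= -> ->. Qed.

Lemma reD x y : re (x + y) = re x + re y. Proof. by case: x; case: y. Qed.
Lemma imD x y : im (x + y) = im x + im y. Proof. by case: x; case: y. Qed.
Lemma reN x : re (- x) = - re x. Proof. by case: x. Qed.
Lemma imN x : im (- x) = - im x. Proof. by case: x. Qed.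
Lemma reZ s x : re (s%:C * x) = s * re x.
Proof. by case: x => u v; simpc. Qed.
Lemma imZ s x : im (s%:C * x) = s * im x.
Proof. by case: x => u v; simpc. Qed.
Lemma re1 : re (1 : C) = 1. Proof. by []. Qed.
Lemma im1 : im (1 : C) = 0. Proof. by []. Qed.

Let reimE := (reD, imD, reN, imN, reZ, imZ, re1, im1).

Lemma unit_norm a : `|a| = 1 -> re a * re a + im a * im a = 1.
Proof.
move=> h; have := add_Re2_Im2 a; rewrite h expr1n => /complexI.
by rewrite !expr2.
Qed.

(** Lagrange's identity makes the squared inner product equal to 1 when [cross a b = 0], and
    equality in Cauchy-Schwarz for unit vectors leaves [a = b] or [a = - b]. *)
Lemma cross_neq0 a b : `|a| = 1 -> `|b| = 1 -> a <> b -> a <> - b ->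
  cross a b != 0.
Proof.
move=> /unit_norm ha /unit_norm hb nab nab'; apply/eqP => h.
have h2 : (re a * re b + im a * im b) ^+ 2 = 1.
  have -> : (re a * re b + im a * im b) ^+ 2 =
    (re a * re a + im a * im a) * (re b * re b + im b * im b) - cross a b ^+ 2.
    by rewrite /cross; ring.
  by rewrite ha hb h expr0n /= mulr1 subr0.
have /eqP := h2; rewrite sqrf_eq1 => /orP[/eqP e|/eqP e].
  have : (re a - re b) ^+ 2 + (im a - im b) ^+ 2 = 0 by lra.
  move/eqP; rewrite paddr_eq0 ?sqr_ge0// !sqrf_eq0 !subr_eq0.
  by case/andP => /eqP h3 /eqP h4; apply: nab; apply: complex_eqP.
have : (re a + re b) ^+ 2 + (im a + im b) ^+ 2 = 0 by lra.
move/eqP; rewrite paddr_eq0 ?sqr_ge0// !sqrf_eq0 !addr_eq0.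
by case/andP => /eqP h3 /eqP h4; apply: nab'; apply: complex_eqP; rewrite reimE.
Qed.

Lemma coord_inj a b s t s' t' : cross a b != 0 ->
  s * re a + t * re b = s' * re a + t' * re b ->
  s * im a + t * im b = s' * im a + t' * im b -> s = s' /\ t = t'.
Proof.
move=> h e1 e2; split; apply: (mulIf h); rewrite /cross.
  have -> : s * (re a * im b - im a * re b) =
    (s * re a + t * re b) * im b - (s * im a + t * im b) * re b by ring.
  by rewrite e1 e2; ring.
have -> : t * (re a * im b - im a * re b) =
    (s * im a + t * im b) * re a - (s * re a + t * re b) * im a by ring.
by rewrite e1 e2; ring.
Qed.

Lemma rhombusE p a b z : rhombus p a b z <->
  exists s t, [/\ 0 <= s <= 1, 0 <= t <= 1,
    re z = re p + s * re a + t * re b & im z = im p + s * im a + t * im b].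
Proof.
split=> [[s [t [hs ht ->]]]|[s [t [hs ht h1 h2]]]]; exists s, t; split=> //.
- by rewrite !reimE.
- by rewrite !reimE.
- by apply: complex_eqP; rewrite !reimE.
Qed.

Lemma rhombus_atW F p a b : rhombus_at F p a b ->
  [/\ re a * re a + im a * im a = 1, re b * re b + im b * im b = 1 &
      cross a b != 0].
Proof.
by case=> h1 h2 h3 h4 _; split; [exact: unit_norm|exact: unit_norm|exact: cross_neq0].
Qed.

Lemma rhombus_at_mem F p a b z : rhombus_at F p a b ->
  (F z <-> exists s t, [/\ 0 <= s <= 1, 0 <= t <= 1,
    re z = re p + s * re a + t * re b & im z = im p + s * im a + t * im b]).
Proof. by case=> _ _ _ _ ->; exact: rhombusE. Qed.

Lemma rhombus_atC F p a b : rhombus_at F p a b -> rhombus_at F p b a.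
Proof.
case=> h1 h2 h3 h4 h5; split => //; [exact/nesym| |].
  by move=> e; apply: h4; rewrite e opprK.
rewrite h5; apply/seteqP; split => z /rhombusE [s [t [hs ht e1 e2]]];
  apply/rhombusE; exists t, s; split=> //.
all: by rewrite ?e1 ?e2; ring.
Qed.

Lemma rhombus_atN F p a b : rhombus_at F p a b -> rhombus_at F (p + a) (- a) b.
Proof.
case=> h1 h2 h3 h4 h5; split => //; first by rewrite normrN.
- by move=> e; apply: h4; rewrite -e opprK.
- by move=> /oppr_inj.
rewrite h5; apply/seteqP; split => z /rhombusE [s [t [hs ht e1 e2]]];
  apply/rhombusE; exists (1 - s), t; split=> //; rewrite ?e1 ?e2 ?reimE; lra.
Qed.

Lemma rhombus_atN2 F p a b : rhombus_at F p a b -> rhombus_at F (p + b) a (- b).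
Proof. by move=> /rhombus_atC /rhombus_atN /rhombus_atC. Qed.

Lemma rhombus_atNN F p a b :
  rhombus_at F p a b -> rhombus_at F (p + a + b) (- a) (- b).
Proof. by move=> /rhombus_atN /rhombus_atN2. Qed.

Lemma rhombus_at_coord0 F p a b s t : rhombus_at F p a b ->
  s * re a + t * re b = 0 -> s * im a + t * im b = 0 -> s = 0 /\ t = 0.
Proof.
move=> /rhombus_atW[_ _ h] e1 e2; apply: (coord_inj h); lra.
Qed.

(** A corner is an extreme point of [F]. If [0 < s < 1], both [x + r a] and [x - r a] lie in [F]; in
    the description at [x] their coordinates are nonnegative and add up to zero, which forces
    [a = 0]. *)
Lemma corner_extreme F p a b x c d s t :
  rhombus_at F p a b -> rhombus_at F x c d ->
  re x = re p + s * re a + t * re b -> im x = im p + s * im a + t * im b ->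
  0 <= s <= 1 -> 0 <= t <= 1 -> s = 0 \/ s = 1.
Proof.
move=> hp hx e1 e2 hs ht.
have [->|s0] := eqVneq s 0; first by left.
have [->|s1] := eqVneq s 1; first by right.
exfalso; have {s0 s1} {}hs : 0 < s < 1.
  by rewrite lt0r s0 lt_neqAle s1 /=.
pose r := Num.min s (1 - s).
have [r1 r2 r0] : [/\ r <= s, r <= 1 - s & 0 < r].
  rewrite /r; split; [by rewrite ge_min lexx|by rewrite ge_min lexx orbT|].
  by rewrite lt_min; lra.
have /(rhombus_at_mem _ hx) [u [v [hu hv f1 f2]]] : F (x + r%:C * a).
  apply/(rhombus_at_mem _ hp); exists (s + r), t; rewrite !reimE e1 e2.
  split => //; lra.
have /(rhombus_at_mem _ hx) [u' [v' [hu' hv' f1' f2']]] : F (x - r%:C * a).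
  apply/(rhombus_at_mem _ hp); exists (s - r), t; rewrite !reimE e1 e2.
  split => //; lra.
move: f1 f2 f1' f2'; rewrite !reimE => f1 f2 f1' f2'.
have [z1 z2] : u + u' = 0 /\ v + v' = 0 by apply: (rhombus_at_coord0 hx); lra.
have /eqP e3 : u = 0 by lra.
have /eqP e4 : v = 0 by lra.
rewrite (eqP e3) (eqP e4) in f1 f2.
have [n1 _ _] := rhombus_atW hp.
have ra : r * re a = 0 by lra.
have ia : r * im a = 0 by lra.
have : r * (re a * re a + im a * im a) = 0 by rewrite mulrDr !mulrA ra ia; ring.
rewrite n1; lra.
Qed.

(** The two changes of basis between [(a, b)] and [(c, d)] are mutually inverse matrices with
    nonnegative entries, hence monomial; unit length removes the scaling factors. *)
Lemma same_corner_sides F p a b c d :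
  rhombus_at F p a b -> rhombus_at F p c d -> c = a \/ c = b.
Proof.
move=> hp hx.
have [na nb _] := rhombus_atW hp.
have [nc nd _] := rhombus_atW hx.
have /(rhombus_at_mem _ hp) [s [t [hs ht c1 c2]]] : F (p + c).
  by apply/(rhombus_at_mem _ hx); exists 1, 0; rewrite !reimE; split; lra.
have /(rhombus_at_mem _ hx) [u [v [hu hv a1 a2]]] : F (p + a).
  by apply/(rhombus_at_mem _ hp); exists 1, 0; rewrite !reimE; split; lra.
have /(rhombus_at_mem _ hp) [s' [t' [hs' ht' d1 d2]]] : F (p + d).
  by apply/(rhombus_at_mem _ hx); exists 0, 1; rewrite !reimE; split; lra.
have /(rhombus_at_mem _ hx) [u' [v' [hu' hv' b1 b2]]] : F (p + b).
  by apply/(rhombus_at_mem _ hp); exists 0, 1; rewrite !reimE; split; lra.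
move: c1 c2 a1 a2 d1 d2 b1 b2; rewrite !reimE => c1 c2 a1 a2 d1 d2 b1 b2.
have {}c1 : re c = s * re a + t * re b by move: c1; clear; lra.
have {}c2 : im c = s * im a + t * im b by move: c2; clear; lra.
have {}d1 : re d = s' * re a + t' * re b by move: d1; clear; lra.
have {}d2 : im d = s' * im a + t' * im b by move: d2; clear; lra.
have {}a1 : re a = u * re c + v * re d by move: a1; clear; lra.
have {}a2 : im a = u * im c + v * im d by move: a2; clear; lra.
have {}b1 : re b = u' * re c + v' * re d by move: b1; clear; lra.
have {}b2 : im b = u' * im c + v' * im d by move: b2; clear; lra.
have unit_scale (e f : C) (r : R) : 0 <= r ->
    re e * re e + im e * im e = 1 -> re f * re f + im f * im f = 1 ->
    re e = r * re f -> im e = r * im f -> e = f.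
  move=> r0 ne nf h1 h2.
  have /eqP : r ^+ 2 = 1.
    have : r ^+ 2 * (re f * re f + im f * im f) = 1 by rewrite -ne h1 h2; ring.
    by rewrite nf mulr1.
  rewrite sqrf_eq1 => /orP[|] /eqP r1; last by exfalso; lra.
  by apply: complex_eqP; rewrite ?h1 ?h2 r1 mul1r.
have [_ z1] : u * s + v * s' - 1 = 0 /\ u * t + v * t' = 0.
  apply: (rhombus_at_coord0 hp).
    by have := a1; rewrite c1 d1; lra.
  by have := a2; rewrite c2 d2; lra.
have [z2 _] : u' * s + v' * s' = 0 /\ u' * t + v' * t' - 1 = 0.
  apply: (rhombus_at_coord0 hp).
    by have := b1; rewrite c1 d1; lra.
  by have := b2; rewrite c2 d2; lra.
have [/andP[u0 _] /andP[v0 _]] := conj hu hv.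
have [/andP[u0' _] /andP[v0' _]] := conj hu' hv'.
have [/andP[s0 _] /andP[t0 _]] := conj hs ht.
have [/andP[s0' _] /andP[t0' _]] := conj hs' ht'.
move/eqP: z1; rewrite paddr_eq0 ?mulr_ge0// !mulf_eq0 => /andP[ut _].
move/eqP: z2; rewrite paddr_eq0 ?mulr_ge0// !mulf_eq0 => /andP[us _].
case/orP: us => [/eqP eu'|/eqP es]; last first.
  by right; apply: (unit_scale c b t); rewrite // ?c1 ?c2 es; ring.
case/orP: ut => [/eqP eu|/eqP et]; last first.
  by left; apply: (unit_scale c a s); rewrite // ?c1 ?c2 et; ring.
have : cross a b = 0 by rewrite /cross a1 a2 b1 b2 eu eu'; ring.
by have [_ _ /eqP] := rhombus_atW hp.
Qed.
End Rhombus.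

(** * Corners, sides and congruence of rhombi *)

Section Sides.
Variable R : realType.
Local Notation C := R[i].
Implicit Types (F G : set C) (p a b c d x y z : C) (s t : R).

Let reimE := (@reD R, @imD R, @reN R, @imN R, @reZ R, @imZ R, @re1 R, @im1 R).

Lemma same_corner_pair F p a b c d :
  rhombus_at F p a b -> rhombus_at F p c d ->
  (c = a /\ d = b) \/ (c = b /\ d = a).
Proof.
move=> h hx; have [_ _ ncd _ _] := hx.
case: (same_corner_sides h hx) => ec;
  case: (same_corner_sides h (rhombus_atC hx)) => ed; subst; try by tauto.
Qed.

Lemma rhombus_at_inv F p a b x c d : rhombus_at F p a b -> rhombus_at F x c d ->
  exists a' b', [/\ rhombus_at F x a' b',
    (c = a' /\ d = b') \/ (c = b' /\ d = a')
  & [\/ [/\ x = p, a' = a & b' = b], [/\ x = p + a, a' = - a & b' = b],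
        [/\ x = p + b, a' = a & b' = - b]
      | [/\ x = p + a + b, a' = - a & b' = - b]]].
Proof.
move=> hp hx.
have Fx : F x by apply/(rhombus_at_mem _ hx); exists 0, 0; split; lra.
have [s [t [hs ht e1 e2]]] := (rhombus_at_mem x hp).1 Fx.
have hs' := corner_extreme hp hx e1 e2 hs ht.
have ht' : t = 0 \/ t = 1.
  by apply: (corner_extreme (rhombus_atC hp) hx _ _ ht hs); rewrite ?e1 ?e2; ring.
case: hs' ht' e1 e2 => -> [] -> e1 e2.
- have ex : x = p by apply: complex_eqP; rewrite ?e1 ?e2; ring.
  subst x; exists a, b; split=> //; last by constructor 1.
  exact: same_corner_pair hp hx.
- have ex : x = p + b by apply: complex_eqP; rewrite ?e1 ?e2 !reimE; ring.
  subst x; have h := rhombus_atN2 hp.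
  exists a, (- b); split=> //; last by constructor 3.
  exact: same_corner_pair h hx.
- have ex : x = p + a by apply: complex_eqP; rewrite ?e1 ?e2 !reimE; ring.
  subst x; have h := rhombus_atN hp.
  exists (- a), b; split=> //; last by constructor 2.
  exact: same_corner_pair h hx.
- have ex : x = p + a + b by apply: complex_eqP; rewrite ?e1 ?e2 !reimE; ring.
  subst x; have h := rhombus_atNN hp.
  exists (- a), (- b); split=> //; last by constructor 4.
  exact: same_corner_pair h hx.
Qed.

Lemma corner_ind F p a b (P : C -> Prop) : rhombus_at F p a b ->
  P p -> P (p + a) -> P (p + b) -> P (p + a + b) -> forall z, corner F z -> P z.
Proof.
move=> hp h1 h2 h3 h4 z [c [d hz]].
by have [a' [b' [_ _ []]]] := rhombus_at_inv hp hz; case=> ->.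
Qed.

Lemma rhombus_at_side F p a b : rhombus_at F p a b -> is_side F p (p + a).
Proof. by move=> h; exists b; rewrite addrC addKr. Qed.

Lemma rhombus_at_corner F p a b : rhombus_at F p a b -> corner F p.
Proof. by move=> h; exists a, b. Qed.

Lemma is_side_sym F x y : is_side F x y -> is_side F y x.
Proof.
case=> b /rhombus_atN; rewrite addrC subrK opprB => h.
by exists b.
Qed.

Lemma is_side_cornerl F x y : is_side F x y -> corner F x.
Proof. by case=> b h; exists (y - x), b. Qed.

Lemma is_side_cornerr F x y : is_side F x y -> corner F y.
Proof. by move/is_side_sym/is_side_cornerl. Qed.

Lemma side_ind F p a b (P : C -> C -> Prop) : rhombus_at F p a b ->
  (forall x y, P x y -> P y x) -> P p (p + a) -> P p (p + b) ->
  P (p + a) (p + a + b) -> P (p + b) (p + a + b) ->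
  forall x y, is_side F x y -> P x y.
Proof.
move=> hp sym h1 h2 h3 h4 x y [d hz].
have eab : p + b + a = p + a + b by rewrite addrAC.
have := rhombus_at_inv hp hz.
move=> [a' [b' [_ [] [e1 _] []]]]; case=> ex ea eb;
  have -> : y = x + (y - x) by rewrite addrC subrK.
all: by rewrite e1 ?ea ?eb ex ?addrK -?eab ?addrK; try exact: sym;
  rewrite ?eab; try exact: sym.
Qed.

Lemma corner_mem F z : corner F z -> F z.
Proof.
by case=> a [b h]; apply/(rhombus_at_mem _ h); exists 0, 0; split; lra.
Qed.

Lemma side_norm F x y : is_side F x y -> `|y - x| = 1.
Proof. by case=> b []. Qed.

Lemma segmentE x y z : segment x y z <-> exists s, [/\ 0 <= s <= 1,
   re z = re x + s * (re y - re x) & im z = im x + s * (im y - im x)].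
Proof.
split=> [[s hs ->]|[s [hs e1 e2]]]; exists s => //; first by rewrite !reimE.
by apply: complex_eqP; rewrite !reimE.
Qed.

Lemma segment_sym x y z : segment x y z -> segment y x z.
Proof.
move=> /segmentE[s [hs e1 e2]]; apply/segmentE; exists (1 - s).
by split; [lra|rewrite e1; ring|rewrite e2; ring].
Qed.

Lemma segment_l x y : segment x y x.
Proof. by apply/segmentE; exists 0; split; lra. Qed.

Lemma segment_side F x y z : is_side F x y -> segment x y z -> F z.
Proof.
case=> b h /segmentE[s [hs e1 e2]]; apply/(rhombus_at_mem _ h).
by exists s, 0; rewrite !reimE e1 e2; split; lra.
Qed.

Lemma corner_on_side F x y z : is_side F x y -> corner F z -> segment x y z ->
  z = x \/ z = y.
Proof.
case=> b h hz /segmentE[s [hs e1 e2]].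
have [_ _ cr] := rhombus_atW h.
move: z hz e1 e2; apply: (corner_ind h) => [e1 e2|e1 e2|e1 e2|e1 e2].
- by left.
- by right; rewrite addrC subrK.
- exfalso; move: e1 e2; rewrite !reimE => e1 e2.
  by have [] := @coord_inj _ _ _ 0 1 s 0 cr;
    rewrite ?reimE; lra.
- exfalso; move: e1 e2; rewrite !reimE => e1 e2.
  by have [] := @coord_inj _ _ _ 1 1 s 0 cr;
    rewrite ?reimE; lra.
Qed.

Lemma side_through F x y x' y' z : is_side F x y -> is_side F x' y' ->
  segment x y z -> segment x' y' z -> ~ corner F z ->
  (x' = x /\ y' = y) \/ (x' = y /\ y' = x).
Proof.
move=> s1 s2 z1 z2 nz.
have [b h] := s1; have [_ _ cr] := rhombus_atW h.
have [s [hs e1 e2]] := (segmentE x y z).1 z1.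
have ey : x + (y - x) = y by rewrite addrC subrK.
have zx : z <> x by move=> e; apply: nz; rewrite e; exact: is_side_cornerl s1.
have zy : z <> y by move=> e; apply: nz; rewrite e; exact: is_side_cornerr s1.
move: x' y' s2 z2; apply: (side_ind h).
- by move=> u v h12 /segment_sym /h12; tauto.
- by rewrite ey; left.
- move=> /segmentE[t [ht]]; rewrite !reimE => f1 f2; exfalso; apply: zx.
  have [st _] := @coord_inj _ _ _ s 0 0 t cr ltac:(rewrite ?reimE; lra) ltac:(rewrite ?reimE; lra).
  by apply: complex_eqP; rewrite ?e1 ?e2 st; ring.
- move=> /segmentE[t [ht]]; rewrite !reimE => f1 f2; exfalso; apply: zy.
  have [st _] := @coord_inj _ _ _ s 0 1 t cr ltac:(rewrite ?reimE; lra) ltac:(rewrite ?reimE; lra).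
  by apply: complex_eqP; rewrite ?e1 ?e2 st; ring.
- move=> /segmentE[t [ht]]; rewrite !reimE => f1 f2; exfalso.
  have [_] := @coord_inj _ _ _ s 0 t 1 cr ltac:(rewrite ?reimE; lra) ltac:(rewrite ?reimE; lra).
  lra.
Qed.

Definition dot a b : R := re a * re b + im a * im b.

(* The diameter determines the angle of the rhombus: this is how congruence is used. *)
Lemma rhombus_diameter F p a b : rhombus_at F p a b ->
  (forall x y, F x -> F y -> dot (x - y) (x - y) <= 2 + 2 * `|dot a b|) /\
  (exists x y, [/\ F x, F y & dot (x - y) (x - y) = 2 + 2 * `|dot a b|]).
Proof.
move=> h; have [na nb _] := rhombus_atW h; split.
  move=> x y /(rhombus_at_mem _ h)[s [t [hs ht e1 e2]]].
  move=> /(rhombus_at_mem _ h)[s' [t' [hs' ht' e1' e2']]].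
  have -> : dot (x - y) (x - y) =
      (s - s') ^+ 2 * (re a * re a + im a * im a) +
      (t - t') ^+ 2 * (re b * re b + im b * im b) +
      2 * ((s - s') * (t - t') * dot a b).
    by rewrite /dot !reimE e1 e2 e1' e2'; ring.
  rewrite na nb !mulr1; apply: lerD.
    have sq1 (r : R) : -1 <= r <= 1 -> r ^+ 2 <= 1.
      move=> /andP[h1 h2].
      have : 0 <= (1 - r) * (1 + r) by apply: mulr_ge0; move: h1 h2; clear; lra.
      by clear; lra.
    by rewrite -[2]/(1 + 1) lerD // sq1 //; lra.
  rewrite ler_pM2l //; apply: (le_trans (ler_norm _)); rewrite normrM.
  rewrite ler_piMl // normrM mulr_ile1 // ler_norml; lra.
have [d0|d0] := leP 0 (dot a b).
  exists (p + a + b), p; split.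
  - exact: (corner_mem (rhombus_at_corner (rhombus_atNN h))).
  - exact: (corner_mem (rhombus_at_corner h)).
  - by rewrite ger0_norm // /dot !reimE; lra.
exists (p + a), (p + b); split.
- exact: (corner_mem (rhombus_at_corner (rhombus_atN h))).
- exact: (corner_mem (rhombus_at_corner (rhombus_atN2 h))).
- by rewrite ltr0_norm // /dot !reimE; lra.
Qed.

Lemma dot_norm x y : `|x| = `|y| -> dot x x = dot y y.
Proof.
move=> h; have := add_Re2_Im2 x; rewrite h -add_Re2_Im2 => /complexI.
by rewrite /dot !expr2.
Qed.

(** The isometry preserves the squared diameter [2 + 2 |dot a b|], and [cross ^+ 2 = 1 - dot ^+ 2]
    for unit sides. *)
Lemma congruent_cross F G p a b q c d : congruent F G ->
  rhombus_at F p a b -> rhombus_at G q c d -> `|cross a b| = `|cross c d|.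
Proof.
move=> [phi iso im_phi] hF hG.
have [bF [x [y [Fx Fy exy]]]] := rhombus_diameter hF.
have [bG [x' [y' [Gx Gy exy']]]] := rhombus_diameter hG.
have e : `|dot a b| = `|dot c d|.
  apply: le_anti; apply/andP; split.
    have : dot (phi x - phi y) (phi x - phi y) <= 2 + 2 * `|dot c d|.
      by apply: bG; rewrite -im_phi; [exists x|exists y].
    by rewrite (dot_norm (iso x y)) exy; lra.
  move: Gx Gy; rewrite -im_phi => -[u Fu eu] [v Fv ev].
  have := bF _ _ Fu Fv; rewrite -(dot_norm (iso u v)) eu ev exy'; lra.
have [na nb _] := rhombus_atW hF; have [nc nd _] := rhombus_atW hG.
have sq : cross a b ^+ 2 = cross c d ^+ 2.
  have crossE (u v : C) : cross u v ^+ 2 = dot u u * dot v v - dot u v ^+ 2.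
    by rewrite /cross /dot; ring.
  rewrite !crossE -(real_normK (num_real (dot a b))) e real_normK ?num_real//.
  by rewrite /dot na nb nc nd.
by apply/eqP; rewrite -(@eqrXn2 _ 2) // !real_normK ?num_real// sq.
Qed.
End Sides.

(** * Local structure of the tessellation *)

Section Tessellation.
Variable R : realType.
Local Notation C := R[i].
Implicit Types (F G : set C) (p a b c d x y z : C) (s t : R).

Let reimE := (@reD R, @imD R, @reN R, @imN R, @reZ R, @imZ R, @re1 R, @im1 R).

Definition box x (e : R) y := `|re y - re x| < e /\ `|im y - im x| < e.

Lemma box_refl x e : 0 < e -> box x e x.
Proof. by move=> e0; split; rewrite subrr normr0. Qed.

Lemma box_add x e y : `|re y| < e -> `|im y| < e -> box x e (x + y).
Proof. by rewrite /box !reimE [re x + _]addrC [im x + _]addrC !addrK. Qed.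

(** By Cramer's rule the quotients are the coordinates of [z - p] in the basis [(a, b)]; in this
    form they can be estimated as [z] moves. *)
Lemma mem_coord F p a b : rhombus_at F p a b -> forall z, F z <->
  0 <= cross (z - p) b / cross a b <= 1 /\ 0 <= cross a (z - p) / cross a b <= 1.
Proof.
move=> h z; have [_ _ cr] := rhombus_atW h; split.
  move=> /(rhombus_at_mem _ h)[s [t [hs ht e1 e2]]].
  have -> : cross (z - p) b = s * cross a b.
    by rewrite /cross !reimE e1 e2; ring.
  have -> : cross a (z - p) = t * cross a b.
    by rewrite /cross !reimE e1 e2; ring.
  by rewrite !mulfK.
case=> hs ht; apply/(rhombus_at_mem _ h).
exists (cross (z - p) b / cross a b), (cross a (z - p) / cross a b).
by split => //; move: cr; rewrite /cross !reimE => cr; field.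
Qed.

Lemma unit_coord_le1 (u v : R) : u * u + v * v = 1 -> `|u| <= 1.
Proof.
move=> e1; rewrite -(@ler_pXn2r _ 2) // ?nnegrE // expr1n real_normK ?num_real //.
by have := sqr_ge0 v; rewrite !expr2; lra.
Qed.

Lemma cross_box F p a b x y (e : R) : rhombus_at F p a b -> box x e y ->
  `|cross (y - p) b / cross a b - cross (x - p) b / cross a b| <= 2 * e / `|cross a b| /\
  `|cross a (y - p) / cross a b - cross a (x - p) / cross a b| <= 2 * e / `|cross a b|.
Proof.
move=> h [h1 h2]; have [na nb cr] := rhombus_atW h.
have le1 := unit_coord_le1.
have [na1 na2] : `|re a| <= 1 /\ `|im a| <= 1.
  by split; [apply: le1 na | apply: (le1 _ (re a)); rewrite addrC].
have [nb1 nb2] : `|re b| <= 1 /\ `|im b| <= 1.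
  by split; [apply: le1 nb | apply: (le1 _ (re b)); rewrite addrC].
have key (u v w r : R) : `|u| < e -> `|v| < e -> `|w| <= 1 -> `|r| <= 1 ->
    `|u * w - v * r| <= 2 * e.
  move=> hu hv hw hr; apply: (le_trans (ler_normB _ _)); rewrite !normrM.
  have : `|u| * `|w| <= `|u| by rewrite ler_piMr.
  have : `|v| * `|r| <= `|v| by rewrite ler_piMr.
  lra.
split; rewrite -mulrBl normrM normfV ler_wpM2r ?invr_ge0 //.
  have -> : cross (y - p) b - cross (x - p) b =
    (re y - re x) * im b - (im y - im x) * re b by rewrite /cross !reimE; ring.
  exact: key.
have -> : cross a (y - p) - cross a (x - p) =
    (im y - im x) * re a - (re y - re x) * im a by rewrite /cross !reimE; ring.
exact: key.
Qed.

Lemma rhombus_closed F p a b x : rhombus_at F p a b -> ~ F x ->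
  exists2 e : R, 0 < e & forall y, box x e y -> ~ F y.
Proof.
move=> h nFx; have [_ _ cr] := rhombus_atW h.
have h0 : 0 < `|cross a b| by rewrite normr_gt0.
set u := fun z => cross (z - p) b / cross a b.
set v := fun z => cross a (z - p) / cross a b.
have Fuv z : F z <-> 0 <= u z <= 1 /\ 0 <= v z <= 1 by exact: mem_coord h z.
have [r r0 hr] : exists2 r : R, 0 < r & forall u' v',
    `|u' - u x| <= r -> `|v' - v x| <= r -> ~ (0 <= u' <= 1 /\ 0 <= v' <= 1).
  have [u0|u0] := ltP (u x) 0.
    exists (- u x / 2); first lra.
    by move=> u' v'; rewrite ler_norml => h1 _ [h2 _]; lra.
  have [u1|u1] := ltP 1 (u x).
    exists ((u x - 1) / 2); first lra.
    by move=> u' v'; rewrite ler_norml => h1 _ [h2 _]; lra.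
  have [v0|v0] := ltP (v x) 0.
    exists (- v x / 2); first lra.
    by move=> u' v' _; rewrite ler_norml => h1 [_ h2]; lra.
  have [v1|v1] := ltP 1 (v x).
    exists ((v x - 1) / 2); first lra.
    by move=> u' v' _; rewrite ler_norml => h1 [_ h2]; lra.
  by exfalso; apply/nFx/Fuv; rewrite u0 u1 v0 v1.
(* [cross_box] multiplies a box radius by [2 / |cross a b|], which turns this one into [r]. *)
exists (r * `|cross a b| / 2); first by rewrite divr_gt0 // mulr_gt0.
move=> y /(cross_box h)[]; rewrite mulrCA divff ?pnatr_eq0 // mulr1.
by rewrite mulfK ?gt_eqF // => h1 h2 /Fuv; apply: hr.
Qed.

Lemma uniform_pos (n : nat) (P : nat -> R -> Prop) :
  (forall i e e', P i e -> 0 < e' -> e' <= e -> P i e') ->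
  (forall i, exists2 e : R, 0 < e & P i e) ->
  exists2 e : R, 0 < e & forall i, (i < n)%N -> P i e.
Proof.
move=> mono ex; elim: n => [|n [e e0 IH]]; first by exists 1.
have [e' e'0 he'] := ex n.
exists (Num.min e e'); first by rewrite lt_min e0.
move=> i; rewrite ltnS leq_eqVlt => /orP[/eqP ->|/IH h].
  by apply: mono he' _ _; rewrite ?lt_min ?e0 // ge_min lexx orbT.
by apply: mono h _ _; rewrite ?lt_min ?e0 // ge_min lexx.
Qed.

Variable fs : set (set C).
Hypothesis tess : rhombic_tessellation fs.

Lemma face_rhombus F : fs F -> exists p a b, rhombus_at F p a b.
Proof. by case: tess => h _ _ _; exact: h. Qed.

Lemma face_cover z : exists2 F, fs F & F z.
Proof. by case: tess => _ _ h _; exact: h. Qed.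

(** With sides of length 1 the common area is also the distance between opposite sides: it is the
    scale for counting faces and the row height of horizontal tracks. *)
Lemma face_height : exists2 h : R, 0 < h &
  forall F p a b, fs F -> rhombus_at F p a b -> `|cross a b| = h.
Proof.
have [F fF _] := face_cover 0; have [p [a [b hF]]] := face_rhombus fF.
exists `|cross a b|; first by rewrite normr_gt0; case: (rhombus_atW hF).
move=> G q c d fG hG; case: tess => _ cong _ _.
exact: congruent_cross (cong _ _ fG fF) hG hF.
Qed.

(** Disjointness of interiors in usable form: the intersections that an edge-to-edge tessellation
    allows for distinct faces (empty, a point, a segment) are collinear. *)
Lemma face_overlap F G x y z : fs F -> fs G -> F x -> F y -> F z ->
  G x -> G y -> G z -> cross (y - x) (z - x) != 0 -> F = G.
Proof.
move=> fF fG Fx Fy Fz Gx Gy Gz cr; apply: contrapT => nFG.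
case: tess => _ _ _ /(_ F G fF fG nFG)[e|[w [_ _ e]]|[u [v [_ _ e]]]].
- by have : (F `&` G) x by []; rewrite e.
- have : (F `&` G) x by []; have : (F `&` G) y by []; rewrite e => ey ex.
  by move: cr; rewrite /cross ex ey subrr !mul0r subrr eqxx.
- have : (F `&` G) x by []; have : (F `&` G) y by []; have : (F `&` G) z by [].
  rewrite e => /segmentE[s [_ e1 e2]] /segmentE[s' [_ e1' e2']].
  move=> /segmentE[t [_ f1 f2]]; move/eqP: cr; apply.
  by rewrite /cross !reimE e1 e2 e1' e2' f1 f2; ring.
Qed.

Lemma face_meet F G x : fs F -> fs G -> F <> G -> F x -> G x ->
  (corner F x /\ corner G x) \/
  exists u v, [/\ is_side F u v, is_side G u v, F `&` G = segment u v &
     segment u v x].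
Proof.
move=> fF fG nFG Fx Gx; have FGx : (F `&` G) x by [].
case: tess => _ _ _ /(_ F G fF fG nFG)[e|[w [h1 h2 e]]|[u [v [h1 h2 e]]]].
- by move: FGx; rewrite e.
- by move: FGx; rewrite e => ->; left.
- by right; exists u, v; split => //; rewrite -e.
Qed.

Lemma shared_corners F G x y : fs F -> fs G -> F <> G -> x <> y ->
  corner F x -> corner F y -> corner G x -> corner G y ->
  is_side F x y /\ is_side G x y.
Proof.
move=> fF fG nFG nxy Fx Fy Gx Gy.
have FGx : (F `&` G) x by split; exact: corner_mem.
have FGy : (F `&` G) y by split; exact: corner_mem.
case: tess => _ _ _ /(_ F G fF fG nFG)[e|[w [_ _ e]]|[u [v [h1 h2 e]]]].
- by move: FGx; rewrite e.
- by move: FGx FGy; rewrite e => ex ey; case: nxy; rewrite ex ey.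
- rewrite e in FGx FGy.
  case: (corner_on_side h1 Fx FGx) => ex; case: (corner_on_side h1 Fy FGy) => ey.
  all: subst; try by []; by split=> //; exact: is_side_sym.
Qed.

(** Either [x] is a corner of some face, and then of every face through it, or all faces through [x]
    share the side containing [x], or there is just one face. Faces around a point can thus be
    compared at one corner, without knowing their cyclic order. *)
Lemma common_corner x : exists b, forall F, fs F -> F x -> corner F b.
Proof.
have [[F [fF Fx]]|nc] := pselect (exists F, fs F /\ corner F x).
  exists x => G fG Gx; have [<-//|nFG] := pselect (F = G).
  case: (face_meet fF fG nFG (corner_mem Fx) Gx) => [[]//|[u [v [h1 h2 _ h]]]].
  case: (corner_on_side h1 Fx h) => ->; first exact: is_side_cornerl h2.
  exact: is_side_cornerr h2.
have {}nc F : fs F -> ~ corner F x by move=> h1 h2; apply: nc; exists F.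
have [F fF Fx] := face_cover x.
have [[G [fG Gx nFG]]|h] := pselect (exists G, [/\ fs G, G x & F <> G]); last first.
  have [p [a [b hF]]] := face_rhombus fF.
  exists p => G fG Gx; have [<-|nFG] := pselect (F = G).
    exact: rhombus_at_corner hF.
  by exfalso; apply: h; exists G.
have [[/(nc _ fF)]//|[u [v [h1 h2 _ hx]]]] := face_meet fF fG nFG Fx Gx.
exists u => H fH Hx; have [<-|nFH] := pselect (F = H).
  exact: is_side_cornerl h1.
have [[/(nc _ fF)]//|[u' [v' [h1' h2' _ hx']]]] := face_meet fF fH nFH Fx Hx.
case: (side_through h1' h1 hx' hx (nc _ fF)) => -[-> _].
  exact: is_side_cornerl h2'.
exact: is_side_cornerr h2'.
Qed.

(** Faces are counted by their centres on a grid of mesh [r = h / 8]. A face contains the box of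
    radius [2 r] about its centre, so two faces with centres in one cell overlap and coincide.
    Finitely many cells matter near [x], and each holds at most one face, which is closed; the
    smallest of the resulting radii works. *)
Lemma locally_finite x : exists2 e : R, 0 < e &
  forall F y, fs F -> F y -> box x e y -> F x.
Proof.
have [h h0 hh] := face_height; pose r := h / 8.
have r0 : 0 < r by rewrite /r; lra.
pose key F (i j : nat) := exists p a b, [/\ rhombus_at F p a b,
  i%:R * r <= re (p - x) + re (a + b) / 2 + 3 < i.+1%:R * r &
  j%:R * r <= im (p - x) + im (a + b) / 2 + 3 < j.+1%:R * r].
have key_inj F G i j : fs F -> fs G -> key F i j -> key G i j -> F = G.
  move=> fF fG [p [a [b [hF]]]]; rewrite -(natr1 i) -(natr1 j) => k1 k2.
  move=> [q [c [d [hG]]]]; rewrite -(natr1 i) -(natr1 j) => k1' k2'.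
  pose z := q + (2^-1)%:C * (c + d).
  have near_mem H p' a' b' w : fs H -> rhombus_at H p' a' b' ->
      box (p' + (2^-1)%:C * (a' + b')) (2 * r) w -> H w.
    move=> fH hH /(cross_box hH); rewrite (hh _ _ _ _ fH hH).
    have [_ _ cr] := rhombus_atW hH.
    have -> : cross (p' + (2^-1)%:C * (a' + b') - p') b' / cross a' b' = 2^-1.
      by move: cr; rewrite /cross !reimE => cr; field.
    have -> : cross a' (p' + (2^-1)%:C * (a' + b') - p') / cross a' b' = 2^-1.
      by move: cr; rewrite /cross !reimE => cr; field.
    have -> : 2 * (2 * r) / h = 2^-1 by rewrite /r; field; rewrite gt_eqF.
    rewrite !ler_norml => -[g1 g2]; apply/(mem_coord hH); lra.
  have Gz w : box z (2 * r) w -> G w by exact: near_mem fG hG.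
  have Fz w : box z r w -> F w.
    move=> [w1 w2]; apply: (near_mem _ _ _ _ _ fF hF).
    move: w1 w2 k1 k2 k1' k2'; rewrite /box /z !reimE !ltr_norml.
    by move=> w1 w2 k1 k2 k1' k2'; split; lra.
  clear k1 k2 k1' k2'.
  have mem u v : `|u| <= r / 2 -> `|v| <= r / 2 ->
      F (z + (u +i* v)) /\ G (z + (u +i* v)).
    by move=> w1 w2; split; [apply/Fz/box_add|apply/Gz/box_add]; rewrite /=; lra.
  have r2 : 0 < r / 2 by lra.
  have r_r : `|r / 2| <= r / 2 by rewrite gtr0_norm.
  have o_r : `|0 : R| <= r / 2 by rewrite normr0 ltW.
  have [[F0 G0] [F1 G1]] := conj (mem _ _ o_r o_r) (mem _ _ r_r o_r).
  have [F2 G2] := mem _ _ o_r r_r.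
  apply: (face_overlap fF fG F0 F1 F2 G0 G1 G2).
  by rewrite /cross !reimE /= gt_eqF //; have := mulr_gt0 r2 r2; lra.
(* A face meeting the unit box about [x] has its centre within 2 of [x] in each coordinate; the
   shift by 3 in [key] then puts the shifted coordinates between 0 and 6. *)
have [N hN] : exists N : nat, 6 / r < N%:R.
  by exists (Num.truncn (6 / r)).+1; exact: truncnS_gt.
have key_ex F y : fs F -> F y -> box x 1 y -> exists i j, [/\ (i < N)%N, (j < N)%N & key F i j].
  move=> fF Fy [y1 y2]; have [p [a [b hF]]] := face_rhombus fF.
  have [s [t [hs ht e1 e2]]] := (rhombus_at_mem y hF).1 Fy.
  have [na nb _] := rhombus_atW hF.
  have half (u v w : R) : u * u + v * v = 1 -> 0 <= w <= 1 -> `|(2^-1 - w) * u| <= 2^-1.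
    move=> e hw; rewrite normrM -[leRHS]mulr1 ler_pM //.
      by rewrite ler_norml; lra.
    exact: unit_coord_le1 e.
  have bound (u : R) : 0 <= u < 6 -> exists2 i : nat, (i < N)%N & i%:R * r <= u < i.+1%:R * r.
    move=> /andP[u0 u6].
    have ur0 : 0 <= u / r by rewrite divr_ge0 // ltW.
    exists (Num.truncn (u / r)).
      rewrite -(ltr_nat R); apply: le_lt_trans hN.
      apply: (@le_trans _ _ (u / r)); first by rewrite truncn_le.
      by rewrite ler_pM2r ?invr_gt0 //; lra.
    by rewrite -ler_pdivlMr // -ltr_pdivrMr // truncn_itv.
  have := (half _ _ _ na hs, half _ _ _ nb ht).
  rewrite addrC in na; rewrite addrC in nb.
  have := (half _ _ _ na hs, half _ _ _ nb ht).
  rewrite !ler_norml => -[hi1 hi2] [hr1 hr2]; move: y1 y2; rewrite !ltr_norml => y1 y2.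
  have [i iN hi] : exists2 i : nat, (i < N)%N &
      i%:R * r <= re (p - x) + re (a + b) / 2 + 3 < i.+1%:R * r.
    by apply: bound; rewrite !reimE; clear -y1 hr1 hr2 e1; lra.
  have [j jN hj] : exists2 j : nat, (j < N)%N &
      j%:R * r <= im (p - x) + im (a + b) / 2 + 3 < j.+1%:R * r.
    by apply: bound; rewrite !reimE; clear -y2 hi1 hi2 e2; lra.
  by exists i, j; split => //; exists p, a, b.
pose P i j (e : R) := e <= 1 /\
  forall F y, fs F -> F y -> key F i j -> box x e y -> F x.
have boxW e e' y : e' <= e -> box x e' y -> box x e y by move=> h1 []; split; lra.
have P_mono i j e e' : P i j e -> 0 < e' -> e' <= e -> P i j e'.
  move=> [h1 h2] _ le; split; first lra.
  by move=> F y fF Fy k /(boxW _ _ _ le); exact: h2 fF Fy k.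
have P_ex i j : exists2 e : R, 0 < e & P i j e.
  have [[F [fF kF nF]]|nF] := pselect (exists F, [/\ fs F, key F i j & ~ F x]).
    have [p [a [b hF]]] := face_rhombus fF.
    have [e e0 he] := rhombus_closed hF nF.
    exists (Num.min e 1); first by rewrite lt_min e0 /=.
    split; first by rewrite ge_min lexx orbT.
    move=> G y fG Gy kG bx; exfalso; apply: (he y).
      by apply: boxW bx; rewrite ge_min lexx.
    by rewrite (key_inj F G i j).
  exists 1 => //; split=> // F y fF Fy kF _; apply: contrapT => nFx.
  by apply: nF; exists F.
have [e e0 he] : exists2 e : R, 0 < e & forall i, (i < N)%N ->
    forall j, (j < N)%N -> P i j e.
  apply: (@uniform_pos N (fun i e => forall j, (j < N)%N -> P i j e)).
    by move=> i e e' h1 e0' le j jN; exact: P_mono (h1 j jN) e0' le.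
  by move=> i; apply: uniform_pos; [exact: P_mono|exact: P_ex].
exists (Num.min e 1); first by rewrite lt_min e0 /=.
move=> F y fF Fy bx; have bx1 : box x 1 y.
  by apply: boxW bx; rewrite ge_min lexx orbT.
have [i [j [iN jN k]]] := key_ex F y fF Fy bx1.
have [_ h1] := he i iN j jN; apply: (h1 F y) => //.
by apply: boxW bx; rewrite ge_min lexx.
Qed.
End Tessellation.

(** * Exactness of locally exact forms *)

Section Poincare.
Variable R : realType.
Local Notation C := R[i].
Implicit Types (F G : set C) (p a b c d x y z : C) (s t : R).

Let reimE := (@reD R, @imD R, @reN R, @imN R, @reZ R, @imZ R, @re1 R, @im1 R).

Variable fs : set (set C).
Hypothesis tess : rhombic_tessellation fs.

(** A Lebesgue number: [locally_finite] and [common_corner] apply at each point of the compact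
    square, and compactness makes the radius uniform. *)
Lemma lebesgue_corner (rho : R) : exists2 e : R, 0 < e &
  forall x, `|re x| <= rho -> `|im x| <= rho -> exists b, forall F y,
    fs F -> F y -> box x e y -> corner F b.
Proof.
pose K : set (R * R) := `[- rho, rho]%classic `*` `[- rho, rho]%classic.
have cK : compact K by apply: compact_setX; exact: segment_compact.
pose P (e : R) (u : R * R) := exists b, forall F y,
    fs F -> F y -> box (u.1 +i* u.2) e y -> corner F b.
have : \forall e \near (0 : R)^'+, K `<=` P e.
  apply: (compact_near_coveringP K).1 => // u _.
  have [e e0 he] := locally_finite tess (u.1 +i* u.2).
  have [b hb] := common_corner tess (u.1 +i* u.2).
  exists (ball u (e / 2), [set i : R | i < e / 2]) => /=.
    split; first by apply: nbhsx_ballx; rewrite divr_gt0.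
    by apply: nbhs_right_lt; rewrite divr_gt0.
  move=> [u' e'] [/= [u1 u2] e'e]; exists b => F y fF Fy [y1 y2].
  apply: hb => //; apply: (he F y fF Fy).
  move: u1 u2 y1 y2; rewrite /ball /= !ltr_norml => u1 u2 y1 y2.
  by split; rewrite ltr_norml /=; lra.
move=> H; near (0 : R)^'+ => e.
exists e; first by near: e; exact: nbhs_right_gt.
move=> x x1 x2; have : K (re x, im x) by split; rewrite /= in_itv /= -ler_norml.
have Ke : K `<=` P e by near: e.
by move=> /Ke; rewrite /P; case: x {x1 x2}.
Unshelve. all: by end_near. Qed.

Lemma exists_natr_gt (r : R) : exists n : nat, r < n.+1%:R.
Proof. by exists (Num.truncn r); exact: truncnS_gt. Qed.

Section Holonomy.
Variables (U : zmodType) (phi : set C -> C -> U).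
Hypothesis compat : forall F G u v, fs F -> fs G -> corner F u -> corner F v ->
  corner G u -> corner G v -> phi F v - phi G v = phi F u - phi G u.

(* The point says where the flag sits; the value of the potential is the one
   carried by the corner. *)
Record flag := Flag {
  fpt : C; fface : set C; fcor : C;
  flagP : [/\ fs fface, fface fpt & corner fface fcor] }.

Lemma flag_exists z : exists x : flag, fpt x = z.
Proof.
have [F fF Fz] := face_cover tess z; have [p [a [b hF]]] := face_rhombus tess fF.
by exists (@Flag z F p (And3 fF Fz (rhombus_at_corner hF))).
Qed.

Definition flag_at z : flag := projT1 (cid (flag_exists z)).

Lemma fpt_flag_at z : fpt (flag_at z) = z.
Proof. exact: projT2 (cid (flag_exists z)). Qed.

Definition hub (X Y : flag) : C :=
  xget 0 [set b | corner (fface X) b /\ corner (fface Y) b].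

(** Parallel transport of a multivalued potential: the functions [phi F] of neighbouring faces
    differ by constants, and the second summand removes this difference, measured at a shared
    corner. By [compat] any shared corner gives the same value. *)
Definition jump (X Y : flag) : U :=
  (phi (fface Y) (fcor Y) - phi (fface X) (fcor X)) +
  (phi (fface X) (hub X Y) - phi (fface Y) (hub X Y)).

Lemma jumpE X Y b : corner (fface X) b -> corner (fface Y) b ->
  jump X Y = (phi (fface Y) (fcor Y) - phi (fface X) (fcor X)) +
             (phi (fface X) b - phi (fface Y) b).
Proof.
move=> bX bY; have [fX _ _] := flagP X; have [fY _ _] := flagP Y.
have [hX hY] : corner (fface X) (hub X Y) /\ corner (fface Y) (hub X Y).
  by rewrite /hub; case: xgetP => [z _ []//|/(_ b)[]].
by congr (_ + _); exact: compat.
Qed.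

Lemma jump_same X Y : fface X = fface Y ->
  jump X Y = phi (fface X) (fcor Y) - phi (fface X) (fcor X).
Proof. by rewrite /jump => ->; rewrite subrr addr0. Qed.

Lemma jump_here X Y : fcor X = fcor Y -> jump X Y = 0.
Proof.
move=> e; have [_ _ cX] := flagP X; have [_ _ cY] := flagP Y.
by rewrite (@jumpE X Y (fcor X)) // ?e // -e subrKA subrr.
Qed.

Variables (rho e : R).
Hypothesis hub_e : forall x, `|re x| <= rho -> `|im x| <= rho ->
  exists b, forall F y, fs F -> F y -> box x e y -> corner F b.

Definition inside (X : flag) := `|re (fpt X)| <= rho /\ `|im (fpt X)| <= rho.

(** All faces meeting the box share a corner [b]; with [b] as the hub of all three jumps the sum
    telescopes. *)
Lemma jump_cocycle X Y Z : 0 < e -> inside X ->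
  box (fpt X) e (fpt Y) -> box (fpt X) e (fpt Z) ->
  jump X Y + jump Y Z = jump X Z.
Proof.
move=> e0 [iX iX'] XY XZ; have [b hb] := hub_e iX iX'.
have cb W : box (fpt X) e (fpt W) -> corner (fface W) b.
  by have [fW mW _] := flagP W; exact: hb fW mW.
have bX := cb X (box_refl _ e0).
rewrite !(@jumpE _ _ b) //; try exact: cb.
by rewrite addrACA subrKA [X in X + _]addrC subrKA.
Qed.

Variable K : nat.

(* The flag [X] itself ends the ray, so that its own face and corner are used. *)
Definition ray (X : flag) (k : nat) : flag :=
  if k == K then X else flag_at ((k%:R / K%:R)%:C * fpt X).

Definition ray_sum (X : flag) (m : nat) : U :=
  \sum_(k < m) jump (ray X k) (ray X k.+1).

Hypotheses (K0 : (0 < K)%N) (rhoK : rho / K%:R < e / 2) (rho0 : 0 <= rho).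

Let KR0 : (0 : R) < K%:R. Proof. by rewrite ltr0n. Qed.

Lemma fpt_ray X k : fpt (ray X k) = (k%:R / K%:R)%:C * fpt X.
Proof.
rewrite /ray; case: eqP => [->|_]; last exact: fpt_flag_at.
by rewrite divff ?gt_eqF // mul1r.
Qed.

Lemma ray_scale k : (k <= K)%N -> 0 <= (k%:R / K%:R : R) <= 1.
Proof.
by move=> kK; rewrite divr_ge0 ?ler0n //= ler_pdivrMr // mul1r ler_nat.
Qed.

Lemma inside_ray X k : (k <= K)%N -> inside X -> inside (ray X k).
Proof.
move=> /ray_scale /andP[k0 k1] [h1 h2].
by split; rewrite fpt_ray !reimE normrM (ger0_norm k0);
  [apply: le_trans h1|apply: le_trans h2]; rewrite ler_piMl.
Qed.

Lemma box_ray X Y j k : (j <= K)%N -> (k <= K)%N -> (j <= k.+1)%N ->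
  (k <= j.+1)%N -> inside X -> box (fpt X) (e / 2) (fpt Y) ->
  box (fpt (ray X j)) e (fpt (ray Y k)).
Proof.
move=> jK kK jk kj [h1 h2] [b1 b2].
have /andP[j0 j1] := ray_scale jK; have /andP[k0 k1] := ray_scale kK.
have d : `|k%:R / K%:R - j%:R / K%:R| <= (K%:R)^-1 :> R.
  rewrite -mulrBl normrM normfV (gtr0_norm KR0) -[leRHS]mul1r ler_pM2r ?invr_gt0 //.
  have : k%:R <= j%:R + 1 :> R by rewrite natr1 ler_nat.
  have : j%:R <= k%:R + 1 :> R by rewrite natr1 ler_nat.
  by rewrite ler_norml; lra.
have key (x y : R) : `|x| <= rho -> `|y - x| < e / 2 ->
    `|k%:R / K%:R * y - j%:R / K%:R * x| < e.
  move=> hx hy.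
  have -> : k%:R / K%:R * y - j%:R / K%:R * x =
    k%:R / K%:R * (y - x) + (k%:R / K%:R - j%:R / K%:R) * x by ring.
  apply: (le_lt_trans (ler_normD _ _)).
  rewrite (normrM (k%:R / K%:R)) (normrM (k%:R / K%:R - j%:R / K%:R)).
  rewrite [e]splitr; apply: (@le_lt_trans _ _ (`|y - x| + rho / K%:R)).
    apply: lerD; first by rewrite (ger0_norm k0) ler_piMl.
    by rewrite mulrC; apply: ler_pM.
  exact: ltrD.
by split; rewrite !fpt_ray !reimE; apply: key.
Qed.

(* The triangle with vertices 0, [X], [Y] is cut into thin quadrilaterals. *)
Lemma ray_sum_thin X Y m : (m <= K)%N -> inside X -> inside Y ->
  box (fpt X) (e / 2) (fpt Y) ->
  ray_sum Y m - ray_sum X m = jump (ray X m) (ray Y m) - jump (ray X 0) (ray Y 0).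
Proof.
move=> + iX iY XY; have e0 : 0 < e.
  have h : 0 <= rho / K%:R by rewrite divr_ge0 // ltW.
  by have := le_lt_trans h rhoK; rewrite pmulr_lgt0.
elim: m => [|m IH] mK; first by rewrite /ray_sum !big_ord0 !subrr.
have XX : box (fpt X) (e / 2) (fpt X) by apply: box_refl; lra.
rewrite /ray_sum !big_ord_recr /= opprD addrACA -!/(ray_sum _ _) IH 1?ltnW //.
have mK' := ltnW mK; have m2 := leqnSn m; have m3 := leqW m2.
have c1 : jump (ray X m) (ray Y m) + jump (ray Y m) (ray Y m.+1) =
          jump (ray X m) (ray Y m.+1).
  by apply: jump_cocycle; [|exact: inside_ray|exact: box_ray..].
have c2 : jump (ray X m) (ray X m.+1) + jump (ray X m.+1) (ray Y m.+1) =
          jump (ray X m) (ray Y m.+1).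
  by apply: jump_cocycle; [|exact: inside_ray|exact: box_ray..].
rewrite addrAC; congr (_ - _).
by rewrite addrA c1 -c2 [X in X - _]addrC addrK.
Qed.

Lemma ray_sum_jump X Y : inside X -> inside Y ->
  box (fpt X) (e / 2) (fpt Y) -> ray_sum Y K - ray_sum X K = jump X Y.
Proof.
move=> iX iY XY; rewrite ray_sum_thin // [jump (ray X 0) _]jump_here.
  by rewrite subr0 /ray eqxx.
(* As [0 < K], both rays start at the one flag chosen at the origin, so the jump at the tip of the
   triangle vanishes. *)
have K00 : (0%N == K) = false by rewrite eq_sym -[LHS]negbK -lt0n K0.
by rewrite /ray K00 !mul0r.
Qed.
End Holonomy.
End Poincare.

(** * Chains of faces along a segment, connectedness and global potentials *)

Section Potential.
Variable R : realType.
Local Notation C := R[i].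
Implicit Types (F G : set C) (p a b c d x y z : C) (s t : R).

Let reimE := (@reD R, @imD R, @reN R, @imN R, @reZ R, @imZ R, @re1 R, @im1 R).

Variable fs : set (set C).
Hypothesis tess : rhombic_tessellation fs.

Definition in_square (rho : R) x := `|re x| <= rho /\ `|im x| <= rho.

Lemma in_square_segment rho x y z :
  in_square rho x -> in_square rho y -> segment x y z -> in_square rho z.
Proof.
have key (u v s : R) : `|u| <= rho -> `|v| <= rho -> 0 <= s <= 1 ->
    `|u + s * (v - u)| <= rho.
  move=> hu hv /andP[s0 s1].
  have -> : u + s * (v - u) = (1 - s) * u + s * v by ring.
  apply: (le_trans (ler_normD _ _)); rewrite !normrM (ger0_norm s0).
  rewrite (@ger0_norm _ (1 - s)) ?subr_ge0 //.
  have : (1 - s) * `|u| <= (1 - s) * rho by rewrite ler_wpM2l // subr_ge0.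
  have : s * `|v| <= s * rho by rewrite ler_wpM2l.
  by clear; lra.
move=> [x1 x2] [y1 y2] /segmentE[s [hs e1 e2]].
by split; rewrite ?e1 ?e2; exact: key.
Qed.

Lemma exists_div_lt (r e : R) : 0 <= r -> 0 < e -> exists2 n : nat,
  (0 < n)%N & r / n%:R < e.
Proof.
move=> r0 e0; have [n hn] := exists_natr_gt (r / e); exists n.+1 => //.
by rewrite ltr_pdivrMr ?ltr0n // mulrC -ltr_pdivrMr.
Qed.

Lemma exists_square (l : seq C) : exists2 rho : R, 0 <= rho &
  forall x, x \in l -> in_square rho x.
Proof.
elim: l => [|y l [r r0 hr]]; first by exists 0.
exists (r + `|re y| + `|im y|); first by rewrite !addr_ge0.
move=> x; rewrite inE => /orP[/eqP->|/hr[h1 h2]]; split.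
- by rewrite addrAC lerDr addr_ge0.
- by rewrite lerDr addr_ge0.
- by rewrite -addrA (le_trans h1) // lerDl addr_ge0.
- by rewrite -addrA (le_trans h2) // lerDl addr_ge0.
Qed.

Definition point_on p q t := p + t%:C * (q - p).

Lemma point_on_in_segment p q t : 0 <= t <= 1 -> segment p q (point_on p q t).
Proof. by move=> ht; exists t. Qed.

Lemma point_on0 p q : point_on p q 0 = p.
Proof. by rewrite /point_on mul0r addr0. Qed.

Lemma point_on1 p q : point_on p q 1 = q.
Proof. by rewrite /point_on mul1r addrC subrK. Qed.

Lemma box_point_on p q (e : R) (J j : nat) : (0 < J)%N ->
  (`|re (q - p)| + `|im (q - p)|) / J%:R < e ->
  box (point_on p q (j%:R / J%:R)) e (point_on p q (j.+1%:R / J%:R)).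
Proof.
move=> J0; have JR : (0 : R) < J%:R by rewrite ltr0n.
set r := (_ + _) => he.
have key (u v : R) : `|v| <= r ->
    `|u + j.+1%:R / J%:R * v - (u + j%:R / J%:R * v)| < e.
  move=> hv; apply: le_lt_trans he.
  have -> : u + j.+1%:R / J%:R * v - (u + j%:R / J%:R * v) = v / J%:R.
    by rewrite -natr1; field; rewrite gt_eqF.
  by rewrite normrM normfV (gtr0_norm JR) ler_pM2r ?invr_gt0.
by split; rewrite /point_on ?(reD p) ?(imD p) ?reZ ?imZ; apply: key;
  rewrite /r ?lerDl ?lerDr.
Qed.

Lemma step_itv (J j : nat) : (0 < J)%N -> (j <= J)%N -> 0 <= (j%:R / J%:R : R) <= 1.
Proof.
move=> J0 jJ; have JR : (0 : R) < J%:R by rewrite ltr0n.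
by rewrite divr_ge0 ?ler0n //= ler_pdivrMr // mul1r ler_nat.
Qed.

(** Consecutive points of a fine subdivision lie in faces with a common corner. This serves both to
    connect vertices and to carry a track height along a horizontal line. *)
Lemma segment_chain p q (Q : set C -> Prop) :
  (forall F G x y b, fs F -> fs G -> F x -> G y ->
     segment p q x -> segment p q y -> corner F b -> corner G b -> Q F -> Q G) ->
  forall F G, fs F -> fs G -> F p -> G q -> Q F -> Q G.
Proof.
move=> step F G fF fG Fp Gq QF.
have [rho rho0 hrho] := exists_square [:: p; q].
have pS : in_square rho p by apply: hrho; rewrite inE eqxx.
have qS : in_square rho q by apply: hrho; rewrite !inE eqxx orbT.
have [e e0 he] := lebesgue_corner tess rho.
have [J J0 hJ] := exists_div_lt (addr_ge0 (normr_ge0 (re (q - p))) (normr_ge0 (im (q - p)))) e0.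
have inS t : 0 <= t <= 1 -> in_square rho (point_on p q t).
  by move=> ht; apply: in_square_segment pS qS (point_on_in_segment _ _ ht).
suff H j : (j <= J)%N -> forall F', fs F' -> F' (point_on p q (j%:R / J%:R)) -> Q F'.
  by apply: (H J (leqnn J) G fG); rewrite divff ?point_on1 // pnatr_eq0 -lt0n.
elim: j => [|j IH] jJ F' fF' F'x.
  move: F'x; rewrite mul0r point_on0 => F'p.
  have [b hb] := common_corner tess p.
  by apply: (step F F' p p b) => //; [exact: segment_l..|exact: hb|exact: hb].
have [F1 fF1 F1x] := face_cover tess (point_on p q (j%:R / J%:R)).
have hj := step_itv J0 (ltnW jJ); have hj1 := step_itv J0 jJ.
have [i1 i2] := inS _ hj.
have [b hb] := he _ i1 i2.
apply: (step F1 F' _ _ b fF1 fF' F1x F'x) => //.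
- exact: point_on_in_segment.
- exact: point_on_in_segment.
- by apply: hb fF1 F1x _; exact: box_refl.
- by apply: hb fF' F'x _; exact: box_point_on.
- exact: IH (ltnW jJ) _ fF1 F1x.
Qed.

Definition adjC : rel C := fun x y => `[< edge fs x y >].

Definition reach (e : rel C) x y := exists2 s, path e x s & last x s = y.

Lemma reach_refl e x : reach e x x.
Proof. by exists [::]. Qed.

Lemma reach_trans (e : rel C) x y z : reach e x y -> reach e y z -> reach e x z.
Proof.
move=> [s1 p1 l1] [s2 p2 l2]; exists (s1 ++ s2); last by rewrite last_cat l1.
by rewrite cat_path p1 l1.
Qed.

Lemma reach1 (e : rel C) x y : e x y -> reach e x y.
Proof. by move=> h; exists [:: y]; rewrite //= h. Qed.

Lemma edge_sym x y : edge fs x y -> edge fs y x.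
Proof. by case=> F fF /is_side_sym; exists F. Qed.

Lemma edge_vertexl x y : edge fs x y -> vertices fs x.
Proof. by case=> F fF /is_side_cornerl; exists F. Qed.

Lemma edge_vertexr x y : edge fs x y -> vertices fs y.
Proof. by move/edge_sym/edge_vertexl. Qed.

Lemma corners_reach F x y : fs F -> corner F x -> corner F y -> reach adjC x y.
Proof.
move=> fF [a [b h]] cy; move: y cy.
have e1 : reach adjC x (x + a).
  by apply/reach1/asboolP; exists F => //; exact: rhombus_at_side h.
have e2 : reach adjC x (x + b).
  by apply/reach1/asboolP; exists F => //; exact: rhombus_at_side (rhombus_atC h).
apply: (corner_ind h) => //; first exact: reach_refl.
apply: (reach_trans e1); apply/reach1/asboolP; exists F => //.
exact: rhombus_at_side (rhombus_atC (rhombus_atN h)).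
Qed.

Lemma vertices_connected x y : vertices fs x -> vertices fs y -> reach adjC x y.
Proof.
move=> [F fF cx] [G fG cy].
pose Q H := forall z, corner H z -> reach adjC x z.
suff : Q G by apply.
apply: (@segment_chain x y Q _ F G) => //; [|exact: corner_mem..|].
  move=> F' G' _ _ b fF' fG' _ _ _ _ bF bG QF z hz.
  exact: reach_trans (QF b bF) (corners_reach fG' bG hz).
by move=> z; exact: corners_reach.
Qed.

Section Form.
Variables (U : zmodType) (om : C -> C -> U).
Hypothesis face_potential : forall F, fs F ->
  exists phi : C -> U, forall x y, is_side F x y -> om x y = phi y - phi x.

(** [H z] adds up the jumps along the ray from 0 to the vertex [z]. The number [K] of ray steps
    depends on the square, which is why the statement is local. *)
Lemma local_potential (rho : R) : 0 <= rho -> exists H : C -> U, forall x y,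
  edge fs x y -> in_square rho x -> in_square rho y -> om x y = H y - H x.
Proof.
move=> rho0.
have /choice[phi hphi] : forall F, exists phi : C -> U,
    fs F -> forall x y, is_side F x y -> om x y = phi y - phi x.
  move=> F; have [/face_potential[phi h]|nF] := pselect (fs F); first by exists phi.
  by exists (fun=> 0).
have compat F G u v : fs F -> fs G -> corner F u -> corner F v ->
    corner G u -> corner G v -> phi F v - phi G v = phi F u - phi G u.
  move=> fF fG Fu Fv Gu Gv; have [->|nFG] := pselect (F = G); first by rewrite !subrr.
  have [->//|nuv] := pselect (u = v).
  have [sF sG] := shared_corners tess fF fG nFG nuv Fu Fv Gu Gv.
  have := hphi G fG _ _ sG; rewrite (hphi F fF _ _ sF) => e.
  have -> : phi F v = phi G v - phi G u + phi F u by rewrite -e subrK.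
  by rewrite addrAC [_ - _ - _]addrAC subrr add0r addrC.
have [e e0 he] := lebesgue_corner tess rho.
have [K K0 hK] := exists_div_lt rho0 (divr_gt0 e0 (ltr0n _ 2)).
pose L X := ray_sum tess phi K X K.
have LJ X Y : inside rho X -> inside rho Y -> box (fpt X) (e / 2) (fpt Y) ->
    L Y - L X = jump phi X Y.
  by move=> iX iY; apply: (ray_sum_jump _ compat he).
have L_here X Y : inside rho X -> fpt X = fpt Y -> fcor X = fcor Y -> L X = L Y.
  move=> iX e1 e2; apply/eqP; rewrite eq_sym -subr_eq0 LJ ?jump_here //.
    by rewrite /inside -e1.
  by rewrite -e1; apply: box_refl; rewrite divr_gt0.
have /choice[vflag hv] : forall z, exists X : flag fs,
    vertices fs z -> fpt X = z /\ fcor X = z.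
  move=> z; have [[G fG cz]|nz] := pselect (vertices fs z).
    by exists (Flag (And3 fG (corner_mem cz) cz)).
  by exists (flag_at tess z).
exists (fun z => L (vflag z)) => x y [F fF sxy] ix iy.
have L_vertex z (h : [/\ fs F, F z & corner F z]) : in_square rho z ->
    L (vflag z) = L (Flag h).
  move=> iz; have [fF' _ cz] := h; have vz : vertices fs z by exists F.
  by have [e1 e2] := hv z vz; apply: L_here; rewrite // /inside e1.
have cx := is_side_cornerl sxy; have cy := is_side_cornerr sxy.
have hx := And3 fF (corner_mem cx) cx; have hy := And3 fF (corner_mem cy) cy.
rewrite (L_vertex y hy iy) (L_vertex x hx ix).
have [J J0 hJ] := exists_div_lt (addr_ge0 (normr_ge0 (re (y - x))) (normr_ge0 (im (y - x))))
  (divr_gt0 e0 (ltr0n _ 2)).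
have inS t : 0 <= t <= 1 -> in_square rho (point_on x y t).
  by move=> ht; apply: in_square_segment ix iy (point_on_in_segment _ _ ht).
(* The edge may be too long for a single jump, so the flag slides along it in small steps; face and
   corner stay fixed, hence each jump is 0 and the ray sum does not change. *)
have chain j : (j <= J)%N -> exists X : flag fs,
    [/\ fpt X = point_on x y (j%:R / J%:R), fface X = F, fcor X = x & L X = L (Flag hx)].
  elim: j => [|j IH] jJ.
    by exists (Flag hx); rewrite mul0r point_on0.
  have [X [X1 X2 X3 <-]] := IH (ltnW jJ).
  have hj := step_itv J0 (ltnW jJ); have hj1 := step_itv J0 jJ.
  have hY : [/\ fs F, F (point_on x y (j.+1%:R / J%:R)) & corner F x].
    by split=> //; apply: segment_side sxy (point_on_in_segment _ _ hj1).
  exists (Flag hY); split=> //; apply/eqP; rewrite -subr_eq0 LJ.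
  - by rewrite jump_here.
  - by rewrite /inside X1; exact: inS.
  - exact: inS.
  - by rewrite X1; exact: box_point_on.
have [X [X1 X2 X3 <-]] := chain J (leqnn J).
rewrite divff ?pnatr_eq0 -?lt0n // point_on1 in X1.
rewrite LJ.
- by rewrite jump_same X2 ?X3 //; exact: hphi.
- by rewrite /inside X1.
- by [].
- by rewrite X1; apply: box_refl; rewrite divr_gt0.
Qed.

Fixpoint path_sum z (l : seq C) : U :=
  if l is w :: l' then om z w + path_sum w l' else 0.

Lemma path_sum_potential (H : C -> U) (S : C -> Prop) z l :
  (forall x y, edge fs x y -> S x -> S y -> om x y = H y - H x) ->
  path adjC z l -> S z -> (forall w, w \in l -> S w) ->
  path_sum z l = H (last z l) - H z.
Proof.
move=> hH; elim: l z => [|w l IH] z /=; first by rewrite subrr.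
move=> /andP[/asboolP zw wl] Sz Sl.
have Sw : S w by apply: Sl; rewrite inE eqxx.
rewrite IH //; last by move=> v vl; apply: Sl; rewrite inE vl orbT.
by rewrite hH // addrC subrKA.
Qed.

(** Path sums from a fixed vertex involve no square; two of them are compared inside one square that
    contains both paths, where [local_potential] applies. *)
Lemma potential : exists H : C -> U, forall x y, edge fs x y -> om x y = H y - H x.
Proof.
have [F fF _] := face_cover tess 0; have [z0 [a [b hF]]] := face_rhombus tess fF.
have v0 : vertices fs z0 by exists F => //; exact: rhombus_at_corner hF.
have /choice[l hl] : forall z, exists l : seq C,
    vertices fs z -> path adjC z0 l /\ last z0 l = z.
  move=> z; have [vz|nz] := pselect (vertices fs z); last by exists [::].
  by case: (vertices_connected v0 vz) => l p1 p2; exists l.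
exists (fun z => path_sum z0 (l z)) => x y xy.
have [px lx] := hl x (edge_vertexl xy); have [py ly] := hl y (edge_vertexr xy).
have [rho rho0 hrho] := exists_square (x :: y :: z0 :: l x ++ l y).
have [H hH] := local_potential rho0.
rewrite (path_sum_potential hH py); last 2 first.
- by apply: hrho; rewrite !inE eqxx !orbT.
- by move=> w hw; apply: hrho; rewrite !inE mem_cat hw !orbT.
rewrite (path_sum_potential hH px); last 2 first.
- by apply: hrho; rewrite !inE eqxx !orbT.
- by move=> w hw; apply: hrho; rewrite !inE mem_cat hw !orbT.
rewrite lx ly opprB subrKA hH //; apply: hrho.
- by rewrite inE eqxx.
- by rewrite !inE eqxx orbT.
Qed.
End Form.
End Potential.

(** * Tracks with horizontal ties *)

Section Tracks.
Variable R : realType.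
Local Notation C := R[i].
Implicit Types (F G : set C) (p a b c d x y z : C) (s t : R).

Let reimE := (@reD R, @imD R, @reN R, @imN R, @reZ R, @imZ R, @re1 R, @im1 R).

Variable fs : set (set C).
Hypothesis tess : rhombic_tessellation fs.

Lemma side_neighbourhood F x y m : fs F -> is_side F x y -> segment x y m ->
  ~ corner F m -> exists2 e : R, 0 < e & forall G q, fs G -> G q -> box m e q ->
    F = G \/ is_side G x y.
Proof.
move=> fF sxy hm nc; have [e e0 he] := locally_finite tess m.
exists e => // G q fG Gq bq; have Gm := he G q fG Gq bq.
have [->|nFG] := pselect (F = G); first by left.
right; have [[]//|[u [v [s1 s2 _ hm']]]] :=
  face_meet tess fF fG nFG (segment_side sxy hm) Gm.
by case: (side_through sxy s1 hm hm' nc) => -[<- <-] //; exact: is_side_sym.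
Qed.

(** Both faces have height [h], so [b] and [b'] differ by a multiple of [a]. The witness [w] stands
    above the middle of the side, low enough that this shear moves its coordinate along [a] by at
    most 1/2; hence it lies in both faces. *)
Lemma face_same_side F G x a b b' : fs F -> fs G ->
  rhombus_at F x a b -> rhombus_at G x a b' -> 0 < cross a b * cross a b' -> F = G.
Proof.
move=> fF fG hF hG pos; have [h h0 hh] := face_height tess.
have [na nb cr] := rhombus_atW hF; have [_ nb' cr'] := rhombus_atW hG.
have kF := hh _ _ _ _ fF hF; have kG := hh _ _ _ _ fG hG.
have ek : cross a b' = cross a b.
  have : `|cross a b'| = `|cross a b| by rewrite kF kG.
  move/eqP; rewrite eqr_norm2 => /orP[/eqP //|/eqP e].
  by move: pos; rewrite e mulrN oppr_gt0 ltNge -expr2 sqr_ge0.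
have le1 (u v w r : R) : u * u + v * v = 1 -> w * w + r * r = 1 -> `|u * r - v * w| <= 1.
  move=> e1 e2; rewrite -(@ler_pXn2r _ 2) // ?nnegrE // expr1n real_normK ?num_real //.
  have : (u * r - v * w) ^+ 2 + (u * w + v * r) ^+ 2 = 1.
    have -> : (u * r - v * w) ^+ 2 + (u * w + v * r) ^+ 2 =
      (u * u + v * v) * (w * w + r * r) by ring.
    by rewrite e1 e2 mulr1.
  by have := sqr_ge0 (u * w + v * r); lra.
have h1 : h <= 1 by rewrite -kF; exact: le1.
pose w := x + ((2^-1)%:C * a + (h / 2)%:C * b).
have Fw : F w.
  apply/(rhombus_at_mem _ hF); exists 2^-1, (h / 2).
  by rewrite /w !reimE; split; lra.
have Gw : G w.
  apply/(mem_coord hG).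
  have -> : cross a (w - x) / cross a b' = h / 2.
    have -> : cross a (w - x) = h / 2 * cross a b.
      by rewrite /w /cross !reimE; ring.
    by rewrite -ek mulfK.
  have -> : cross (w - x) b' / cross a b' = 2^-1 + h * cross b b' / cross a b' / 2.
    by move: cr'; rewrite /w /cross !reimE => cr'; field.
  have : `|h * cross b b' / cross a b'| <= 1.
    rewrite normrM normfV kG normrM (gtr0_norm h0) mulrAC divff ?gt_eqF // mul1r.
    exact: le1.
  by rewrite ler_norml; lra.
have Fx := corner_mem (rhombus_at_corner hF); have Gx := corner_mem (rhombus_at_corner hG).
have Fxa := corner_mem (is_side_cornerr (rhombus_at_side hF)).
have Gxa := corner_mem (is_side_cornerr (rhombus_at_side hG)).
apply: (face_overlap tess fF fG Fx Fxa Fw Gx Gxa Gw).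
have -> : cross (x + a - x) (w - x) = h / 2 * cross a b.
  by rewrite /w /cross !reimE; ring.
by rewrite mulf_neq0 // gt_eqF // divr_gt0.
Qed.

Lemma side_midpoint F x a b : rhombus_at F x a b -> forall s, 0 < s < 1 ->
  segment x (x + a) (x + s%:C * a) /\ ~ corner F (x + s%:C * a).
Proof.
move=> hF s hs; have [na _ _] := rhombus_atW hF.
have seg : segment x (x + a) (x + s%:C * a).
  by exists s; [lra|rewrite [x + a]addrC addrK].
split=> // hc; case: (corner_on_side (rhombus_at_side hF) hc seg) => e.
  have [ea eb] : re (x + s%:C * a) = re x /\ im (x + s%:C * a) = im x by rewrite e.
  move: ea eb; rewrite !reimE => ea eb.
  have f1 : s * re a = 0 by lra.
  have f2 : s * im a = 0 by lra.
  have : s * (re a * re a + im a * im a) = 0 by rewrite mulrDr !mulrA f1 f2; ring.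
  by rewrite na; lra.
have [ea eb] : re (x + s%:C * a) = re (x + a) /\ im (x + s%:C * a) = im (x + a) by rewrite e.
move: ea eb; rewrite !reimE => ea eb.
have f1 : (1 - s) * re a = 0 by lra.
have f2 : (1 - s) * im a = 0 by lra.
have : (1 - s) * (re a * re a + im a * im a) = 0.
  by rewrite mulrDr !mulrA f1 f2; ring.
by rewrite na; lra.
Qed.

(** A point just beyond the midpoint of the side lies in a face other than [F]; that face contains
    the whole side by [side_neighbourhood] and lies opposite to [F] by [face_same_side]. *)
Lemma face_across F x a b : fs F -> rhombus_at F x a b ->
  exists G b', [/\ fs G, rhombus_at G x a b' & cross a b * cross a b' < 0].
Proof.
move=> fF hF; have [na nb cr] := rhombus_atW hF.
have half : 0 < (2^-1 : R) < 1 by lra.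
have [seg nc] := side_midpoint hF half.
have [e e0 he] := side_neighbourhood fF (rhombus_at_side hF) seg nc.
set m := x + (2^-1)%:C * a in seg nc he.
have [G fG Gq] := face_cover tess (m + (- (e / 2))%:C * b).
have bq : box m e (m + (- (e / 2))%:C * b).
  have nb' := nb; rewrite addrC in nb'.
  have e2 : 0 < e / 2 by rewrite divr_gt0.
  have ee : e / 2 < e by lra.
  by apply: box_add; rewrite !reimE normrM normrN (gtr0_norm e2);
    apply: le_lt_trans ee; rewrite ler_piMr ?(ltW e2) //;
    [exact: unit_coord_le1 nb|exact: unit_coord_le1 nb'].
have [eFG|sG] := he G _ fG Gq bq.
  exfalso; move: Gq; rewrite -eFG => /(mem_coord hF)[_].
  have -> : cross a (m + (- (e / 2))%:C * b - x) / cross a b = - (e / 2).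
    by move: cr; rewrite /m /cross !reimE => cr; field.
  lra.
case: sG => b'; rewrite [x + a]addrC addrK => hG; exists G, b'; split=> //.
rewrite ltNge; apply/negP => ge0.
have [_ _ cr'] := rhombus_atW hG.
have pos : 0 < cross a b * cross a b' by rewrite lt0r ge0 mulf_neq0.
have eFG := face_same_side fF fG hF hG pos.
move: Gq; rewrite -eFG => /(mem_coord hF)[_].
have -> : cross a (m + (- (e / 2))%:C * b - x) / cross a b = - (e / 2).
  by move: cr; rewrite /m /cross !reimE => cr; field.
lra.
Qed.

Variable h : R.
Hypotheses (h0 : 0 < h)
  (hh : forall F p a b, fs F -> rhombus_at F p a b -> `|cross a b| = h).

Lemma cross1 b : cross 1 b = im b.
Proof. by rewrite /cross !reimE mul1r mul0r subr0. Qed.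

Lemma edge_up_down z : edge fs z (z + 1) ->
  (exists b, [/\ fs (rhombus z 1 b), rhombus_at (rhombus z 1 b) z 1 b & im b = h]) /\
  (exists b, [/\ fs (rhombus z 1 b), rhombus_at (rhombus z 1 b) z 1 b & im b = - h]).
Proof.
move=> [F fF [b]]; rewrite [z + 1]addrC addrK => hF.
have [G [b' [fG hG]]] := face_across fF hF; rewrite !cross1 => neg.
have key H c : fs H -> rhombus_at H z 1 c ->
    [/\ fs (rhombus z 1 c), rhombus_at (rhombus z 1 c) z 1 c & im c = h \/ im c = - h].
  move=> fH hH; have [h1 h2 h3 h4 eH] := hH; rewrite eH in fH hH; split=> //.
  have := hh fH hH; rewrite cross1 => e.
  have [p|p] := leP 0 (im c); first by left; rewrite -e ger0_norm.
  by right; rewrite -e ltr0_norm ?opprK.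
have [f1 r1 i1] := key _ _ fF hF; have [f2 r2 i2] := key _ _ fG hG.
have hh0 : 0 < h * h by rewrite mulr_gt0.
case: i1 i2 => e1 [] e2; rewrite e1 e2 ?mulrNN ?mulrN ?mulNr in neg; try lra.
  by split; [exists b|exists b'].
by split; [exists b'|exists b].
Qed.

Definition strip (z beta : int -> C) (n : int) := rhombus (z n) 1 (beta n).

(** A track with horizontal ties, recorded by the left end [z n] of each tie. All rows have height
    [h], so the ordinates of the ties form an arithmetic progression and determine the index. *)
Definition vertical (z beta : int -> C) := forall n : int,
  [/\ fs (strip z beta n), rhombus_at (strip z beta n) (z n) 1 (beta n),
      z (n + 1) = z n + beta n & im (beta n) = h].

Lemma vertical_exists x : edge fs x (x + 1) ->
  exists z beta : int -> C, vertical z beta /\ z 0 = x.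
Proof.
move=> ex.
have /choice[up hup] : forall y, exists b, edge fs y (y + 1) ->
    [/\ fs (rhombus y 1 b), rhombus_at (rhombus y 1 b) y 1 b & im b = h].
  move=> y; have [/edge_up_down[[b hb] _]|n] := pselect (edge fs y (y + 1)); first by exists b.
  by exists 0.
have /choice[dn hdn] : forall y, exists b, edge fs y (y + 1) ->
    [/\ fs (rhombus y 1 b), rhombus_at (rhombus y 1 b) y 1 b & im b = - h].
  move=> y; have [/edge_up_down[_ [b hb]]|n] := pselect (edge fs y (y + 1)); first by exists b.
  by exists 0.
have edge_next F y b : fs F -> rhombus_at F y 1 b -> edge fs (y + b) (y + b + 1).
  by move=> fF /rhombus_atN2 /rhombus_at_side; exists F.
pose u n := iter n (fun y => y + up y) x; pose d n := iter n (fun y => y + dn y) x.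
have eu n : edge fs (u n) (u n + 1).
  by elim: n => //= n /hup[f r _]; exact: edge_next f r.
have ed n : edge fs (d n) (d n + 1).
  by elim: n => //= n /hdn[f r _]; exact: edge_next f r.
(* Downwards a face is found from its upper tie, so the strip below [d n] is described from its
   lower corner [d n.+1], with the reversed side [- dn (d n)]. *)
exists (fun k => match k with Posz n => u n | Negz n => d n.+1 end).
exists (fun k => match k with Posz n => up (u n) | Negz n => - dn (d n) end).
split=> // -[n|n].
  have [f r e] := hup _ (eu n); rewrite /strip; split=> //.
  by rewrite -PoszD addn1.
have [f r e] := hdn _ (ed n); rewrite /strip.
have r' := rhombus_atN2 r; have [_ _ _ _ eF] := r'.
rewrite -eF; split => //=; last by rewrite imN e opprK.
rewrite addrK; case: n {f r e r' eF} => [|n] //.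
by rewrite (_ : Negz n.+1 + 1 = Negz n) // !NegzE -[n.+2]addn1 PoszD opprD addrNK.
Qed.

Section OneTrack.
Variables (z beta : int -> C).
Hypothesis ver : vertical z beta.

Let T := strip z beta.

Lemma vertical_im n : im (z n) = im (z 0) + n%:~R * h.
Proof.
have step k : im (z (k + 1)) = im (z k) + h.
  by have [_ _ -> <-] := ver k; rewrite imD.
elim/int_rect: n => [|n IH|n IH]; first by rewrite mul0r addr0.
  by rewrite -[n.+1]addn1 PoszD step IH intrD mulrDl mul1r addrA.
have := step (- n.+1%:Z); rewrite -{1}[n.+1]addn1 PoszD opprD addrNK IH.
by rewrite !mulrNz -[n.+1]addn1 PoszD intrD !mulNr mulrDl mul1r; lra.
Qed.

Lemma vertical_im_inj m n : im (z m) = im (z n) -> m = n.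
Proof.
rewrite (vertical_im m) (vertical_im n) => /addrI /(mulIf (lt0r_neq0 h0)) /eqP.
by rewrite eqr_int => /eqP.
Qed.

Lemma tie_lr m n : z m <> z n + 1.
Proof.
move=> e; have emn : m = n by apply: vertical_im_inj; rewrite e imD im1 addr0.
by move: e; rewrite emn => /(congr1 (@complex.Re R)); rewrite reD re1; lra.
Qed.

Lemma strip_up n : rhombus_at (T n) (z (n + 1)) 1 (- beta n).
Proof. by have [_ r -> _] := ver n; exact: rhombus_atN2. Qed.

Lemma strip_mem n x : T n x <-> exists s t, [/\ 0 <= s <= 1, 0 <= t <= 1,
  re x = re (z n) + s + t * re (beta n) & im x = im (z n) + t * h].
Proof.
have [_ r _ e] := ver n; apply: (iff_trans (rhombus_at_mem x r)).
by split=> -[s [t [hs ht e1 e2]]]; exists s, t; split=> //;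
  move: e1 e2; rewrite ?re1 ?im1 ?e ?mulr1 ?mulr0 ?addr0.
Qed.

Lemma strip_corner n x : corner (T n) x ->
  [\/ x = z n, x = z n + 1, x = z (n + 1) | x = z (n + 1) + 1].
Proof.
have [_ r e _] := ver n; move: x; apply: (corner_ind r).
- by constructor 1.
- by constructor 2.
- by constructor 3.
- by constructor 4; rewrite e addrAC.
Qed.

Lemma strip_inj m n : T m = T n -> m = n.
Proof.
move=> e.
have im_ge k l : T k = T l -> im (z l) <= im (z k).
  move=> ekl; have [_ r _ _] := ver k; have := corner_mem (rhombus_at_corner r).
  rewrite -/(T k) ekl => /strip_mem[s [t [_ ht _ ->]]].
  by rewrite lerDl mulr_ge0 ?(ltW h0) //; case/andP: ht.
by apply: vertical_im_inj; apply/le_anti; rewrite !im_ge.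
Qed.

Lemma strip_shared n : shared_side (T n) (T (n + 1)) (z (n + 1)) (z (n + 1) + 1).
Proof.
split; first by move=> /strip_inj/eqP; rewrite -subr_eq0 opprD addrA subrr add0r.
- exact: rhombus_at_side (strip_up n).
- by have [_ r _ _] := ver (n + 1); exact: rhombus_at_side r.
Qed.

Lemma vertical_is_track : is_track fs T.
Proof.
move=> n; have [f r e _] := ver n; split=> //.
exists (z (n + 1)), 1, (- beta n); split; first exact: strip_up.
  exact: strip_shared.
have := strip_shared (n - 1); rewrite subrK => -[h1 h2 h3].
by rewrite e addrK; split => //; exact/nesym.
Qed.

Lemma vertical_tie n : tie T (z n) (z n + 1).
Proof. by exists (n - 1); have := strip_shared (n - 1); rewrite subrK. Qed.

Lemma tie_face F n : fs F -> is_side F (z n) (z n + 1) -> exists m, F = T m.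
Proof.
move=> fF [b]; rewrite [z n + 1]addrC addrK => r.
have [fT rT _ eb] := ver n; have [fT' _ _ eb'] := ver (n - 1).
have rT' := strip_up (n - 1); rewrite subrK in rT'.
have hb0 : im b != 0 by have [_ _] := rhombus_atW r; rewrite cross1.
have [p|p] := ltP 0 (im b).
  exists n; apply: (face_same_side fF fT r rT).
  by rewrite !cross1 eb mulr_gt0.
exists (n - 1); apply: (face_same_side fF fT' r rT').
rewrite !cross1 imN eb' mulrN -mulNr mulr_gt0 // oppr_gt0.
by rewrite lt_neqAle hb0.
Qed.

Definition is_tie x y := exists n, x = z n /\ y = z n + 1.

(** The form that is 1 along each tie from left to right, -1 backwards and 0 on the other edges is
    exact on every face: a constant potential off the track, [phi] on a strip. Its global potential
    tells the two sides of the track apart. *)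
Lemma track_height_exists : exists H : C -> int,
  (forall n, H (z n) = 0 /\ H (z n + 1) = 1) /\
  (forall x y, edge fs x y -> ~ is_tie x y -> ~ is_tie y x -> H x = H y).
Proof.
pose om x y : int := if `[< is_tie x y >] then 1 else if `[< is_tie y x >] then -1 else 0.
have tieN x y : is_tie x y -> ~ is_tie y x.
  by move=> [n [-> ->]] [m [/esym e1 _]]; exact: (@tie_lr m n).
have omN x y : om y x = - om x y.
  rewrite /om; case: asboolP => t1; case: asboolP => t2; rewrite ?opprK ?oppr0 //.
  by case: (tieN _ _ t1).
pose phi x : int := if `[< exists n, x = z n + 1 >] then 1 else 0.
have phi_r n : phi (z n + 1) = 1 by rewrite /phi; case: asboolP => // -[]; exists n.
have phi_l n : phi (z n) = 0 by rewrite /phi; case: asboolP => // -[m /tie_lr].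
have om_tie n : om (z n) (z n + 1) = 1 by rewrite /om; case: asboolP => // -[]; exists n.
have [H hH] : exists H : C -> int, forall x y, edge fs x y -> om x y = H y - H x.
  apply: (potential tess) => F fF.
  have [[n eF]|nF] := pselect (exists n, F = T n); last first.
    exists (fun=> 0) => x y sxy; rewrite subrr /om.
    case: asboolP => [[n [ex ey]]|_]; first by case: nF; apply: (@tie_face F n); rewrite // -ey -ex.
    case: asboolP => [[n [ex ey]]|//]; case: nF; apply: (@tie_face F n) => //.
    by rewrite -ey -ex; exact: is_side_sym.
  exists phi; rewrite eF; have [_ r e eb] := ver n.
  apply: (side_ind r).
  - by move=> x y exy; rewrite omN exy opprB.
  - by rewrite om_tie phi_r phi_l.
  - rewrite -e !phi_l subrr /om.
    case: asboolP => [[m [_ /tie_lr]]//|_].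
    by case: asboolP => [[m [_ /tie_lr]]//|].
  - rewrite addrAC -e !phi_r subrr /om.
    case: asboolP => [[m [/esym/tie_lr]]//|_].
    by case: asboolP => [[m [/esym/tie_lr]]//|].
  - by rewrite addrAC -e om_tie phi_r phi_l.
have Hz n : H (z (n + 1)) = H (z n).
  have [fT r e _] := ver n.
  have ed : edge fs (z n) (z (n + 1)).
    by rewrite e; exists (T n) => //; exact: rhombus_at_side (rhombus_atC r).
  apply/eqP; rewrite -subr_eq0 -hH // /om.
  case: asboolP => [[m [_ /tie_lr]]//|_].
  by case: asboolP => [[m [_ /tie_lr]]//|].
have Hz0 n : H (z n) = H (z 0).
  elim/int_rect: n => [//|n IH|n IH]; first by rewrite -[n.+1]addn1 PoszD Hz.
  by rewrite -IH -[LHS]Hz -[n.+1]addn1 PoszD opprD addrNK.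
exists (fun x => H x - H (z 0)); split.
  move=> n; rewrite Hz0 subrr; split=> //; rewrite -(Hz0 n) -hH ?om_tie //.
  by have [fT r _ _] := ver n; exists (T n) => //; exact: rhombus_at_side r.
move=> x y exy n1 n2; congr (_ - _); apply/esym/eqP; rewrite -subr_eq0 -hH // /om.
by case: asboolP => // _; case: asboolP.
Qed.
End OneTrack.
End Tracks.

Lemma int_eq_close (k n : int) : -1 < k - n < 1 -> k = n.
Proof. lia. Qed.

(** * Two tracks cannot each lie to the right of the other *)

Section Facing.
Variable R : realType.
Local Notation C := R[i].
Implicit Types (F G : set C) (p a b c d x y : C) (s t : R).

Let reimE := (@reD R, @imD R, @reN R, @imN R, @reZ R, @imZ R, @re1 R, @im1 R).

Variable fs : set (set C).
Hypothesis tess : rhombic_tessellation fs.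
Variable h : R.
Hypotheses (h0 : 0 < h)
  (hh : forall F p a b, fs F -> rhombus_at F p a b -> `|cross a b| = h).

Definition track_height (z : int -> C) (H : C -> int) :=
  (forall n, H (z n) = 0 /\ H (z n + 1) = 1) /\
  (forall x y, edge fs x y -> ~ is_tie z x y -> ~ is_tie z y x -> H x = H y).

Lemma height_off_track (z beta : int -> C) H F b v : vertical fs h z beta ->
  track_height z H -> fs F -> (forall k, F <> strip z beta k) ->
  corner F b -> corner F v -> H v = H b.
Proof.
move=> ver [_ Hc] fF nF [c [d r]] cv; move: v cv.
have step x y : is_side F x y -> H y = H x.
  move=> sxy; apply/esym/Hc; first by exists F.
    move=> [n [ex ey]]; rewrite ex ey in sxy.
    by have [m] := tie_face tess h0 ver fF sxy; exact: nF.
  move=> [n [ex ey]]; rewrite ex ey in sxy; move/is_side_sym: sxy => sxy.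
  by have [m] := tie_face tess h0 ver fF sxy; exact: nF.
have e1 : H (b + c) = H b by apply: step; exact: rhombus_at_side r.
apply: (corner_ind r) => //.
  by apply: step; exact: rhombus_at_side (rhombus_atC r).
by rewrite -e1; apply: step; exact: rhombus_at_side (rhombus_atC (rhombus_atN r)).
Qed.

Section TwoTracks.
Variables (z beta z' beta' : int -> C) (H : C -> int).
Hypotheses (ver : vertical fs h z beta) (ver' : vertical fs h z' beta').
Hypotheses (HH : track_height z H)
  (H1 : forall n, H (z' n) = 1 /\ H (z' n + 1) = 1).

Lemma height_strip m v : corner (strip z' beta' m) v -> H v = 1.
Proof.
move=> /(strip_corner ver')[] ->; [exact: (H1 m).1|exact: (H1 m).2| |].
  exact: (H1 (m + 1)).1.
exact: (H1 (m + 1)).2.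
Qed.

Lemma strip_neq n m : strip z beta n <> strip z' beta' m.
Proof.
move=> e; have [_ r _ _] := ver n; have := rhombus_at_corner r.
by rewrite e => /height_strip; rewrite (HH.1 n).1.
Qed.

(* Walk along a horizontal line from the strip of [z'] rightwards to that of [z]:
   the height [H] stays 1 on the way, but it is 0 just before arriving. *)
Lemma not_left n m t t' : 0 < t < 1 -> 0 <= t' <= 1 ->
  im (z n) + t * h = im (z' m) + t' * h ->
  re (z' m) + t' * re (beta' m) < re (z n) + t * re (beta n) -> False.
Proof.
move=> ht ht' eim ltre.
pose p := z' m + t'%:C * beta' m; pose X := z n + t%:C * beta n.
have [fT r ez eb] := ver n; have [fT' r' ez' eb'] := ver' m.
have reX : re X = re (z n) + t * re (beta n) by rewrite /X !reimE.
have imX : im X = im (z n) + t * h by rewrite /X !reimE eb.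
have rep : re p = re (z' m) + t' * re (beta' m) by rewrite /p !reimE.
have imp : im p = im X by rewrite imX eim /p !reimE eb'.
have ltpX : re p < re X by rewrite rep reX.
have [seg nc] := side_midpoint (rhombus_atC r) ht.
have [e e0 he] := side_neighbourhood tess fT (rhombus_at_side (rhombus_atC r)) seg nc.
pose eta := Num.min (e / 2) (re X - re p).
have eta0 : 0 < eta by rewrite lt_min; apply/andP; split; lra.
have eta1 : eta < e by apply: (@le_lt_trans _ _ (e / 2)); [rewrite ge_min lexx|lra].
have eta2 : eta <= re X - re p by rewrite ge_min lexx orbT.
pose q := X + (- eta)%:C * 1.
(* Only the strip with index [n] meets the horizontal line through [X], and on this line it begins
   at [X]; so the faces met strictly to the left are off the track and [H] is constant on the
   corners of each. *)
have off F x : fs F -> F x -> im x = im X -> re x < re X -> forall k, F <> strip z beta k.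
  move=> fF Fx ix rx k eF; move: Fx; rewrite eF => /(strip_mem ver)[s [u [hs hu e1 e2]]].
  have ekn : k = n.
    have := e2; rewrite ix imX (vertical_im ver n) (vertical_im ver k) => e3.
    have e4 : (k - n)%:~R * h = (t - u) * h by rewrite intrD mulrNz; lra.
    have /esym e5 := mulIf (lt0r_neq0 h0) e4.
    apply: int_eq_close.
    by rewrite -(ltr_int R) -[X in _ && X](ltr_int R) -e5 mulrNz; lra.
  subst k; have eu : u = t.
    have e3 : u * h = t * h by lra.
    exact: mulIf (lt0r_neq0 h0) _ _ e3.
  by move: rx; rewrite e1 eu reX; lra.
have imq : im q = im X by rewrite /q !reimE mulr0 addr0.
have req : re q = re X - eta by rewrite /q !reimE mulr1.
have [G fG Gq] := face_cover tess q.
have bq : box X e q.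
  by apply: box_add; rewrite !reimE ?mulr1 ?mulr0 ?normr0 // normrN gtr0_norm.
have nG := off G q fG Gq imq ltac:(rewrite req; lra).
have cG : corner G (z n).
  have [eG|] := he G q fG Gq bq; first by case: (nG n); rewrite -eG.
  exact: is_side_cornerl.
have Tp : strip z' beta' m p.
  by apply/(strip_mem ver'); exists 0, t'; rewrite rep imp imX eim; split; lra.
pose Q F := forall v, corner F v -> H v = 1.
suff /(_ _ cG) : Q G by rewrite (HH.1 n).1.
apply: (@segment_chain _ fs tess p q Q _ _ _ fT' fG Tp Gq); last first.
  by move=> v; exact: height_strip.
move=> F F' x y b fF fF' Fx F'y _ py bF bF' QF v cv.
have iy : im y = im X.
  by move/segmentE: py => [s [_ _ ->]]; rewrite imp imq; ring.
have ry : re y < re X.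
  move/segmentE: py => [s [hs -> _]]; rewrite req.
  have : s * (re X - eta - re p) <= re X - eta - re p by rewrite ler_piMl; lra.
  lra.
by rewrite (height_off_track ver HH fF' (off F' y fF' F'y iy ry) bF' cv) (QF b bF).
Qed.

(** If the left borders meet on the line, both strips contain the unit segment to the right of that
    point and a point above it, so they are the same face, against [strip_neq]. *)
Lemma not_aligned n m t t' : 0 < t < 1 -> 0 < t' < 1 ->
  im (z n) + t * h = im (z' m) + t' * h ->
  re (z' m) + t' * re (beta' m) = re (z n) + t * re (beta n) -> False.
Proof.
move=> ht ht' eim ere; apply: (@strip_neq n m).
have [fT r ez eb] := ver n; have [fT' r' ez' eb'] := ver' m.
have [_ nb _] := rhombus_atW r; have [_ nb' _] := rhombus_atW r'.
have := unit_coord_le1 nb; have := unit_coord_le1 nb'; rewrite !ler_norml => b1 b2.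
pose X := z n + t%:C * beta n.
(* The slants [beta n] and [beta' m] differ by at most 2 in abscissa, so [d <= 1/4] keeps the offset
   in [T'Y] within 1/2; the other bounds keep [t + d] and [t' + d] at most 1. *)
pose d := Num.min 4^-1 (Num.min (1 - t) (1 - t')).
have [d0 d1 [d2 d3]] : [/\ 0 < d, d <= 4^-1 & d <= 1 - t /\ d <= 1 - t'].
  split; first by rewrite !lt_min; apply/and3P; split; lra.
    by rewrite ge_min lexx.
  by rewrite !ge_min !lexx !orbT.
pose Y := X + ((2^-1)%:C * 1 + d%:C * beta n).
have re_bd : `|d * (re (beta n) - re (beta' m))| <= 2^-1.
  rewrite normrM (gtr0_norm d0); apply: (@le_trans _ _ (4^-1 * 2)); last lra.
  by apply: ler_pM => //; [exact: ltW|rewrite ler_norml; lra].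
move: re_bd; rewrite ler_norml mulrBr => re_bd.
have TX : strip z beta n X.
  by apply/(strip_mem ver); exists 0, t; rewrite /X !reimE eb; split; lra.
have T'X : strip z' beta' m X.
  by apply/(strip_mem ver'); exists 0, t'; rewrite /X !reimE eb; split; lra.
have TX1 : strip z beta n (X + 1).
  by apply/(strip_mem ver); exists 1, t; rewrite /X !reimE eb; split; lra.
have T'X1 : strip z' beta' m (X + 1).
  by apply/(strip_mem ver'); exists 1, t'; rewrite /X !reimE eb; split; lra.
have TY : strip z beta n Y.
  by apply/(strip_mem ver); exists 2^-1, (t + d); rewrite /Y /X !reimE eb; split; lra.
have T'Y : strip z' beta' m Y.
  apply/(strip_mem ver').
  exists (2^-1 + (d * re (beta n) - d * re (beta' m))), (t' + d).
  by rewrite /Y /X !reimE eb; split; lra.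
apply: (face_overlap tess fT fT' TX TX1 TY T'X T'X1 T'Y).
have -> : cross (X + 1 - X) (Y - X) = d * h.
  by rewrite /cross /Y !reimE eb; ring.
by rewrite mulf_neq0 // gt_eqF.
Qed.
End TwoTracks.

Lemma no_facing (z beta z' beta' : int -> C) H H' :
  vertical fs h z beta -> vertical fs h z' beta' ->
  track_height z H -> track_height z' H' ->
  (forall n, H (z' n) = 1 /\ H (z' n + 1) = 1) ->
  (forall n, H' (z n) = 1 /\ H' (z n + 1) = 1) -> False.
Proof.
move=> ver ver' HH HH' H1 H1'.
have [t [m [t' [ht ht' e]]]] : exists t (m : int) t', [/\ 0 < t < 1, 0 < t' < 1 &
    im (z 0) + t * h = im (z' m) + t' * h].
  have key t : exists m : int, exists2 t', 0 <= t' < 1 &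
      im (z 0) + t * h = im (z' m) + t' * h.
    pose c := (im (z 0) + t * h - im (z' 0)) / h.
    exists (Num.floor c), (c - (Num.floor c)%:~R).
      by have := floor_itv c; rewrite intrD; lra.
    by rewrite (vertical_im ver') /c; field; rewrite gt_eqF.
  (* The line must avoid the corners of both tracks. If the levels 1/2 and 1/3 of row 0 both ran
     through ties of [z'], their distance [h / 6] would be an integer multiple of [h]. *)
  have [m [t' ht' e]] := key 2^-1.
  have [t0|t0] := eqVneq t' 0; last by exists 2^-1, m, t'; split=> //; lra.
  have [m2 [t2 ht2 e2]] := key 3^-1.
  have [t20|t20] := eqVneq t2 0; last by exists 3^-1, m2, t2; split=> //; lra.
  have not6 (k : int) : 6 * k != 1 by clear; lia.
  exfalso; move: e e2; rewrite t0 t20 (vertical_im ver' m) (vertical_im ver' m2).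
  move=> e e2; have : (6 * (m - m2))%:~R * h = 1%:~R * h.
    by rewrite intrM intrD mulrNz; lra.
  by move=> /(mulIf (lt0r_neq0 h0)) /eqP; rewrite eqr_int (negbTE (not6 _)).
have [ht1 ht1'] : 0 <= t <= 1 /\ 0 <= t' <= 1 by lra.
have [lt|lt|eq] := ltgtP (re (z' m) + t' * re (beta' m)) (re (z 0) + t * re (beta 0)).
- exact: (not_left ver ver' HH H1 ht ht1' e lt).
- exact: (not_left ver' ver HH' H1' ht' ht1 (esym e) lt).
- exact: (not_aligned ver ver' HH H1 ht ht' e eq).
Qed.
End Facing.

(** * Slanted paths to a vertex with a right neighbour *)

Section RightOpen.
Variable R : realType.
Local Notation C := R[i].
Implicit Types (F G : set C) (p a b c d x y w : C) (s t : R).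

Variable fs : set (set C).
Hypothesis tess : rhombic_tessellation fs.

(** Reachability shaped for the propagation of zeros: induction on this predicate carries a zero of
    [G] back along slanted edges from a vertex with a right neighbour. *)
Inductive right_open : C -> Prop :=
| right_open_here w : edge fs w (w + 1) -> right_open w
| right_open_step w y : edge fs w y -> y - w <> 1 -> y - w <> -1 ->
    right_open y -> right_open w.

Definition slanted : rel C :=
  fun x y => `[< [/\ edge fs x y, y - x <> 1 & y - x <> -1] >].

Lemma right_open_reach x y : reach slanted x y -> right_open y -> right_open x.
Proof.
case=> l; elim: l x => [|v l IH] x /=; first by move=> _ ->.
move=> /andP[/asboolP[h1 h2 h3] pl] ll /(IH _ pl ll).
exact: right_open_step.
Qed.

(** The edges before the first one of direction 1 or -1 are slanted. A rightward one, or the lack of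
    any, proves [right_open w]; a leftward one yields [y]. The relation [e] is a parameter so that
    the path can be made to avoid the ties of a track. *)
Lemma first_unit_edge (e : rel C) w l : (forall x y, e x y -> edge fs x y) ->
  path e w l -> right_open (last w l) ->
  right_open w \/ exists2 y, reach slanted w y & e y (y - 1).
Proof.
move=> sub; elim: l w => [|v l IH] w /=; first by left.
move=> /andP[wv pl] /(IH _ pl) ih.
have [v1|v1] := pselect (v - w = 1).
  by left; apply: right_open_here; rewrite -v1 addrC subrK; exact: sub.
have [v2|v2] := pselect (v - w = -1).
  by right; exists w; [exact: reach_refl|rewrite -v2 addrC subrK].
case: ih => [ro|[y ry ey]].
  by left; apply: right_open_step ro => //; exact: sub.
right; exists y => //; apply: reach_trans ry; apply: reach1.
by apply/asboolP; split => //; exact: sub.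
Qed.

Lemma is_tie_succ (z : int -> C) x y : is_tie z x y -> y = x + 1.
Proof. by case=> n [-> ->]. Qed.

Lemma height_slanted z H x y : track_height fs z H -> reach slanted x y -> H x = H y.
Proof.
move=> [_ Hc] [l]; elim: l x => [|v l IH] x /=; first by move=> _ ->.
move=> /andP[/asboolP[h1 h2 h3] pl] ll; rewrite -(IH _ pl ll); apply: Hc => //.
  by move=> /is_tie_succ e; apply: h2; rewrite e addrC addKr.
by move=> /is_tie_succ e; apply: h3; rewrite e opprD addrA subrr add0r.
Qed.

Lemma tie_sym (T : int -> set C) x y : tie T x y -> tie T y x.
Proof. by case=> n [h1 h2 h3]; exists n; split=> //; exact: is_side_sym. Qed.

Lemma vertical_slanted h (z beta : int -> C) n : 0 < h -> vertical fs h z beta ->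
  slanted (z n) (z (n + 1)) /\ slanted (z n + 1) (z (n + 1) + 1).
Proof.
move=> h0 ver; have [f r e eb] := ver n.
have nb : beta n <> 1 /\ beta n <> -1.
  by split=> e1; move: eb h0; rewrite e1 /= ?oppr0 => <-; rewrite ltxx.
split; apply/asboolP; split.
- by rewrite e; exists (strip z beta n) => //; exact: rhombus_at_side (rhombus_atC r).
- by rewrite e addrC addKr; case: nb.
- by rewrite e addrC addKr; case: nb.
- rewrite e addrAC; exists (strip z beta n) => //.
  exact: rhombus_at_side (rhombus_atC (rhombus_atN r)).
- by rewrite opprD addrACA subrr addr0 e addrC addKr; case: nb.
- by rewrite opprD addrACA subrr addr0 e addrC addKr; case: nb.
Qed.

Lemma height_along z H h (z' beta' : int -> C) : track_height fs z H -> 0 < h ->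
  vertical fs h z' beta' -> H (z' 0) = 1 -> H (z' 0 + 1) = 1 ->
  forall n, H (z' n) = 1 /\ H (z' n + 1) = 1.
Proof.
move=> HH h0 ver e1 e2.
have step k : H (z' k) = H (z' (k + 1)) /\ H (z' k + 1) = H (z' (k + 1) + 1).
  have [s1 s2] := vertical_slanted k h0 ver.
  by split; apply: height_slanted HH (reach1 _).
elim/int_rect => [//|n [i1 i2]|n [i1 i2]].
  have -> : Posz n.+1 = n%:Z + 1 by rewrite -addn1 PoszD.
  by have [<- <-] := step n.
have e : - n.+1%:Z + 1 = - n%:Z by rewrite -addn1 PoszD opprD addrNK.
by have := step (- n.+1%:Z); rewrite e i1 i2.
Qed.

Hypothesis dir1 : edge_directions fs 1.
Hypothesis coh : forall T A, is_track fs T -> is_track_side fs T A ->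
    exists T', [/\ is_track fs T', coherent T' T & track_in T' A].

Lemma right_open_vertex w : vertices fs w -> right_open w.
Proof.
move=> vw; apply: contrapT => nw.
have [h h0 hh] := face_height tess.
have [p [q [epq e1]]] := dir1.
have rop : right_open p by apply: right_open_here; rewrite e1 addrC subrK.
have [l pl ll] := vertices_connected tess vw (edge_vertexl epq).
have adjW x y : adjC fs x y -> edge fs x y by move/asboolP.
rewrite -ll in rop.
(* As [w] is not right open, the path to the known horizontal edge first leaves the slanted class of
   [w] leftwards, at [y]; the track [T] through this edge has [y] on its right border. *)
have [//|[y ry /asboolP ey]] := first_unit_edge adjW pl rop.
have ny : ~ right_open y by move=> roy; apply/nw/(right_open_reach ry).
have ey1 : edge fs (y - 1) (y - 1 + 1) by rewrite subrK; exact: edge_sym.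
have [z [beta [ver z0]]] := vertical_exists tess h0 hh ey1.
have yE : y = z 0 + 1 by rewrite z0 subrK.
pose T := strip z beta.
have [T' [trT' cohT' inA]] := coh (vertical_is_track h0 ver)
  (ex_intro2 _ _ y (edge_vertexl ey) erefl).
(* Coherence makes a tie of [T'] horizontal, so its left end is right open, and [track_in] joins
   that end to [y] without using a tie of [T]. *)
have [u rou [k pk lk]] : exists2 u, right_open u &
    exists2 s, path (off_ties fs T) y s & last y s = u.
  have [f0 [p' [a [b [r sh _]]]]] := trT' 0.
  have t1 : tie T' p' (p' + a) by exists 0.
  have [t ht ea] := cohT' _ _ _ _ t1 (vertical_tie h0 ver 0).
  have sd := rhombus_at_side r.
  have [na _ _] := rhombus_atW r.
  move: ea; rewrite [p' + a]addrC [z 0 + 1]addrC !addrK mulr1 => ea.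
  have : t ^+ 2 = 1 by rewrite -na ea /= mulr0 addr0.
  move/eqP; rewrite sqrf_eq1 => /orP[|] /eqP et.
    exists p'; last exact: (inA 0 p' (is_side_cornerl sd)).
    by apply: right_open_here; exists (T' 0) => //; rewrite -[1]/(1%:C) -et -ea.
  exists (p' + a); last exact: (inA 0 _ (is_side_cornerr sd)).
  apply: right_open_here; exists (T' 0) => //.
  have -> : p' + a + 1 = p'.
    by rewrite ea et rmorphN rmorph1 addrNK.
  exact: is_side_sym.
have offW x x' : off_ties fs T x x' -> edge fs x x' by move=> /asboolP[].
rewrite -lk in rou.
(* The first argument is repeated from [y] along a path avoiding the ties of [T]; hence the new
   leftward edge, which starts the second track, is not a tie of [T]. *)
have [//|[y' ry' /asboolP[ey' nt']]] := first_unit_edge offW pk rou.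
have ey1' : edge fs (y' - 1) (y' - 1 + 1) by rewrite subrK; exact: edge_sym.
have [z' [beta' [ver' z0']]] := vertical_exists tess h0 hh ey1'.
have yE' : y' = z' 0 + 1 by rewrite z0' subrK.
have [H HH] := track_height_exists tess h0 ver.
have [H' HH'] := track_height_exists tess h0 ver'.
have two0 x : x <> x + 1 + 1.
  by move=> /(congr1 (@complex.Re R)); rewrite !reD re1; lra.
have Hy' : H (z' 0 + 1) = 1.
  by rewrite -yE' -(height_slanted HH ry') yE; exact: (HH.1 0).2.
have H0' : H (z' 0) = 1.
  rewrite -Hy' -yE' z0'; apply/esym/HH.2 => //.
    by move=> /is_tie_succ e; apply: (two0 (y' - 1)); rewrite subrK.
  move=> [n [en en']]; apply/nt'/tie_sym; rewrite en en'.
  exact: (vertical_tie h0 ver n).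
have H1 := height_along HH h0 ver' H0' Hy'.
have Hy : H' (z 0 + 1) = 1.
  by rewrite -yE (height_slanted HH' ry') yE'; exact: (HH'.1 0).2.
(* The edge from [z 0] to [y] is not a tie of [z'], because [H] is 0 at [z 0] and 1 at every
   [z' n]. *)
have H0 : H' (z 0) = 1.
  rewrite -Hy -yE z0; apply/esym/HH'.2 => //.
    by move=> /is_tie_succ e; apply: (two0 (y - 1)); rewrite subrK.
  move=> [n [en _]]; have := (H1 n).1; rewrite -en -z0; have [-> _] := HH.1 0.
  by [].
exact: (no_facing tess h0 ver ver' HH HH' H1 (height_along HH' h0 ver H0 Hy)).
Qed.
End RightOpen.

(** * The forward shift *)

Section FourCycle.
Variables (R : realType) (U : lmodType R[i]).
Local Notation C := R[i].
Implicit Types (F : set C) (p a b x y : C).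

Lemma four_cycle_potential (V : zmodType) (om : C -> C -> V) F p a b :
  rhombus_at F p a b -> (forall x y, om y x = - om x y) ->
  om p (p + a) + om (p + a) (p + a + b) = om p (p + b) + om (p + b) (p + a + b) ->
  exists phi : C -> V, forall x y, is_side F x y -> om x y = phi y - phi x.
Proof.
move=> r anti cyc; have [na nb nab nab' _] := r.
have a0 : a != 0 by rewrite -normr_gt0 na ltr01.
have b0 : b != 0 by rewrite -normr_gt0 nb ltr01.
have ab0 : a + b != 0 by rewrite addr_eq0; exact/eqP.
have pa : (p + a == p) = false by rewrite -subr_eq0 addrC addKr (negbTE a0).
have pb : (p + b == p) = false by rewrite -subr_eq0 addrC addKr (negbTE b0).
have pba : (p + b == p + a) = false.
  by rewrite (inj_eq (addrI p)); apply/negbTE/eqP/nesym.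
have pab : (p + a + b == p) = false.
  by rewrite -addrA -[X in _ == X]addr0 (inj_eq (addrI p)) (negbTE ab0).
have paba : (p + a + b == p + a) = false by rewrite -subr_eq0 addrC addKr (negbTE b0).
have pabb : (p + a + b == p + b) = false.
  by rewrite addrAC -[X in _ == X]addr0 (inj_eq (addrI (p + b))) (negbTE a0).
exists (fun x => if x == p then 0 else if x == p + a then om p (p + a) else
  if x == p + b then om p (p + b) else om p (p + a) + om (p + a) (p + a + b)).
apply: (side_ind r).
- by move=> x y e; rewrite anti e opprB.
- by rewrite pa !eqxx subr0.
- by rewrite pb pba !eqxx subr0.
- by rewrite pa pab paba pabb !eqxx [RHS]addrC addKr.
- by rewrite pb pba pab paba pabb !eqxx cyc [RHS]addrC addKr.
Qed.

Definition mean_form (f : C -> U) x y : U := (y - x) *: (2^-1 *: (f x + f y)).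

Lemma mean_formN f x y : mean_form f y x = - mean_form f x y.
Proof. by rewrite /mean_form -opprB scaleNr [f y + _]addrC. Qed.

(** The mean form of [Phi] closes up around the rhombus because both sides of the reduced identity
    equal [- a b / 4] times the sum of [f] over the four corners, which is symmetric in [a] and
    [b]. *)
Lemma mean_form_primitive (f Phi : C -> U) F : (exists p a b, rhombus_at F p a b) ->
  (forall x y, is_side F x y -> Phi y - Phi x = mean_form f x y) ->
  exists phi : C -> U, forall x y, is_side F x y -> mean_form Phi x y = phi y - phi x.
Proof.
move=> [p [a [b r]]] hPhi.
apply: (four_cycle_potential r); first exact: mean_formN.
have pE : p + b + a = p + a + b by rewrite addrAC.
have s1 := hPhi _ _ (rhombus_at_side r).
have s2 := hPhi _ _ (rhombus_at_side (rhombus_atC (rhombus_atN r))).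
have s3 := hPhi _ _ (rhombus_at_side (rhombus_atC r)).
have s4 := hPhi _ _ (rhombus_at_side (rhombus_atN (rhombus_atC r))).
have s5 := hPhi _ _ (rhombus_at_side (rhombus_atN2 r)).
move: s1 s2 s3 s5 {s4}; rewrite pE /mean_form.
have dd (x y : C) : x + y - x = y by rewrite addrC addKr.
have d1 : p + a - p = a by exact: dd.
have d2 : p + a + b - (p + a) = b by exact: dd.
have d3 : p + b - p = b by exact: dd.
have d4 : p + a + b - (p + b) = a by rewrite -pE; exact: dd.
rewrite d1 d2 d3 d4.
set f1 := f p; set f2 := f (p + a); set f3 := f (p + a + b); set f4 := f (p + b).
set P1 := Phi p; set P2 := Phi (p + a); set P3 := Phi (p + a + b); set P4 := Phi (p + b).
move=> e1 e2 e3 e4.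
suff : a *: (2^-1 *: ((P1 + P2) - (P4 + P3))) = b *: (2^-1 *: ((P1 + P4) - (P2 + P3))).
  rewrite !scalerBr => /eqP; rewrite subr_eq addrAC -subr_eq opprK => /eqP ->.
  by [].
have -> : P1 + P2 - (P4 + P3) = - (b *: (2^-1 *: (f1 + f4)) + b *: (2^-1 *: (f2 + f3))).
  by rewrite -e2 -e3 [RHS]opprD !opprB [in LHS]opprD addrACA.
have -> : P1 + P4 - (P2 + P3) = - (a *: (2^-1 *: (f1 + f2)) + a *: (2^-1 *: (f4 + f3))).
  by rewrite -e1 -e4 [RHS]opprD !opprB [in LHS]opprD addrACA.
rewrite !scalerN -!scalerDr !scalerA.
have -> : f1 + f4 + (f2 + f3) = f1 + f2 + (f4 + f3) by rewrite addrACA.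
by congr (- (_ *: _)); ring.
Qed.
End FourCycle.

Section Lattice.
Variables (R : realType) (L : rhombic_lattice R).
Local Notation C := R[i].
Let fs := faces L.
Let tess : rhombic_tessellation fs := facesP L.

Definition as_vertex (x : C) (hx : vertices fs x) : vtx L := SigSub (mem_set hx).

Lemma vertexP (v : vtx L) : vertices fs (val v).
Proof. exact: set_mem (valP v). Qed.

Lemma lift_path (v : vtx L) l : path (adjC fs) (val v) l ->
  exists l', path (@adj R L) v l' /\ val (last v l') = last (val v) l.
Proof.
elim: l v => [|x l IH] v /=; first by exists [::].
move=> /andP[/asboolP vx pl].
have vxx := edge_vertexr vx.
have [l' [pl' e]] := IH (as_vertex vxx) pl.
exists (as_vertex vxx :: l'); split=> //=.
by rewrite pl' andbT; apply/asboolP.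
Qed.

Lemma adj_connected (v w : vtx L) : exists l, path (@adj R L) v l /\ last v l = w.
Proof.
have [l pl ll] := vertices_connected tess (vertexP v) (vertexP w).
have [l' [pl' e]] := lift_path pl; exists l'; split=> //.
by apply: val_inj; rewrite e.
Qed.

Lemma adj_sym (v w : vtx L) : adj v w -> adj w v.
Proof. by move=> /asboolP h; apply/asboolP; exact: edge_sym. Qed.

Section Integral.
Variable U : lmodType C.
Implicit Types (f g : vtx L -> U) (v w : vtx L).

Lemma path_int_cat f v l1 l2 :
  path_int f v (l1 ++ l2) = path_int f v l1 + path_int f (last v l1) l2.
Proof. by elim: l1 v => [|w l IH] v /=; rewrite ?add0r // IH addrA. Qed.

Lemma path_int_rev f v l :
  path_int f (last v l) (rev (belast v l)) = - path_int f v l.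
Proof.
elim: l v => [|w l IH] v /=; first by rewrite oppr0.
rewrite rev_cons -cats1 path_int_cat IH opprD addrC; congr (_ + _).
have -> : last (last w l) (rev (belast w l)) = w.
  by case: l {IH} => [|x l] //=; rewrite rev_cons last_rcons.
by rewrite /= addr0 -opprB scaleNr [f w + _]addrC.
Qed.

Lemma integral_betweenE f v w l : discrete_analytic f -> path (@adj R L) v l ->
  last v l = w -> integral_between f v w = path_int f v l.
Proof.
move=> da pl ll; rewrite /integral_between; case: xgetP => [x _ [l' [pl' ll' ->]]|]; last first.
  by move=> /(_ (path_int f v l)); case; exists l.
have pr : path (@adj R L) w (rev (belast v l)).
  rewrite -ll rev_path; apply: sub_path pl => x' y'; exact: adj_sym.
have := da v (l' ++ rev (belast v l)).
rewrite cat_path pl' ll' pr last_cat ll' path_int_cat ll' -[in X in _ -> _ -> X]ll path_int_rev.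
have -> : last w (rev (belast v l)) = v.
  rewrite -ll; case: (l) => [|x' l0] //=; by rewrite rev_cons last_rcons.
by move=> /(_ isT erefl) /eqP; rewrite subr_eq0 => /eqP.
Qed.

Definition primitive f : vtx L -> U := integral_between f (vtx0 L).

Lemma primitive0 f : discrete_analytic f -> primitive f (vtx0 L) = 0.
Proof. by move=> da; rewrite /primitive (@integral_betweenE _ _ _ [::]). Qed.

Lemma primitive_step f v w : discrete_analytic f -> adj v w ->
  primitive f w - primitive f v = (val w - val v) *: (2^-1 *: (f v + f w)).
Proof.
move=> da vw; have [l [pl ll]] := adj_connected (vtx0 L) v.
have pl' : path (@adj R L) (vtx0 L) (rcons l w) by rewrite rcons_path pl ll.
rewrite /primitive (integral_betweenE da pl ll).
rewrite (integral_betweenE da pl' (last_rcons _ _ _)) -cats1 path_int_cat ll /=.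
by rewrite addr0 addrC addKr.
Qed.

Lemma Zplus0 f : discrete_analytic f -> Zplus f (vtx0 L) = 0.
Proof.
move=> da; rewrite /Zplus -/(primitive f (vtx0 L)) primitive0 //.
by rewrite subrr scaler0 addr0.
Qed.

Lemma Zplus_step f v w : discrete_analytic f -> adj v w ->
  Zplus f w = Zplus f v + ((1 + (val w - val v)) / 2) *: f v
              - ((1 - (val w - val v)) / 2) *: f w.
Proof.
move=> da vw; have := primitive_step da vw; rewrite /Zplus -!/(primitive f _).
move: (val w - val v) => e /eqP; rewrite subr_eq => /eqP ->.
rewrite !scalerBr !scalerDr !scalerA !mulrDl !mulNr !scalerDl !scaleNr !mul1r opprB.
rewrite [X in _ = X + _ + _]addrAC subrKA -!addrA; congr (_ + _).
by rewrite addrC -!addrA [RHS]addrCA; congr (_ + _); rewrite [RHS]addrCA.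
Qed.

Lemma path_int_potential f (H : C -> U) v l :
  (forall x y : vtx L, adj x y ->
     (val y - val x) *: (2^-1 *: (f x + f y)) = H (val y) - H (val x)) ->
  path (@adj R L) v l -> path_int f v l = H (val (last v l)) - H (val v).
Proof.
move=> hH; elim: l v => [|w l IH] v /=; first by rewrite subrr.
by move=> /andP[vw pl]; rewrite IH // hH // addrC subrKA.
Qed.

(** Brings lattice functions into the scope of [potential], which speaks of functions on [C]; edges
    only read the values at vertices. *)
Definition extend f (x : C) : U :=
  if pselect (vertices fs x) is left hx then f (as_vertex hx) else 0.

Lemma extendE f v : extend f (val v) = f v.
Proof.
rewrite /extend; case: pselect => [hx|[]]; last exact: vertexP.
by congr f; apply: val_inj.
Qed.

Lemma extend_side F f x y : fs F -> is_side F x y ->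
  exists v w, [/\ x = val v, y = val w & adj v w].
Proof.
move=> fF sxy; have exy : edge fs x y by exists F.
exists (as_vertex (edge_vertexl exy)), (as_vertex (edge_vertexr exy)).
by split=> //; apply/asboolP.
Qed.

Lemma Zplus_discrete_analytic f : discrete_analytic f -> discrete_analytic (Zplus f).
Proof.
move=> da.
pose P := extend (primitive f); pose fe := extend f; pose f0 := f (vtx0 L).
have gE v : Zplus f v = - 2^-1 *: fe (val v) + (2^-1 *: f0 + P (val v)).
  rewrite /Zplus -/(primitive f v) /P /fe !extendE scalerBr scaleNr addrCA -addrA.
  by rewrite addrCA.
have lin c (u u' : C -> U) x y : mean_form (fun x => c *: u x + u' x) x y =
    c *: mean_form u x y + mean_form u' x y.
  rewrite /mean_form addrACA -scalerDr [in LHS](scalerDr 2^-1) [LHS]scalerDr.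
  congr (_ + _).
  by rewrite !scalerA; congr (_ *: _); ring.
have [H hH] : exists H : C -> U, forall x y, edge fs x y ->
    mean_form (fun x => - 2^-1 *: fe x + (2^-1 *: f0 + P x)) x y = H y - H x.
  apply: (potential tess) => F fF.
  have hP x y : is_side F x y -> P y - P x = mean_form fe x y.
    move=> sxy; have [v [w [-> -> vw]]] := extend_side f fF sxy.
    by rewrite /P /mean_form /fe !extendE primitive_step.
  have [phi hphi] := mean_form_primitive (face_rhombus tess fF) hP.
  (* The mean forms of the three summands of [Zplus f] have primitives on a face: [P] for [f],
     [x *: f0] for the constant, and the [phi] of [mean_form_primitive] for [P]. *)
  exists (fun x => - 2^-1 *: P x + (2^-1 *: (x *: f0) + phi x)) => x y sxy.
  rewrite lin (lin _ (fun=> f0)) -hP // hphi //.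
  have -> : mean_form (fun=> f0) x y = y *: f0 - x *: f0.
    have two : 2^-1 *: (f0 + f0) = f0.
      by rewrite -mulr2n -[f0 *+ 2]scaler_nat scalerA mulVf ?scale1r ?pnatr_eq0.
    by rewrite /mean_form two scalerBl.
  by rewrite !scalerBr opprD [RHS]addrACA; congr (_ + _); rewrite opprD [RHS]addrACA.
move=> v l pl ll; rewrite (path_int_potential (H := H)) ?ll ?subrr //.
move=> x y /asboolP /hH <-; by rewrite !gE.
Qed.

Lemma iter_Zplus_discrete_analytic f n :
  discrete_analytic f -> discrete_analytic (iter n (@Zplus R L U) f).
Proof. by move=> da; elim: n => //= n; exact: Zplus_discrete_analytic. Qed.
End Integral.
End Lattice.

(** * Hilbert spaces and adjoints *)

Section Hilbert.
Variable R : realType.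
Local Notation C := R[i].

Definition cabs (c : C) : R := complex.Re `|c|.

Lemma cabsE (c : C) : `|c| = (cabs c)%:C.
Proof. by rewrite /cabs RRe_real // normr_real. Qed.

Lemma cabs_ge0 (c : C) : 0 <= cabs c.
Proof. by rewrite -lecR -cabsE normr_ge0. Qed.

Lemma cabsM (c d : C) : cabs (c * d) = cabs c * cabs d.
Proof. by apply: (@complexI R); rewrite rmorphM -!cabsE normrM. Qed.

Lemma cabs_real (r : R) : 0 <= r -> cabs r%:C = r.
Proof. by move=> r0; apply: (@complexI R); rewrite -cabsE ger0_norm // ler0c. Qed.

Lemma cabs_conj (c : C) : cabs (Num.conj c) = cabs c.
Proof. by apply: (@complexI R); rewrite -!cabsE norm_conjC. Qed.

Lemma cvg_dominated (u v : nat -> R) (l : R) : (forall n, `|u n - l| <= v n) ->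
  v @ \oo --> (0 : R) -> u @ \oo --> l.
Proof.
move=> uv v0; apply/subr_cvg0.
apply: (@squeeze_cvgr _ _ _ _ (fun n => - v n) v) => //.
  by near=> n; rewrite -ler_norml.
by rewrite -oppr0; exact: cvgN.
Unshelve. all: by end_near. Qed.

Section Norm.
Variable H : hilbertType R.
Implicit Types (x y z : H) (t : R).

Lemma hnorm_ge0 x : 0 <= hnorm x.
Proof. by rewrite -lecR -normE_hnorm normr_ge0. Qed.

Lemma hnorm0 : hnorm (0 : H) = 0.
Proof. by rewrite /hnorm normr0. Qed.

Lemma hnorm_eq0 x : hnorm x = 0 -> x = 0.
Proof. by move=> e; apply/normr0_eq0; rewrite normE_hnorm e. Qed.

Lemma hnorm_leD x y : hnorm (x + y) <= hnorm x + hnorm y.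
Proof. by rewrite -lecR rmorphD /= -!normE_hnorm; exact: ler_normD. Qed.

Lemma hnorm_opp x : hnorm (- x) = hnorm x.
Proof. by rewrite /hnorm normrN. Qed.

Lemma hnorm_subC x y : hnorm (x - y) = hnorm (y - x).
Proof. by rewrite -hnorm_opp opprB. Qed.

Lemma hnormZ (c : C) x : hnorm (c *: x) = cabs c * hnorm x.
Proof. by apply: (@complexI R); rewrite rmorphM /= -!normE_hnorm -cabsE normrZ. Qed.

(** The minimisation runs over real parameters and so sees the real part; imaginary parts are
    recovered by inserting a factor [i]. *)
Definition rin x y : R := complex.Re (inner x y).

Lemma inner_conj x y : inner x y = Num.conj (inner y x).
Proof. by rewrite hermC /= expr0 mul1r. Qed.

Lemma rinC x y : rin x y = rin y x.
Proof. by rewrite /rin inner_conj; case: (inner y x). Qed.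

Lemma rinDl x y z : rin (x + y) z = rin x z + rin y z.
Proof. by rewrite /rin linearDl reD. Qed.

Lemma rinDr x y z : rin z (x + y) = rin z x + rin z y.
Proof. by rewrite rinC rinDl ![rin z _]rinC. Qed.

Lemma rinNl x z : rin (- x) z = - rin x z.
Proof. by rewrite /rin linearNl reN. Qed.

Lemma rinNr x z : rin z (- x) = - rin z x.
Proof. by rewrite rinC rinNl rinC. Qed.

Lemma rin0l z : rin 0 z = 0.
Proof. by rewrite /rin linear0l. Qed.

Lemma rin0r z : rin z 0 = 0.
Proof. by rewrite rinC rin0l. Qed.

Lemma rinZl t x y : rin (t%:C *: x) y = t * rin x y.
Proof. by rewrite /rin linearZl_LR /= reZ. Qed.

Lemma rinZr t x y : rin y (t%:C *: x) = t * rin y x.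
Proof. by rewrite rinC rinZl rinC. Qed.

Lemma rin_suml (I : Type) (r : seq I) (f : I -> H) y :
  rin (\sum_(i <- r) f i) y = \sum_(i <- r) rin (f i) y.
Proof.
elim: r => [|i r IH]; first by rewrite !big_nil rin0l.
by rewrite !big_cons rinDl IH.
Qed.

Lemma rin_sumr (I : Type) (r : seq I) (f : I -> H) y :
  rin y (\sum_(i <- r) f i) = \sum_(i <- r) rin y (f i).
Proof. by rewrite rinC rin_suml; apply: eq_bigr => i _; rewrite rinC. Qed.

Lemma rin_scale (c : C) x y : rin (c *: x) y = rin x (Num.conj c *: y).
Proof. by rewrite /rin linearZl_LR linearZr_LR /= conjCK. Qed.

Lemma rin_norm x : rin x x = hnorm x ^+ 2.
Proof. by rewrite /rin inner_norm normE_hnorm -rmorphXn. Qed.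

Lemma rin_nondeg x : (forall y, rin x y = 0) -> x = 0.
Proof.
by move=> /(_ x)/eqP; rewrite rin_norm sqrf_eq0 => /eqP; exact: hnorm_eq0.
Qed.

Lemma hnorm_expand x y t :
  hnorm (x + t%:C *: y) ^+ 2 = hnorm x ^+ 2 + 2 * t * rin x y + t ^+ 2 * hnorm y ^+ 2.
Proof.
rewrite -!rin_norm rinDl !rinDr !rinZl !rinZr [rin y x]rinC; ring.
Qed.

Lemma rin_le x y : `|rin x y| <= hnorm x * hnorm y.
Proof.
have [y0|y0] := eqVneq (hnorm y) 0.
  by rewrite (hnorm_eq0 y0) rin0r normr0 hnorm0 mulr0.
have yp : 0 < hnorm y by rewrite lt_neqAle eq_sym y0 hnorm_ge0.
rewrite -(@ler_pXn2r _ 2) // ?nnegrE ?mulr_ge0 ?hnorm_ge0 // real_normK ?num_real //.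
have := sqr_ge0 (hnorm (x + (- rin x y / hnorm y ^+ 2)%:C *: y)).
rewrite hnorm_expand.
have -> : hnorm x ^+ 2 + 2 * (- rin x y / hnorm y ^+ 2) * rin x y +
   (- rin x y / hnorm y ^+ 2) ^+ 2 * hnorm y ^+ 2 =
   (hnorm x ^+ 2 * hnorm y ^+ 2 - rin x y ^+ 2) / hnorm y ^+ 2 by field.
by rewrite pmulr_lge0 ?invr_gt0 ?exprn_gt0 // subr_ge0 exprMn.
Qed.

Lemma hcvgP (u : nat -> H) (l : H) :
  u @ \oo --> l <-> (fun n => hnorm (u n - l)) @ \oo --> (0 : R).
Proof.
split.
  move=> /cvgrPdist_lt ul; apply/cvgrPdist_lt => e e0.
  have := ul e%:C; rewrite ltcR => /(_ e0); apply: filterS => n.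
  by rewrite distrC normE_hnorm ltcR sub0r normrN ger0_norm ?hnorm_ge0.
move=> /cvgrPdist_lt ul; apply/cvgrPdist_lt => e e0.
(* The norm of [H] takes values in [R[i]], where a positive [e] is automatically real. *)
have eE : e = (complex.Re e)%:C by rewrite RRe_real // gtr0_real.
have e1 : 0 < complex.Re e by rewrite -ltcR -eE.
apply: filterS (ul _ e1) => n.
by rewrite sub0r normrN ger0_norm ?hnorm_ge0 // eE distrC normE_hnorm ltcR.
Qed.

Lemma hcauchy (u : nat -> H) :
  (forall e : R, 0 < e -> exists K, forall m n, (K <= m)%N -> (K <= n)%N ->
     hnorm (u m - u n) < e) -> exists l : H, u @ \oo --> l.
Proof.
move=> hu; suff : cvg (u @ \oo) by move=> h; exists (lim (u @ \oo)).
apply/cauchy_cvgP; apply: cauchy_exP => e e0.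
have eE : e = (complex.Re e)%:C by rewrite RRe_real // gtr0_real.
have e1 : 0 < complex.Re e by rewrite -ltcR -eE.
have [K hK] := hu _ e1; exists (u K), K => // n /= Kn.
rewrite -ball_normE /= eE normE_hnorm ltcR.
exact: hK.
Qed.

Lemma rin_cvg (u : nat -> H) l y : u @ \oo --> l ->
  (fun n => rin (u n) y) @ \oo --> rin l y.
Proof.
move=> /hcvgP ul; apply: (cvg_dominated (v := fun n => hnorm (u n - l) * hnorm y)).
  by move=> n; rewrite -rinNl -rinDl; exact: rin_le.
by rewrite -(mul0r (hnorm y)); apply: cvgM => //; exact: cvg_cst.
Qed.

Lemma hnorm_cvg (u : nat -> H) l : u @ \oo --> l ->
  (fun n => hnorm (u n)) @ \oo --> hnorm l.
Proof.
move=> /hcvgP ul; apply: (cvg_dominated _ ul) => n; rewrite ler_norml.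
have := hnorm_leD (u n - l) l; have := hnorm_leD (l - u n) (u n).
by rewrite !subrK (hnorm_subC l); lra.
Qed.
End Norm.
End Hilbert.

(** * Series with geometric bounds *)

Section Series.
Variable R : realType.
Local Notation C := R[i].

Lemma cvg_le_bound (u : nat -> R) (l B : R) : u @ \oo --> l ->
  (forall n, u n <= B) -> l <= B.
Proof.
by move=> ul uB; apply: (cvgr_to_le ul); exact: nearW.
Qed.

Lemma geometric_to0 (K rho e : R) : 0 <= rho < 1 -> 0 < e ->
  exists N, forall n, (N <= n)%N -> K * rho ^+ n < e.
Proof.
move=> /andP[r0 r1] e0.
have h : (fun n => K * rho ^+ n) @ \oo --> (0 : R).
  by rewrite -(mulr0 K); apply: cvgMr; apply: cvg_expr; rewrite ger0_norm.
have := (@cvgrPdist_lt _ _ _ _ _ _ _).1 h e e0.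
move=> [N _ hN]; exists N => n Nn; apply: (le_lt_trans (ler_norm _)).
by rewrite -[X in `|X|]opprK normrN -sub0r; exact: hN.
Qed.

Section HSeries.
Variable H : hilbertType R.

(** The difference of powers makes the induction on [m] exact, since
    [rho^m = (rho^m - rho^(m+1)) / (1 - rho)]. *)
Lemma hseries_tail (x : nat -> H) (K rho : R) : 0 <= rho < 1 ->
  (forall n, hnorm (x n) <= K * rho ^+ n) -> forall n m, (n <= m)%N ->
  hnorm (series x m - series x n) <= K / (1 - rho) * (rho ^+ n - rho ^+ m).
Proof.
move=> /andP[r0 r1] hx n m; elim: m => [|m IH].
  by rewrite leqn0 => /eqP ->; rewrite !subrr hnorm0 mulr0.
rewrite leq_eqVlt => /orP[/eqP <-|]; first by rewrite !subrr hnorm0 mulr0.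
rewrite ltnS => /IH {}IH.
have -> : series x m.+1 - series x n = (series x m - series x n) + x m.
  by rewrite /series /= big_nat_recr //= addrAC.
have h1 := hnorm_leD (series x m - series x n) (x m).
apply: (le_trans h1); apply: (le_trans (lerD IH (hx m))).
rewrite exprS le_eqVlt; apply/orP; left; apply/eqP; field.
by rewrite subr_eq0 gt_eqF.
Qed.

Lemma hseries_geometric (x : nat -> H) (K rho : R) : 0 <= rho < 1 ->
  (forall n, hnorm (x n) <= K * rho ^+ n) ->
  exists l : H, series x @ \oo --> l /\ hnorm l <= K / (1 - rho).
Proof.
move=> hr hx; have tail := hseries_tail hr hx; have /andP[r0 r1] := hr.
have K0 : 0 <= K by have := hx 0%N; rewrite expr0 mulr1; apply: le_trans; exact: hnorm_ge0.
have Kr : 0 <= K / (1 - rho) by rewrite divr_ge0 // subr_ge0 ltW.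
have [l hl] : exists l : H, series x @ \oo --> l.
  apply: hcauchy => e e0.
  have [N hN] := geometric_to0 (K / (1 - rho)) hr (divr_gt0 e0 (ltr0n _ 2)).
  have small m : (N <= m)%N -> hnorm (series x m - series x N) < e / 2.
    move=> Nm; apply: le_lt_trans (tail _ _ Nm) _; apply: le_lt_trans (hN N (leqnn N)).
    by rewrite ler_wpM2l // gerBl exprn_ge0.
  exists N => m n Nm Nn.
  have -> : series x m - series x n = series x m - series x N - (series x n - series x N).
    by rewrite opprB addrA subrK.
  by apply: (le_lt_trans (hnorm_leD _ _)); rewrite hnorm_opp [e]splitr ltrD // small.
exists l; split=> //; apply: (cvg_le_bound (hnorm_cvg hl)) => m.
have s0 : series x 0%N = 0 by rewrite /series /= big_geq.
have := tail 0%N m (leq0n m); rewrite s0 subr0 expr0.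
move=> h; apply: (le_trans h); rewrite -[leRHS]mulr1 ler_wpM2l // gerBl.
exact: exprn_ge0.
Qed.
End HSeries.

Lemma rseries_geometric (x : nat -> R) (K rho : R) : 0 <= rho < 1 ->
  (forall n, `|x n| <= K * rho ^+ n) -> cvgn (series x).
Proof.
move=> /andP[r0 r1] hx; apply: normed_cvg.
have K0 : 0 <= K by have := hx 0%N; rewrite expr0 mulr1; exact: le_trans.
apply: (series_le_cvg (v_ := geometric K rho)) => //.
- by move=> n; rewrite /= normr_ge0.
- by move=> n; rewrite /geometric /= mulr_ge0 // exprn_ge0.
- by apply: is_cvg_geometric_series; rewrite ger0_norm.
Qed.
End Series.

(** * Riesz representation by minimisation *)

Section Riesz.
Variables (R : realType) (V : lmodType R[i]).
Variables (P : V -> Prop) (q phi : V -> R) (B : V -> V -> R) (A : R) (x0 : V).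
Implicit Types (x y : V) (t : R).
Hypotheses (Px0 : P x0)
  (P_lin : forall x y t, P x -> P y -> P (x + t%:C *: y))
  (q_lin : forall x y t, P x -> P y ->
     q (x + t%:C *: y) = q x + 2 * t * B x y + t ^+ 2 * q y)
  (phi_lin : forall x y t, P x -> P y -> phi (x + t%:C *: y) = phi x + t * phi y)
  (Bxx : forall x, P x -> B x x = q x) (q_ge0 : forall x, P x -> 0 <= q x)
  (phi_le : forall x, P x -> 2 * phi x <= q x + A).

(** The setting is abstract because it serves twice: for adjoints, where [q] is the squared norm of
    a complete space, and for families of kernel functions, where [q] may be degenerate and the
    limit is formed coefficientwise. *)
Let J x := q x - 2 * phi x.

(* A minimising sequence of [q - 2 phi] is Cauchy for [q] by the parallelogram
   identity, and the first variation at the minimum shows that it represents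
   [phi]. *)
Lemma riesz_sequence : exists x : nat -> V, exists M : R, [/\
  forall k, P (x k),
  forall k l, q (x k - x l) <= 2 / k.+1%:R + 2 / l.+1%:R,
  forall y k, P y -> (B (x k) y - phi y) ^+ 2 <= (q y + 1) / k.+1%:R &
  forall k, exists2 D, D ^+ 2 <= M / k.+1%:R & q (x k) <= A + D].
Proof.
pose S : set R := [set r | exists2 x, P x & r = J x].
have S_lb : lbound S (- A).
  by move=> _ [x Px ->]; have := phi_le Px; rewrite /J; lra.
have hasS : has_inf S by split; [exists (J x0), x0|exists (- A)].
pose m := inf S.
have mA : - A <= m by apply: lb_le_inf => //; exists (J x0), x0.
have mJ x : P x -> m <= J x.
  by move=> Px; apply: ge_inf; [case: hasS|exists x].
have /choice[x hx] : forall k : nat, exists x, P x /\ J x < m + k.+1%:R^-1.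
  move=> k; have k0 : 0 < k.+1%:R^-1 :> R by rewrite invr_gt0 ltr0n.
  by have [_ [x Px ->] lt] := inf_adherent k0 hasS; exists x.
have Px k : P (x k) by case: (hx k).
have Jx k : J (x k) < m + k.+1%:R^-1 by case: (hx k).
have k1 k : k.+1%:R^-1 <= 1 :> R by rewrite invf_le1 ?ltr0n // ler1n.
have k0 k : 0 < k.+1%:R^-1 :> R by rewrite invr_gt0 ltr0n.
have half y : P y -> P (y + (- 2^-1)%:C *: y) /\
    J (y + (- 2^-1)%:C *: y) = q y / 4 - phi y.
  move=> Py; split; first exact: P_lin.
  by rewrite /J q_lin // phi_lin // Bxx //; field.
have vary y k : P y -> (B (x k) y - phi y) ^+ 2 <= (q y + 1) / k.+1%:R.
  move=> Py; have Q0 := q_ge0 Py; have Q1 : 0 < q y + 1 by lra.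
  have [D DE] : exists D, D = B (x k) y - phi y by eexists.
  (* This is the minimiser of the variation in [t], with [q y + 1] in place of [q y] so that the
     denominator is positive. *)
  rewrite -DE; pose t := - D / (q y + 1).
  have := mJ _ (P_lin t (Px k) Py); have := Jx k.
  rewrite /J q_lin // phi_lin //; move: (k.+1%:R^-1) => e hj hm.
  have tD : t * D = t * B (x k) y - t * phi y by rewrite DE mulrBr.
  have : 0 <= e + 2 * (t * D) + t ^+ 2 * q y by lra.
  have -> : e + 2 * (t * D) + t ^+ 2 * q y = e - D ^+ 2 / (q y + 1) - t ^+ 2.
    by rewrite /t; field; rewrite gt_eqF.
  move=> h; rewrite mulrC -ler_pdivrMr //.
  by have := sqr_ge0 t; lra.
(* [phi_le] at half of [x k] bounds [phi (x k)] by [q (x k) / 4 + A], so [q = J + 2 phi] leaves at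
   least half of [q] on the left. *)
have bounded k : q (x k) <= 2 * (m + 1 + 2 * A).
  have [h1 h2] := half _ (Px k); have := phi_le h1.
  rewrite phi_lin // q_lin // Bxx // => hp.
  by move: (Jx k) (k1 k); rewrite /J; move: (k.+1%:R^-1) => e hj he; lra.
exists x, (4 * (2 * (m + 1 + 2 * A) + 1)); split=> //.
- move=> k l; have Ps := P_lin 1 (Px k) (Px l).
  have [h1 h2] := half _ Ps; have := mJ _ h1; rewrite h2.
  have -> : x k - x l = x k + (- 1)%:C *: x l by rewrite rmorphN rmorph1 scaleN1r.
  rewrite !q_lin // phi_lin //; move: (Jx k) (Jx l); rewrite /J.
  by move: (k.+1%:R^-1) (l.+1%:R^-1) => e e' hk hl; lra.
(* Here [q = 2 (q - phi) - J], where [- J <= A] and [q - phi] is small by the variation in the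
   direction [x k] itself. *)
- move=> k; exists (2 * (B (x k) (x k) - phi (x k))).
    rewrite exprMn -[2 ^+ 2]/(2 * 2) -natrM -mulrA ler_pM2l ?ltr0n //.
    apply: (le_trans (vary _ _ (Px k))); rewrite ler_pM2r // lerD2r.
    exact: bounded.
  by have := mJ _ (Px k); rewrite Bxx // /J; lra.
Qed.
End Riesz.

Section Adjoint.
Variables (R : realType) (M N : hilbertType R).
Local Notation C := R[i].

Lemma harmonic_small (K e : R) : 0 < e -> exists n : nat, forall k,
  (n <= k)%N -> K / k.+1%:R < e.
Proof.
move=> e0; have [n hn] := exists_natr_gt (`|K| / e); exists n => k nk.
rewrite ltr_pdivrMr ?ltr0n //; apply: (le_lt_trans (ler_norm K)).
move: hn; rewrite ltr_pdivrMr // mulrC => hn; apply: (lt_le_trans hn).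
by rewrite ler_pM2l // ler_nat.
Qed.

Lemma cvg_sq_harmonic (u : nat -> R) (l K : R) :
  (forall k, (u k - l) ^+ 2 <= K / k.+1%:R) -> u @ \oo --> l.
Proof.
move=> h; apply/cvgrPdist_lt => e e0.
have [n hn] := harmonic_small K (exprn_gt0 2 e0).
exists n => // k /= nk; rewrite -(@ltr_pXn2r _ 2) // ?nnegrE ?(ltW e0) //.
rewrite real_normK ?num_real // -sqrrN opprB.
exact: le_lt_trans (h k) (hn k nk).
Qed.

Lemma Rcvg_unique (u : nat -> R) (a b : R) : u @ \oo --> a -> u @ \oo --> b -> a = b.
Proof.
by move=> /(cvg_lim (@Rhausdorff R)) <- /(cvg_lim (@Rhausdorff R)) <-.
Qed.

Lemma bop_linear (T : bounded_op M N) (c : C) x y : T (c *: x + y) = c *: T x + T y.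
Proof. by have /asboolP[lT _] := bop_prop T; exact: lT. Qed.

Lemma bop0 (T : bounded_op M N) : T 0 = 0.
Proof.
have := bop_linear T (-1) 0 0; rewrite scaleN1r addr0 oppr0 => ->.
by rewrite scaleN1r addNr.
Qed.

Lemma bopD (T : bounded_op M N) x y : T (x + y) = T x + T y.
Proof. by have := bop_linear T 1 x y; rewrite !scale1r. Qed.

Lemma bopZ (T : bounded_op M N) c x : T (c *: x) = c *: T x.
Proof. by have := bop_linear T c x 0; rewrite bop0 !addr0. Qed.

Lemma bop_scaleE (c : C) (T : bounded_op M N) x : (c *: T) x = c *: T x.
Proof. by []. Qed.

Lemma bop_bounded (T : bounded_op M N) : exists2 k : R, 0 <= k &
  forall x, hnorm (T x) <= k * hnorm x.
Proof.
have /asboolP[_ [k hk]] := bop_prop T; exists `|k| => // x.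
by apply: (le_trans (hk x)); rewrite ler_wpM2r ?hnorm_ge0 // ler_norm.
Qed.

(** Riesz for the real part of [inner (T x) y]: the bound with [A = (k |y|)^2] is Cauchy-Schwarz
    followed by [2 s t <= s^2 + t^2], and completeness of [M] provides the limit of the minimising
    sequence. *)
Lemma adjoint_vector (T : bounded_op M N) y :
  exists t : M, forall x, inner (T x) y = inner x t.
Proof.
have [k k0 hk] := bop_bounded T.
have [] := @riesz_sequence R M (fun=> True) (fun x => hnorm x ^+ 2)
  (fun x => rin (T x) y) (@rin R M) ((k * hnorm y) ^+ 2) 0.
- by [].
- by [].
- by move=> u v t _ _; exact: hnorm_expand.
- by move=> u v t _ _; rewrite bopD bopZ rinDl rinZl.
- by move=> u _; exact: rin_norm.
- by move=> u _; exact: sqr_ge0.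
- move=> u _; have := rin_le (T u) y; have := sqr_ge0 (hnorm u - k * hnorm y).
  have : hnorm (T u) * hnorm y <= k * hnorm u * hnorm y.
    by rewrite ler_wpM2r ?hnorm_ge0.
  rewrite sqrrB; have := ler_norm (rin (T u) y).
  have -> : hnorm u * (k * hnorm y) = k * hnorm u * hnorm y by ring.
  by rewrite mulr2n; lra.
move=> x [K [_ cau rep _]].
have [t xt] : exists t : M, x @ \oo --> t.
  apply: hcauchy => e e0.
  have [n hn] := harmonic_small 4 (exprn_gt0 2 e0).
  exists n => p r np nr; rewrite -(@ltr_pXn2r _ 2) // ?nnegrE ?hnorm_ge0 ?(ltW e0) //.
  apply: (le_lt_trans (cau p r)); move: (hn p np) (hn r nr).
  by move: (p.+1%:R^-1) (r.+1%:R^-1) => e1 e2; lra.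
have rep_t u : rin (T u) y = rin u t.
  rewrite [RHS]rinC.
  have h1 : (fun n => rin (x n) u) @ \oo --> rin (T u) y.
    exact: cvg_sq_harmonic (fun n => rep u n I).
  have h2 := rin_cvg (y := u) xt.
  by rewrite (Rcvg_unique h1 h2).
exists t => u; apply: complex_eqP; first exact: rep_t.
(* Replacing [u] by [i u] extracts the imaginary parts from the real identity. *)
have := rep_t ('i%C *: u).
rewrite /rin bopZ !linearZl_LR /= !(mulrC 'i%C) !ReiNIm.
exact: oppr_inj.
Qed.

Lemma dual_bound (T : bounded_op M N) y t (k : R) : 0 <= k ->
  (forall x, hnorm (T x) <= k * hnorm x) ->
  (forall x, inner (T x) y = inner x t) -> hnorm t <= k * hnorm y.
Proof.
move=> k0 hk ht.
have [t0|t0] := eqVneq (hnorm t) 0; first by rewrite t0 mulr_ge0 ?hnorm_ge0.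
have tp : 0 < hnorm t by rewrite lt_neqAle eq_sym t0 hnorm_ge0.
rewrite -(ler_pM2l tp) -expr2 -rin_norm {1}/rin -ht -/(rin _ _).
apply: (le_trans (ler_norm _)); apply: (le_trans (rin_le _ _)).
by rewrite mulrCA mulrA ler_wpM2r ?hnorm_ge0.
Qed.

Lemma adjointP (T : bounded_op M N) x y : inner (T x) y = inner x (adjoint T y).
Proof.
have /choice[f hf] := adjoint_vector T.
have [k k0 hk] := bop_bounded T.
have f_ok : f \in @bounded_linearb R N M.
  apply/asboolP; split.
    move=> c u v; apply/eqP; rewrite -subr_eq0; apply/eqP/rin_nondeg => w.
    rewrite rinC rinDr rinNr; apply/eqP; rewrite subr_eq0 /rin.
    by rewrite -hf !linearDr !linearZr_LR /= !hf.
  by exists k => v; exact: dual_bound (hf v).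
rewrite /adjoint; case: xgetP => [T' _ /(_ x y)//|/(_ (BoundedOp f_ok))].
by case => u v /=; rewrite hf.
Qed.

Lemma adjoint_bound (T : bounded_op M N) (k : R) : 0 <= k ->
  (forall x, hnorm (T x) <= k * hnorm x) ->
  forall y, hnorm (adjoint T y) <= k * hnorm y.
Proof. by move=> k0 hk y; apply: (dual_bound k0 hk) => x; exact: adjointP. Qed.
End Adjoint.

(** * Growth of the iterated shift *)

Section Growth.
Variables (R : realType) (L : rhombic_lattice R).
Local Notation C := R[i].

Lemma adj_unit (v w : vtx L) : adj v w -> `|val w - val v| = 1.
Proof. by move=> /asboolP[F _ /side_norm]. Qed.

Lemma unit_half_sum (e : C) : `|e| = 1 -> `|(1 + e) / 2| <= 1 /\ `|(1 - e) / 2| <= 1.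
Proof.
have key (d : C) : `|d| = 1 -> `|(1 + d) / 2| <= 1.
  move=> d1; rewrite normrM normfV (ger0_norm (ler0n _ 2)) ler_pdivrMr ?ltr0n //.
  by rewrite mul1r (le_trans (ler_normD _ _)) // normr1 d1.
by move=> e1; split; apply: key; rewrite ?normrN.
Qed.

Section Seminorms.
Variables (U : lmodType C) (I : Type) (q : I -> U -> R) (wt : I -> R).
Hypotheses (wt_ge0 : forall i, 0 <= wt i) (q0 : forall i, q i 0 <= 0)
  (qD : forall i x y, q i (x + y) <= q i x + q i y)
  (qZ : forall i c x, `|c| <= 1 -> q i (c *: x) <= q i x).
Variable f : vtx L -> U.
Hypotheses (da : discrete_analytic f)
  (base : forall v, exists2 K, 0 <= K & forall i, q i (f v) <= K * wt i).
Variable r : R.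
Hypothesis r1 : 1 < r.

(** The constant is uniform over a family of seminorms: for operators, [q x T = |T x|] with weight
    [|x|] takes the place of an operator norm. The iterates vanish at 0, and crossing an edge adds
    terms with coefficients of modulus at most 1, whose accumulation is absorbed by [r > 1]. *)
Lemma iter_Zplus_growth v : exists2 K, 0 <= K & forall n i,
  q i (iter n (@Zplus R L U) f v) <= K * wt i * r ^+ n.
Proof.
have r0 : 0 < r by exact: lt_trans ltr01 r1.
have rn n : 0 < r ^+ n by exact: exprn_gt0.
have [l [+ <-]] := adj_connected (vtx0 L) v; move: l {v}.
apply: last_ind => [_|l w IH].
  have [K K0 hK] := base (vtx0 L); exists K => // -[|n] i /=.
    by rewrite mulr1.
  rewrite Zplus0; last exact: iter_Zplus_discrete_analytic.
  by apply: (le_trans (q0 i)); rewrite !mulr_ge0 // ltW.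
rewrite rcons_path last_rcons => /andP[/IH{IH}[A A0 hA] vw].
move: (last _ _) vw hA => v vw hA.
have [K K0 hK] := base w.
have [h1 h2] := unit_half_sum (adj_unit vw).
(* Chosen so that [A r + A + B <= B r], the inequality that closes the induction on [n]; the summand
   [K] covers [n = 0]. *)
pose B := K + A * (r + 1) / (r - 1).
have rm : 0 < r - 1 by rewrite subr_gt0.
have rp : 0 <= r + 1 := addr_ge0 (ltW r0) ler01.
have Q0 : 0 <= A * (r + 1) / (r - 1) := divr_ge0 (mulr_ge0 A0 rp) (ltW rm).
have B0 : 0 <= B by exact: addr_ge0.
exists B => //; elim=> [|n IHn] i.
  rewrite expr0 mulr1; apply: (le_trans (hK i)); rewrite ler_wpM2r //.
  by rewrite lerDl.
rewrite iterS (Zplus_step (iter_Zplus_discrete_analytic n da) vw) -iterS.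
have hB : A * r + A + B <= B * r.
  have -> : B * r = B + B * (r - 1) by ring.
  have -> : B * (r - 1) = K * (r - 1) + A * (r + 1) by rewrite /B; field; rewrite gt_eqF.
  by rewrite [A * (r + 1)]mulrDr mulr1 [leLHS]addrC lerD2l lerDr mulr_ge0 // ltW.
apply: (@le_trans _ _ ((A * r + A + B) * wt i * r ^+ n)); last first.
  rewrite exprS mulrA; apply: ler_wpM2r; first exact: ltW.
  by rewrite mulrAC ler_wpM2r.
have -> : (A * r + A + B) * wt i * r ^+ n =
  A * wt i * r ^+ n.+1 + A * wt i * r ^+ n + B * wt i * r ^+ n by rewrite exprS; ring.
apply: (le_trans (qD _ _ _)); apply: lerD.
  apply: (le_trans (qD _ _ _)); apply: lerD; first exact: hA.
  exact: le_trans (qZ _ _ h1) (hA _ _).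
apply: le_trans (IHn i); rewrite -scaleNr; apply: qZ.
by rewrite normrN.
Qed.
End Seminorms.

Lemma const_discrete_analytic (U : lmodType C) (c : U) :
  discrete_analytic (fun _ : vtx L => c).
Proof.
have key v l : path_int (fun _ : vtx L => c) v l = (val (last v l) - val v) *: c.
  elim: l v => [|w l IH] v /=; first by rewrite subrr scale0r.
  rewrite IH -mulr2n -[c *+ 2]scaler_nat [2^-1 *: _]scalerA mulVf ?pnatr_eq0 // scale1r.
  by rewrite -scalerDl addrC subrKA.
by move=> v l _ ll; rewrite key ll subrr scale0r.
Qed.

Lemma zpowS0 n : zpow n.+1 (vtx0 L) = 0.
Proof.
exact: (@Zplus0 R L C^o _ (iter_Zplus_discrete_analytic n (const_discrete_analytic _))).
Qed.

Lemma zpow_step n (v w : vtx L) : adj v w -> zpow n.+1 w =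
  zpow n.+1 v + (1 + (val w - val v)) / 2 * zpow n v
              - (1 - (val w - val v)) / 2 * zpow n w.
Proof.
exact: (@Zplus_step R L C^o _ _ _ (iter_Zplus_discrete_analytic n (const_discrete_analytic _))).
Qed.

Lemma zpow_growth (r : R) : 1 < r -> forall v : vtx L,
  exists2 K, 0 <= K & forall n, cabs (zpow n v) <= K * r ^+ n.
Proof.
move=> r1 v.
have [] := @iter_Zplus_growth C^o unit (fun _ => @cabs R) (fun=> 1) _ _ _ _
   (fun=> 1) (const_discrete_analytic _) _ r r1 v.
- by [].
- by move=> _; rewrite /cabs normr0.
- move=> _ x y; rewrite -lecR rmorphD /= -!cabsE; exact: ler_normD.
- move=> _ c x c1; rewrite -lecR -!cabsE [leLHS]normrM.
  by rewrite ler_piMl.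
- by move=> w; exists 1 => // _; rewrite /cabs normr1 mulr1.
by move=> K K0 hK; exists K => // n; have := hK n tt; rewrite mulr1.
Qed.

Lemma bop_growth (M N : hilbertType R) (S : vtx L -> bounded_op M N) (r : R) :
  discrete_analytic S -> 1 < r -> forall v, exists2 K, 0 <= K & forall n x,
  hnorm (iter n (@Zplus R L _) S v x) <= K * r ^+ n * hnorm x.
Proof.
move=> da r1 v.
have [] := @iter_Zplus_growth (bounded_op M N) M (fun x T => hnorm (T x)) (@hnorm R M)
   _ _ _ _ S da _ r r1 v.
- by move=> x; exact: hnorm_ge0.
- by move=> x; rewrite hnorm0.
- by move=> x A B; exact: hnorm_leD.
- move=> x c A c1; rewrite bop_scaleE hnormZ ler_piMl ?hnorm_ge0 //.
  by rewrite -lecR -cabsE.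
- by move=> w; exact: bop_bounded.
by move=> K K0 hK; exists K => // n x; rewrite mulrAC.
Qed.
End Growth.

(** * Taylor coefficients *)

Section Coefficients.
Variables (R : realType) (L : rhombic_lattice R) (mu : R).
Local Notation C := R[i].
Hypothesis mu1 : 1 < mu.

Let mu0 : 0 < mu. Proof. exact: lt_trans ltr01 mu1. Qed.

Lemma Hcvg_unique (H : hilbertType R) (u : nat -> H) (a b : H) :
  u @ \oo --> a -> u @ \oo --> b -> a = b.
Proof.
move=> ua ub; apply/eqP; rewrite -subr_eq0; apply/eqP/rin_nondeg => y.
rewrite rinDl rinNl (Rcvg_unique (rin_cvg (y := y) ua) (rin_cvg (y := y) ub)).
exact: subrr.
Qed.

Lemma Hcvg_scale (H : hilbertType R) (c : C) (u : nat -> H) (l : H) :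
  u @ \oo --> l -> (fun n => c *: u n) @ \oo --> c *: l.
Proof. exact: cvgZl_tmp. Qed.

Lemma Hcvg_add (H : hilbertType R) (u v : nat -> H) (a b : H) :
  u @ \oo --> a -> v @ \oo --> b -> (fun n => u n + v n) @ \oo --> a + b.
Proof. by move=> ua vb; exact: cvgD. Qed.

Lemma Hcvg_sub (H : hilbertType R) (u v : nat -> H) (a b : H) :
  u @ \oo --> a -> v @ \oo --> b -> (fun n => u n - v n) @ \oo --> a - b.
Proof. by move=> ua vb; exact: cvgB. Qed.

Section OneSpace.
Variable N : hilbertType R.
Implicit Types (a b d : nat -> N) (f g : vtx L -> N).

Definition weighted_sum a (k : nat) : R :=
  \sum_(0 <= n < k) mu ^+ (2 * n) * hnorm (a n) ^+ 2.

Lemma weighted_term_ge0 a n : 0 <= mu ^+ (2 * n) * hnorm (a n) ^+ 2.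
Proof. by rewrite mulr_ge0 ?sqr_ge0 // exprn_ge0 // ltW. Qed.

Lemma coef_norm2_ge0 a : (0 <= coef_norm2 mu a)%E.
Proof.
by apply: nneseries_ge0 => n _ _; rewrite lee_fin weighted_term_ge0.
Qed.

Lemma weighted_sum_le a k : (coef_norm2 mu a < +oo)%E ->
  weighted_sum a k <= fine (coef_norm2 mu a).
Proof.
move=> fin; rewrite -lee_fin fineK; last first.
  by rewrite ge0_fin_numE // coef_norm2_ge0.
rewrite /weighted_sum -sumEFin; apply: nneseries_lim_ge => n _ _.
by rewrite lee_fin weighted_term_ge0.
Qed.

Lemma coef_norm2_le a (B : R) : (forall k, weighted_sum a k <= B) ->
  (coef_norm2 mu a < +oo)%E /\ fine (coef_norm2 mu a) <= B.
Proof.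
move=> h; have le : (coef_norm2 mu a <= B%:E)%E.
  apply: lime_le.
    by apply: is_cvg_nneseries => n _ _; rewrite lee_fin weighted_term_ge0.
  by apply: nearW => k; rewrite sumEFin lee_fin; exact: h.
have fin : (coef_norm2 mu a < +oo)%E by rewrite (le_lt_trans le) ?ltry.
by split=> //; rewrite -lee_fin fineK // ge0_fin_numE // coef_norm2_ge0.
Qed.

Lemma coef_decay a : (coef_norm2 mu a < +oo)%E -> exists2 K, 0 <= K &
  forall n, hnorm (a n) <= K * mu^-1 ^+ n.
Proof.
move=> fin; set F := fine (coef_norm2 mu a).
have F0 : 0 <= F by rewrite /F fine_ge0 // coef_norm2_ge0.
exists (1 + F); first by rewrite addr_ge0.
move=> n; rewrite exprVn ler_pdivlMr ?exprn_gt0 // mulrC.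
have : (mu ^+ n * hnorm (a n)) ^+ 2 <= F.
  rewrite exprMn -exprM mulnC; apply: le_trans (weighted_sum_le n.+1 fin).
  rewrite /weighted_sum big_nat_recr //= lerDr sumr_ge0 // => i _.
  exact: weighted_term_ge0.
have : 0 <= mu ^+ n * hnorm (a n) by rewrite mulr_ge0 ?hnorm_ge0 // exprn_ge0 // ltW.
move: (mu ^+ n * _) => x x0 xF; rewrite leNgt; apply/negP => Fx.
have : (1 + F) * (1 + F) <= x ^+ 2 by rewrite expr2 ler_pM ?addr_ge0 // ltW.
by have := mulr_ge0 F0 F0; lra.
Qed.

(** A number strictly between 1 and [mu]: iterates grow at most like [rate ^+ n], and
    [rate / mu < 1] makes the series below geometric. *)
Definition rate : R := (1 + mu) / 2.

Lemma rate1 : 1 < rate. Proof. by have := mu1; rewrite /rate; lra. Qed.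

Lemma rate_mu : 0 <= rate / mu < 1.
Proof.
have h1 := mu1; apply/andP; split.
  by rewrite divr_ge0 ?(ltW mu0) // /rate; lra.
by rewrite ltr_pdivrMr // /rate; lra.
Qed.

Lemma power_series_cvg d K n (z : vtx L) : 0 <= K ->
  (forall k, hnorm (d k) <= K * mu^-1 ^+ k) ->
  exists l : N, series (fun k => zpow k z *: d (k + n)%N) @ \oo --> l.
Proof.
move=> K0 hd; have [Z Z0 hZ] := zpow_growth rate1 z.
have i0 : 0 <= mu^-1 by rewrite invr_ge0 ltW.
have hx k : hnorm (zpow k z *: d (k + n)%N) <= Z * K * (rate / mu) ^+ k.
  rewrite hnormZ expr_div_n -exprVn mulrACA.
  apply: ler_pM; [exact: cabs_ge0|exact: hnorm_ge0|exact: hZ|].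
  apply: (le_trans (hd _)); rewrite ler_wpM2l // exprD ler_piMr ?exprn_ge0 //.
  by rewrite exprn_ile1 // invf_le1 // ltW.
have [l [hl _]] := hseries_geometric rate_mu hx.
by exists l.
Qed.

Lemma series_shift (x : nat -> N) m :
  series (fun k => x k.+1) m = series x m.+1 - x 0%N.
Proof. by rewrite /series /= [in RHS]big_nat_recl // addrC addKr. Qed.

Lemma cvg_series_shift (x : nat -> N) (l : N) : series x @ \oo --> l ->
  series (fun k => x k.+1) @ \oo --> l - x 0%N.
Proof.
move=> h; have -> : series (fun k => x k.+1) = fun m => series x m.+1 - x 0%N.
  by apply/funext => m; exact: series_shift.
by apply: Hcvg_sub; [rewrite -(cvg_shiftS (series x)) in h; exact: h|exact: cvg_cst].
Qed.

Lemma power_series_uniq d K : 0 <= K -> (forall k, hnorm (d k) <= K * mu^-1 ^+ k) ->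
  (forall z : vtx L, series (fun k => zpow k z *: d k) @ \oo --> (0 : N)) ->
  forall n, d n = 0.
Proof.
move=> K0 hd h0.
have H n : forall z : vtx L, series (fun k => zpow k z *: d (k + n)%N) @ \oo --> (0 : N).
  elim: n => [|n IH].
    move=> z; rewrite (_ : (fun k => _) = fun k => zpow k z *: d k) //.
    by apply/funext => k; rewrite addn0.
  have /choice[G hG] := fun z => power_series_cvg n.+1 z K0 hd.
  have rel v w : adj v w -> ((1 + (val w - val v)) / 2) *: G v =
      ((1 - (val w - val v)) / 2) *: G w.
    move=> vw; set c := _ / 2; set c' := _ / 2.
    have e : series (fun k => zpow k.+1 w *: d (k.+1 + n)%N) =
      fun m => series (fun k => zpow k.+1 v *: d (k.+1 + n)%N) m +
         c *: series (fun k => zpow k v *: d (k + n.+1)%N) m -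
         c' *: series (fun k => zpow k w *: d (k + n.+1)%N) m.
      apply/funext => m; rewrite /series /= !scaler_sumr -big_split /=.
      rewrite -sumrB; apply: eq_bigr => k _.
      have zs := zpow_step k vw; rewrite /= in zs.
      by rewrite zs scalerBl scalerDl !scalerA addSnnS.
    have lw := cvg_series_shift (IH w); have lv := cvg_series_shift (IH v).
    have h := Hcvg_sub (Hcvg_add lv (Hcvg_scale (c := c) (hG v))) (Hcvg_scale (c := c') (hG w)).
    rewrite -e in h; have /eqP := Hcvg_unique lw h.
    rewrite -addrA -subr_eq0 opprD addrA subrr add0r oppr_eq0 subr_eq0.
    by move/eqP.
  have G0 z : G z = 0.
    have := right_open_vertex (facesP L) (direction1 L) (@coherent_tracks _ L) (vertexP z).
    move e : (val z) => x ro; elim: ro z e => {x} [x ex|x y exy n1 n2 _ IHy] z ez.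
      have [w wx] : exists w : vtx L, val w = x + 1 by exists (as_vertex (edge_vertexr ex)).
      have zw : adj z w by apply/asboolP; rewrite ez wx.
      have := rel z w zw; rewrite wx ez [x + 1]addrC addrK subrr mul0r scale0r.
      by rewrite -[1 + 1]/(2%:R) divff ?pnatr_eq0 // scale1r.
    have [w wy] : exists w : vtx L, val w = y by exists (as_vertex (edge_vertexr exy)).
    have zw : adj z w by apply/asboolP; rewrite ez wy.
    have := rel z w zw; rewrite wy ez (IHy w wy) scaler0 => /eqP.
    rewrite scaler_eq0 mulf_eq0 invr_eq0 pnatr_eq0 orbF => /orP[|/eqP//].
    by rewrite addrC addr_eq0 => /eqP.
  by move=> z; rewrite -(G0 z).
move=> n.
(* At the origin [z^(k) = 0] for [k > 0], so all nonempty partial sums of the series shifted by [n]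
   equal [d n]. *)
have c0 : (fun m => series (fun k => zpow k (vtx0 L) *: d (k + n)%N) m.+1) @ \oo --> (0 : N).
  by have := H n (vtx0 L); rewrite -(cvg_shiftS (series _)).
have c1 : (fun m => series (fun k => zpow k (vtx0 L) *: d (k + n)%N) m.+1) = fun=> d n.
  apply/funext => m; rewrite /series /= big_nat_recl // big1 ?addr0.
    by rewrite add0n /zpow /= scale1r.
  by move=> k _; rewrite zpowS0 scale0r.
by rewrite c1 in c0; apply: Hcvg_unique c0; exact: cvg_cst.
Qed.
End OneSpace.
End Coefficients.

(** * Hardy space, multiplication operator and associated kernel *)

Section HardyOperators.
Variables (R : realType) (L : rhombic_lattice R) (mu : R).
Local Notation C := R[i].
Hypothesis mu1 : 1 < mu.

Let mu0 : 0 < mu. Proof. exact: lt_trans ltr01 mu1. Qed.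

Section Coef.
Variable N : hilbertType R.
Implicit Types (a b : nat -> N) (f g : vtx L -> N).

Lemma hardy_coef_uniq f a b : hardy_coef mu f a -> hardy_coef mu f b -> a = b.
Proof.
move=> [fa ha] [fb hb]; apply/funext => n; apply/eqP; rewrite -subr_eq0; apply/eqP.
have [A A0 hA] := coef_decay mu1 fa; have [B B0 hB] := coef_decay mu1 fb.
have hd k : hnorm (a k - b k) <= (A + B) * mu^-1 ^+ k.
  rewrite mulrDl; apply: (le_trans (hnorm_leD _ _)).
  by rewrite hnorm_opp lerD.
apply: (power_series_uniq (L := L) mu1 (addr_ge0 A0 B0) hd) => z.
have -> : series (fun k => zpow k z *: (a k - b k)) =
   fun m => series (fun k => zpow k z *: a k) m - series (fun k => zpow k z *: b k) m.
  apply/funext => m; rewrite /series /= -sumrB; apply: eq_bigr => k _.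
  by rewrite scalerBr.
by rewrite -[X in _ --> X](subrr (f z)); exact: Hcvg_sub.
Qed.

Lemma hardy_hatE f a : hardy_coef mu f a -> hardy_hat mu f = a.
Proof.
move=> fa; rewrite /hardy_hat; case: xgetP => [b _ fb|/(_ a)//].
exact: hardy_coef_uniq fb fa.
Qed.

Lemma hardy_coef_lin (c : C) f g a b : hardy_coef mu f a -> hardy_coef mu g b ->
  hardy_coef mu (c *: f + g) (fun n => c *: a n + b n).
Proof.
move=> [fa ha] [fb hb]; split.
  pose A := fine (coef_norm2 mu a); pose B := fine (coef_norm2 mu b).
  have [] := @coef_norm2_le R mu mu1 N (fun n => c *: a n + b n)
    (2 * cabs c ^+ 2 * A + 2 * B) => // k.
  apply: (@le_trans _ _ (2 * cabs c ^+ 2 * weighted_sum mu a k + 2 * weighted_sum mu b k)).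
    rewrite /weighted_sum !mulr_sumr -big_split /=; apply: ler_sum => n _.
    have m0 : 0 <= mu ^+ (2 * n) by rewrite exprn_ge0 // ltW.
    have -> : 2 * cabs c ^+ 2 * (mu ^+ (2 * n) * hnorm (a n) ^+ 2) +
      2 * (mu ^+ (2 * n) * hnorm (b n) ^+ 2) =
      mu ^+ (2 * n) * (2 * (cabs c * hnorm (a n)) ^+ 2 + 2 * hnorm (b n) ^+ 2).
      by ring.
    rewrite ler_wpM2l //.
    apply: (@le_trans _ _ ((cabs c * hnorm (a n) + hnorm (b n)) ^+ 2)).
      by rewrite -hnormZ lerXn2r ?nnegrE ?addr_ge0 ?hnorm_ge0 // hnorm_leD.
    rewrite sqrrD; have := sqr_ge0 (cabs c * hnorm (a n) - hnorm (b n)).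
    by rewrite sqrrB mulr2n; lra.
  have := weighted_sum_le mu1 k fa; have := weighted_sum_le mu1 k fb => h1 h2.
  apply: lerD; apply: ler_wpM2l => //.
  by rewrite mulr_ge0 // sqr_ge0.
move=> z; have -> : series (fun n => zpow n z *: (c *: a n + b n)) =
   fun m => c *: series (fun n => zpow n z *: a n) m + series (fun n => zpow n z *: b n) m.
  apply/funext => m; rewrite /series /= scaler_sumr -big_split /=; apply: eq_bigr => k _.
  by rewrite scalerDr !scalerA mulrC.
exact: Hcvg_add (Hcvg_scale (ha z)) (hb z).
Qed.
End Coef.

Variables (M N : hilbertType R) (S : vtx L -> bounded_op M N).
Hypothesis da : discrete_analytic S.

Definition op_pow n z : bounded_op M N := iter n (@Zplus R L _) S z.

Lemma op_series_cvg (a : nat -> M) K z : 0 <= K ->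
  (forall n, hnorm (a n) <= K * mu^-1 ^+ n) ->
  exists l : N, series (fun n => op_pow n z (a n)) @ \oo --> l.
Proof.
move=> K0 ha; have [Z Z0 hZ] := bop_growth da (rate1 mu1) z.
have hx n : hnorm (op_pow n z (a n)) <= Z * K * (rate mu / mu) ^+ n.
  rewrite expr_div_n -exprVn mulrACA; apply: (le_trans (hZ n _)).
  apply: ler_wpM2l => //; rewrite mulr_ge0 // exprn_ge0 //.
  by apply: ltW; apply: lt_trans ltr01 (rate1 mu1).
by have [l [hl _]] := hseries_geometric (rate_mu mu1) hx; exists l.
Qed.

Lemma mul_op_cvg (f : vtx L -> M) a z : hardy_coef mu f a ->
  series (fun n => op_pow n z (a n)) @ \oo --> mul_op mu S f z.
Proof.
move=> fa; have [K K0 hK] := coef_decay mu1 fa.1.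
have [l hl] := op_series_cvg z K0 hK.
by rewrite /mul_op (hardy_hatE fa); apply: (cvgP l).
Qed.

Definition kernel_term n z w : bounded_op N N :=
  ((mu ^+ (2 * n))^-1)%:C *:
      ((zpow n z * (zpow n w)^*) *: bop_id N -
       bop_comp (op_pow n z) (adjoint (op_pow n w))).

Lemma kernel_termE n z w x : kernel_term n z w x = ((mu ^+ (2 * n))^-1)%:C *:
  ((zpow n z * (zpow n w)^*) *: x - op_pow n z (adjoint (op_pow n w) x)).
Proof. by []. Qed.

Lemma kernel_term_bound z w : exists2 K, 0 <= K & forall n x,
  hnorm (kernel_term n z w x) <= K * hnorm x * ((rate mu / mu) ^+ 2) ^+ n.
Proof.
have r1 := rate1 mu1; have r0 : 0 < rate mu := lt_trans ltr01 r1.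
have [Z Z0 hZ] := zpow_growth (L := L) r1 z; have [W W0 hW] := zpow_growth (L := L) r1 w.
have [A A0 hA] := bop_growth da r1 z; have [B B0 hB] := bop_growth da r1 w.
exists (Z * W + A * B); first by rewrite addr_ge0 // mulr_ge0.
move=> n x; have rn : 0 <= rate mu ^+ n by rewrite exprn_ge0 // ltW.
have m0 : 0 <= (mu ^+ (2 * n))^-1 by rewrite invr_ge0 exprn_ge0 // ltW.
rewrite kernel_termE hnormZ cabs_real //.
have -> : (Z * W + A * B) * hnorm x * ((rate mu / mu) ^+ 2) ^+ n =
   (mu ^+ (2 * n))^-1 * ((Z * rate mu ^+ n) * (W * rate mu ^+ n) * hnorm x +
      A * rate mu ^+ n * (B * rate mu ^+ n * hnorm x)).
  rewrite -exprM expr_div_n; have -> : rate mu ^+ (2 * n) = rate mu ^+ n * rate mu ^+ n.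
    by rewrite mulnC exprM expr2.
  by ring.
rewrite ler_wpM2l //.
apply: (le_trans (hnorm_leD _ _)); rewrite hnorm_opp; apply: lerD.
  rewrite hnormZ ler_wpM2r ?hnorm_ge0 // cabsM.
  apply: ler_pM; rewrite ?cabs_ge0 //.
  by rewrite [cabs _](cabs_conj (zpow n w)).
apply: (le_trans (hA n _)); rewrite ler_wpM2l ?mulr_ge0 //.
by apply: adjoint_bound; [rewrite mulr_ge0|exact: hB].
Qed.

Lemma sqr_rate : 0 <= (rate mu / mu) ^+ 2 < 1.
Proof.
have /andP[h0 h1] := rate_mu mu1.
by rewrite sqr_ge0 /= expr_lt1.
Qed.

(** Guarantees that [bop_series] does not fall back on its default: by the geometric bound the
    pointwise limits form a bounded operator. *)
Lemma kernel_cvg z w x :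
  series (fun n => kernel_term n z w x) @ \oo --> assoc_kernel mu S z w x.
Proof.
have [K K0 hK] := kernel_term_bound z w.
have /choice[T hT] : forall x, exists l : N, series (fun n => kernel_term n z w x) @ \oo --> l
    /\ hnorm l <= K * hnorm x / (1 - (rate mu / mu) ^+ 2).
  by move=> y; apply: (hseries_geometric sqr_rate) => n; exact: hK.
have T_ok : T \in @bounded_linearb R N N.
  apply/asboolP; split.
    move=> c y y'; have [h1 _] := hT (c *: y + y').
    apply: (Hcvg_unique h1).
    have -> : series (fun n => kernel_term n z w (c *: y + y')) =
      fun m => c *: series (fun n => kernel_term n z w y) m +
               series (fun n => kernel_term n z w y') m.
      apply/funext => m; rewrite /series /= scaler_sumr -big_split /=.
      by apply: eq_bigr => k _; exact: (bop_linear (kernel_term k z w) c y y').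
    exact: Hcvg_add (Hcvg_scale (hT y).1) (hT y').1.
  by exists (K / (1 - (rate mu / mu) ^+ 2)) => y; rewrite mulrAC; exact: (hT y).2.
rewrite /assoc_kernel /bop_series; case: xgetP => [A _ hA|/(_ (BoundedOp T_ok))]; first exact: hA.
by case => y /=; exact: (hT y).1.
Qed.

Lemma re_sum (I : Type) (r : seq I) (F : I -> C) :
  complex.Re (\sum_(i <- r) F i) = \sum_(i <- r) complex.Re (F i).
Proof. exact: (big_morph (@complex.Re R) (@reD R) erefl). Qed.

Lemma Rcvg_sum (I : Type) (r : seq I) (u : I -> nat -> R) (l : I -> R) :
  (forall i, u i @ \oo --> l i) ->
  (fun m => \sum_(i <- r) u i m) @ \oo --> \sum_(i <- r) l i.
Proof.
move=> h; elim: r => [|i r IH].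
  by under eq_fun do rewrite big_nil; rewrite big_nil; exact: cvg_cst.
by under eq_fun do rewrite big_cons; rewrite big_cons; apply: cvgD.
Qed.

Section Family.
Variables (k : nat) (w : 'I_k -> vtx L) (zeta : 'I_k -> N).

Definition fam_u n : N := \sum_i (zpow n (w i))^* *: zeta i.
Definition fam_v n : M := \sum_i adjoint (op_pow n (w i)) (zeta i).

Lemma kernel_term_form n :
  \sum_i \sum_j inner (kernel_term n (w i) (w j) (zeta j)) (zeta i) =
  ((mu ^+ (2 * n))^-1 * (hnorm (fam_u n) ^+ 2 - hnorm (fam_v n) ^+ 2))%:C.
Proof.
have eu : (hnorm (fam_u n) ^+ 2)%:C = \sum_i \sum_j
    inner ((zpow n (w j))^* *: zeta j) ((zpow n (w i))^* *: zeta i).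
  rewrite rmorphXn /= -normE_hnorm -inner_norm /fam_u linear_sumr /=.
  by apply: eq_bigr => i _; rewrite linear_sumlz.
have ev : (hnorm (fam_v n) ^+ 2)%:C = \sum_i \sum_j
    inner (adjoint (op_pow n (w j)) (zeta j)) (adjoint (op_pow n (w i)) (zeta i)).
  rewrite rmorphXn /= -normE_hnorm -inner_norm /fam_v linear_sumr /=.
  by apply: eq_bigr => i _; rewrite linear_sumlz.
rewrite rmorphM rmorphB /= eu ev -sumrB mulr_sumr; apply: eq_bigr => i _.
rewrite -sumrB mulr_sumr; apply: eq_bigr => j _.
rewrite -[X in inner X _ = _]/(((mu ^+ (2 * n))^-1)%:C *:
  ((zpow n (w i) * (zpow n (w j))^*) *: zeta j
   - op_pow n (w i) (adjoint (op_pow n (w j)) (zeta j)))).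
rewrite linearZl_LR /=; congr (_ * _).
rewrite linearBl /= adjointP; congr (_ - _).
by rewrite -scalerA [LHS]linearZl_LR [RHS]linearZr_LR /= conjCK.
Qed.

Definition kernel_form := \sum_i \sum_j
  inner (assoc_kernel mu S (w i) (w j) (zeta j)) (zeta i).

Lemma kernel_form_cvg : complex.Im kernel_form = 0 /\
  series (fun n => (mu ^+ (2 * n))^-1 * (hnorm (fam_u n) ^+ 2 - hnorm (fam_v n) ^+ 2))
    @ \oo --> complex.Re kernel_form.
Proof.
pose p i j m := series (fun n => kernel_term n (w i) (w j) (zeta j)) m.
pose s m := series (fun n => (mu ^+ (2 * n))^-1 *
  (hnorm (fam_u n) ^+ 2 - hnorm (fam_v n) ^+ 2)) m.
have partial m : \sum_i \sum_j inner (p i j m) (zeta i) = (s m)%:C.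
  rewrite /s /series /= rmorph_sum /=.
  transitivity (\sum_i \sum_j \sum_(0 <= n < m)
      inner (kernel_term n (w i) (w j) (zeta j)) (zeta i)).
    by apply: eq_bigr => i _; apply: eq_bigr => j _; rewrite /p /series /= linear_sumlz.
  rewrite (eq_bigr _ (fun i _ => exchange_big _ _ _ _ _ _)) exchange_big /=.
  by apply: eq_bigr => n _; exact: kernel_term_form.
(* Used with [c = 1] for the real part and with [c = i] for the imaginary part, which must be shown
   to vanish because [0 <=] in [R[i]] includes being real. *)
have lim_rin (c : C) : (fun m => \sum_i \sum_j rin (c *: p i j m) (zeta i)) @ \oo -->
    \sum_i \sum_j rin (c *: assoc_kernel mu S (w i) (w j) (zeta j)) (zeta i).
  apply: Rcvg_sum => i; apply: Rcvg_sum => j.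
  exact/rin_cvg/Hcvg_scale/kernel_cvg.
have reE (c : C) (F : 'I_k -> 'I_k -> N) : \sum_i \sum_j rin (c *: F i j) (zeta i) =
    complex.Re (c * \sum_i \sum_j inner (F i j) (zeta i)).
  rewrite mulr_sumr re_sum; apply: eq_bigr => i _; rewrite mulr_sumr re_sum.
  by apply: eq_bigr => j _; rewrite /rin linearZl_LR.
split; last first.
  have := lim_rin 1; under eq_fun do rewrite reE partial mul1r /=.
  by rewrite reE mul1r.
have := lim_rin 'i%C; under eq_fun do rewrite reE partial mulrC ReiNIm /= oppr0.
rewrite reE mulrC ReiNIm => h; apply: oppr_inj; rewrite oppr0.
by apply: Rcvg_unique h _; exact: cvg_cst.
Qed.
End Family.
End HardyOperators.

(** * Positivity and contractivity *)

Section WeightedInner.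
Variables (R : realType) (mu : R).
Hypothesis mu1 : 1 < mu.

Let mu0 : 0 < mu. Proof. exact: lt_trans ltr01 mu1. Qed.

Variable N : hilbertType R.
Implicit Types (x y z : nat -> N) (t : R).

Definition slow x := exists2 K, 0 <= K & forall n, hnorm (x n) <= K * rate mu ^+ n.

Definition wt n : R := (mu ^+ (2 * n))^-1.

Lemma wt_gt0 n : 0 < wt n. Proof. by rewrite invr_gt0 exprn_gt0. Qed.

(** The weights are inverse to those of [coef_norm2]: the kernel combination belonging to [u] has
    the Taylor coefficients [mu^(-2n) u_n], and its squared Hardy norm is [ip u u]. *)
Definition ip x y : R := limn (series (fun n => wt n * rin (x n) (y n))).

Lemma slow_lin x y t : slow x -> slow y -> slow (fun n => x n + t%:C *: y n).
Proof.
move=> [K K0 hK] [J J0 hJ]; exists (K + cabs t%:C * J).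
  by rewrite addr_ge0 // mulr_ge0 // cabs_ge0.
move=> n; rewrite mulrDl; apply: (le_trans (hnorm_leD _ _)); apply: lerD => //.
by rewrite hnormZ -mulrA ler_wpM2l // cabs_ge0.
Qed.

Lemma ip_cvg x y : slow x -> slow y ->
  series (fun n => wt n * rin (x n) (y n)) @ \oo --> ip x y.
Proof.
move=> [K K0 hK] [J J0 hJ].
suff : cvgn (series (fun n => wt n * rin (x n) (y n))) by [].
apply: (@rseries_geometric R _ (K * J) ((rate mu / mu) ^+ 2)); first exact: sqr_rate.
move=> n; rewrite normrM (gtr0_norm (wt_gt0 n)).
have -> : K * J * ((rate mu / mu) ^+ 2) ^+ n =
   wt n * ((K * rate mu ^+ n) * (J * rate mu ^+ n)).
  rewrite /wt -exprM expr_div_n.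
  have -> : rate mu ^+ (2 * n) = rate mu ^+ n * rate mu ^+ n.
    by rewrite mulnC exprM expr2.
  by ring.
rewrite ler_pM2l ?wt_gt0 //; apply: (le_trans (rin_le _ _)).
by apply: ler_pM; rewrite ?hnorm_ge0.
Qed.

Lemma ip_eq x y (l : R) : slow x -> slow y ->
  series (fun n => wt n * rin (x n) (y n)) @ \oo --> l -> ip x y = l.
Proof. by move=> sx sy h; apply: Rcvg_unique (ip_cvg sx sy) h. Qed.

Lemma ip_linl x y z t : slow x -> slow y -> slow z ->
  ip (fun n => x n + t%:C *: y n) z = ip x z + t * ip y z.
Proof.
move=> sx sy sz; apply: ip_eq => //; first exact: slow_lin.
have -> : series (fun n => wt n * rin (x n + t%:C *: y n) (z n)) =
  fun m => series (fun n => wt n * rin (x n) (z n)) m +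
           t * series (fun n => wt n * rin (y n) (z n)) m.
  apply/funext => m; rewrite /series /= mulr_sumr -big_split /=.
  by apply: eq_bigr => n _; rewrite rinDl rinZl; ring.
by apply: cvgD; [exact: ip_cvg|apply: cvgMr; exact: ip_cvg].
Qed.

Lemma ip_sym x y : ip x y = ip y x.
Proof.
by rewrite /ip; congr (limn (series _)); apply/funext => n; rewrite rinC.
Qed.

Lemma ip_expand x y t : slow x -> slow y ->
  ip (fun n => x n + t%:C *: y n) (fun n => x n + t%:C *: y n) =
  ip x x + 2 * t * ip x y + t ^+ 2 * ip y y.
Proof.
move=> sx sy; have sxy := slow_lin t sx sy.
rewrite ip_linl //; move: sxy; set W := fun n => _ => sW.
rewrite (ip_sym x W) (ip_sym y W) /W !ip_linl // (ip_sym y x); ring.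
Qed.

Definition wsum x m : R := \sum_(0 <= n < m) wt n * hnorm (x n) ^+ 2.

Lemma wsum_cvg x : slow x -> wsum x @ \oo --> ip x x.
Proof.
move=> sx; have := ip_cvg sx sx.
have -> : series (fun n => wt n * rin (x n) (x n)) = wsum x; last by [].
by apply/funext => m; rewrite /wsum /series /=; apply: eq_bigr => n _; rewrite rin_norm.
Qed.

Lemma wsum_le x m : slow x -> wsum x m <= ip x x.
Proof.
move=> sx; rewrite -(cvg_lim (@Rhausdorff R) (wsum_cvg sx)).
apply: nondecreasing_cvgn_le; last by apply/cvg_ex; exists (ip x x); exact: wsum_cvg.
apply/nondecreasing_seqP => n; rewrite /wsum big_nat_recr //= lerDl.
by rewrite mulr_ge0 ?sqr_ge0 // ltW // wt_gt0.
Qed.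

Lemma ip_ge0 x : slow x -> 0 <= ip x x.
Proof. by move=> /(wsum_le 0); rewrite /wsum big_geq. Qed.

(** Cauchy-Schwarz from the sign of a quadratic in [t]. The [+ 1] keeps the divisor positive and
    does no harm where the first factor tends to 0. *)
Lemma wsum_cauchy_schwarz x y m :
  (\sum_(0 <= n < m) wt n * rin (x n) (y n)) ^+ 2 <= wsum x m * (wsum y m + 1).
Proof.
set s := \sum_(_ <= _ < _) _; set X := wsum x m; set Y := wsum y m.
have Y0 : 0 <= Y.
  by apply: sumr_ge0 => n _; rewrite mulr_ge0 ?sqr_ge0 // ltW // wt_gt0.
have h t : 0 <= X + 2 * t * s + t ^+ 2 * Y.
  have -> : X + 2 * t * s + t ^+ 2 * Y = wsum (fun n => x n + t%:C *: y n) m.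
    rewrite /X /Y /s /wsum !mulr_sumr -!big_split /=; apply: eq_bigr => n _.
    by rewrite hnorm_expand; ring.
  by apply: sumr_ge0 => n _; rewrite mulr_ge0 ?sqr_ge0 // ltW // wt_gt0.
have Y1 : 0 < Y + 1 by lra.
have := h (- s / (Y + 1)).
have -> : X + 2 * (- s / (Y + 1)) * s + (- s / (Y + 1)) ^+ 2 * Y =
   X - s ^+ 2 / (Y + 1) - (s / (Y + 1)) ^+ 2 by field; rewrite gt_eqF.
have := sqr_ge0 (s / (Y + 1)) => h1 h2; rewrite -ler_pdivrMr //; lra.
Qed.
End WeightedInner.

(** * From contraction to positive kernel *)

Section PositiveOfContraction.
Variables (R : realType) (L : rhombic_lattice R) (mu : R).
Local Notation C := R[i].
Hypothesis mu1 : 1 < mu.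

Let mu0 : 0 < mu. Proof. exact: lt_trans ltr01 mu1. Qed.

Variables (M N : hilbertType R) (S : vtx L -> bounded_op M N).
Hypothesis da : discrete_analytic S.

Lemma slow_sum (H : hilbertType R) (I : Type) (r : seq I) (F : I -> nat -> H) :
  (forall i, slow mu (F i)) -> slow mu (fun n => \sum_(i <- r) F i n).
Proof.
move=> h; elim: r => [|i r [K K0 hK]].
  by exists 0 => // n; rewrite big_nil hnorm0 mul0r.
have [J J0 hJ] := h i; exists (J + K); first exact: addr_ge0.
move=> n; rewrite big_cons mulrDl; apply: (le_trans (hnorm_leD _ _)).
exact: lerD.
Qed.

Lemma slow_fam_u k (w : 'I_k -> vtx L) (zeta : 'I_k -> N) : slow mu (fam_u w zeta).
Proof.
apply: slow_sum => i; have [K K0 hK] := zpow_growth (rate1 mu1) (w i).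
exists (K * hnorm (zeta i)); first by rewrite mulr_ge0 // hnorm_ge0.
move=> n; rewrite hnormZ mulrAC ler_wpM2r ?hnorm_ge0 //.
by rewrite [cabs _](cabs_conj (zpow n (w i))).
Qed.

Lemma slow_fam_v k (w : 'I_k -> vtx L) (zeta : 'I_k -> N) : slow mu (fam_v S w zeta).
Proof.
apply: slow_sum => i; have [K K0 hK] := bop_growth da (rate1 mu1) (w i).
exists (K * hnorm (zeta i)); first by rewrite mulr_ge0 // hnorm_ge0.
move=> n; rewrite mulrAC; apply: adjoint_bound; last exact: hK.
by rewrite mulr_ge0 // exprn_ge0 // ltW // (lt_trans ltr01 (rate1 mu1)).
Qed.

Lemma kernel_form_ip k (w : 'I_k -> vtx L) (zeta : 'I_k -> N) :
  (0 <= kernel_form mu S w zeta) =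
  (ip mu (fam_v S w zeta) (fam_v S w zeta) <= ip mu (fam_u w zeta) (fam_u w zeta)).
Proof.
have [im0 cv] := kernel_form_cvg mu1 da w zeta.
have su := slow_fam_u w zeta; have sv := slow_fam_v w zeta.
have e : complex.Re (kernel_form mu S w zeta) =
    ip mu (fam_u w zeta) (fam_u w zeta) - ip mu (fam_v S w zeta) (fam_v S w zeta).
  apply: Rcvg_unique cv _.
  have -> : series (fun n => (mu ^+ (2 * n))^-1 *
      (hnorm (fam_u w zeta n) ^+ 2 - hnorm (fam_v S w zeta n) ^+ 2)) =
    fun m => wsum mu (fam_u w zeta) m - wsum mu (fam_v S w zeta) m.
    apply/funext => m; rewrite /wsum /series /= -sumrB; apply: eq_bigr => n _.
    by rewrite mulrBr.
  by apply: cvgB; exact: wsum_cvg.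
by rewrite lecE /= im0 eqxx /= e subr_ge0.
Qed.

Lemma pairing_cvg k (w : 'I_k -> vtx L) (zeta : 'I_k -> N) (a : nat -> M) (g : 'I_k -> N) :
  (forall i, series (fun n => op_pow S n (w i) (a n)) @ \oo --> g i) ->
  series (fun n => rin (fam_v S w zeta n) (a n)) @ \oo --> \sum_i rin (g i) (zeta i).
Proof.
move=> hg; have -> : series (fun n => rin (fam_v S w zeta n) (a n)) =
    fun m => \sum_i rin (series (fun n => op_pow S n (w i) (a n)) m) (zeta i).
  apply/funext => m; rewrite /series /=.
  rewrite [RHS](eq_bigr _ (fun i _ => rin_suml _ _ _)) exchange_big /=.
  apply: eq_bigr => n _; rewrite /fam_v rin_suml; apply: eq_bigr => i _.
  by rewrite rinC /rin adjointP.
by apply: Rcvg_sum => i; apply: rin_cvg; exact: hg.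
Qed.

Lemma pairing_u_cvg k (w : 'I_k -> vtx L) (zeta : 'I_k -> N) (b : nat -> N) (g : 'I_k -> N) :
  (forall i, series (fun n => zpow n (w i) *: b n) @ \oo --> g i) ->
  series (fun n => rin (b n) (fam_u w zeta n)) @ \oo --> \sum_i rin (g i) (zeta i).
Proof.
move=> hg; have -> : series (fun n => rin (b n) (fam_u w zeta n)) =
    fun m => \sum_i rin (series (fun n => zpow n (w i) *: b n) m) (zeta i).
  apply/funext => m; rewrite /series /=.
  rewrite [RHS](eq_bigr _ (fun i _ => rin_suml _ _ _)) exchange_big /=.
  apply: eq_bigr => n _; rewrite /fam_u rin_sumr; apply: eq_bigr => i _.
  by rewrite rin_scale.
by apply: Rcvg_sum => i; apply: rin_cvg; exact: hg.
Qed.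

(** This is the square of [x - mu^(-2n) y], scaled by [mu^(2n)]; it pairs the weights of Taylor
    coefficients with those of kernel families. *)
Lemma young (H : hilbertType R) (x y : H) n :
  2 * rin x y <= mu ^+ (2 * n) * hnorm x ^+ 2 + wt mu n * hnorm y ^+ 2.
Proof.
have m0 : 0 < mu ^+ (2 * n) by exact: exprn_gt0.
have := sqr_ge0 (hnorm (x + (- wt mu n)%:C *: y)); rewrite hnorm_expand.
rewrite -(pmulr_rge0 _ m0); have -> : mu ^+ (2 * n) * (hnorm x ^+ 2 +
  2 * - wt mu n * rin x y + (- wt mu n) ^+ 2 * hnorm y ^+ 2) =
  mu ^+ (2 * n) * hnorm x ^+ 2 + wt mu n * hnorm y ^+ 2 - 2 * rin x y.
  by rewrite /wt; field; rewrite gt_eqF.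
by rewrite subr_ge0.
Qed.

Lemma weighted_scale (H : hilbertType R) (x : nat -> H) m :
  weighted_sum mu (fun n => (wt mu n)%:C *: x n) m = wsum mu x m.
Proof.
apply: eq_bigr => n _; rewrite hnormZ cabs_real ?(ltW (wt_gt0 mu1 n)) // exprMn mulrA.
by congr (_ * _); rewrite /wt; field; rewrite gt_eqF // exprn_gt0.
Qed.

(** The test function [f] has the coefficients [mu^(-2n) v_n]: it is the adjoint of [M_S] applied to
    the kernel combination of [u]. Pairing [M_S f] with that combination gives [ip v v], so [2 ip v
    v <= |M_S f|^2 + ip u u <= ip v v + ip u u]. *)
Lemma contraction_positive : H2_contraction mu (mul_op mu S) ->
  positive_kernel (assoc_kernel mu S).
Proof.
move=> [mapsto _ contr] k w zeta; rewrite -/(kernel_form mu S w zeta) kernel_form_ip.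
set u := fam_u w zeta; set v := fam_v S w zeta.
have su : slow mu u := slow_fam_u w zeta; have sv : slow mu v := slow_fam_v w zeta.
pose a n := (wt mu n)%:C *: v n.
have [fin_a le_a] : (coef_norm2 mu a < +oo)%E /\ fine (coef_norm2 mu a) <= ip mu v v.
  by apply: (coef_norm2_le mu1) => m; rewrite weighted_scale; exact: wsum_le.
have [K K0 hK] := coef_decay mu1 fin_a.
have /choice[f hf] : forall z : vtx L, exists l : M,
    series (fun n => zpow n z *: a n) @ \oo --> l.
  move=> z; have [l hl] := power_series_cvg mu1 0 z K0 hK; exists l.
  by move: hl; rewrite (_ : (fun n => _) = fun n => zpow n z *: a n) //;
     apply/funext => n; rewrite addn0.
have fa : hardy_coef mu f a by split.
have [b gb] : H2 mu (mul_op mu S f) by apply: mapsto; exists a.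
have := contr f (ex_intro _ a fa); rewrite /H2norm (hardy_hatE mu1 fa) (hardy_hatE mu1 gb).
have ge0 (H : hilbertType R) (c : nat -> H) : 0 <= fine (coef_norm2 mu c).
  by rewrite fine_ge0 // coef_norm2_ge0.
rewrite ler_sqrt // => le_ba.
have h1 := pairing_cvg (zeta := zeta) (fun i => mul_op_cvg mu1 da (z := w i) fa).
have h2 := pairing_u_cvg (zeta := zeta) (fun i => gb.2 (w i)).
have e1 : ip mu v v = \sum_i rin (mul_op mu S f (w i)) (zeta i).
  apply: ip_eq => //; move: h1.
  have -> : series (fun n => rin (fam_v S w zeta n) (a n)) =
    series (fun n => wt mu n * rin (v n) (v n)); last by [].
  by congr series; apply/funext => n; rewrite /a rinZr.
rewrite -e1 in h2.
have : 2 * ip mu v v <= ip mu v v + ip mu u u; last by lra.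
have h3 : (fun m => 2 * series (fun n => rin (b n) (fam_u w zeta n)) m) @ \oo -->
   2 * ip mu v v by exact: cvgMr.
apply: (cvg_le_bound h3) => m; rewrite /series /= mulr_sumr.
apply: (@le_trans _ _ (weighted_sum mu b m + wsum mu u m)).
  rewrite /weighted_sum /wsum -big_split /=; apply: ler_sum => n _; exact: young.
apply: lerD; last exact: wsum_le.
by apply: (le_trans (weighted_sum_le mu1 m gb.1)); exact: le_trans le_ba le_a.
Qed.
End PositiveOfContraction.

(** * From positive kernel to contraction *)

Section ContractionOfPositive.
Variables (R : realType) (L : rhombic_lattice R) (mu : R).
Local Notation C := R[i].
Hypothesis mu1 : 1 < mu.

Let mu0 : 0 < mu. Proof. exact: lt_trans ltr01 mu1. Qed.

Variables (M N : hilbertType R) (S : vtx L -> bounded_op M N).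
Hypothesis da : discrete_analytic S.

(** The graph of the adjoint of [M_S] on the kernel span. Keeping the pair avoids having to show
    that [v] depends only on [u]. *)
Definition is_family (x : (nat -> N) * (nat -> M)) : Prop :=
  exists k (w : 'I_k -> vtx L) (zeta : 'I_k -> N),
    x = (fam_u w zeta, fam_v S w zeta).

Lemma is_family_slow x : is_family x -> slow mu x.1 /\ slow mu x.2.
Proof.
by move=> [k [w [zeta ->]]]; split; [exact: slow_fam_u|exact: slow_fam_v].
Qed.

Lemma is_family_lin x y (t : R) :
  is_family x -> is_family y -> is_family (x + t%:C *: y).
Proof.
move=> [k [w [zeta ->]]] [k' [w' [zeta' ->]]].
exists (k + k')%N,
  (fun i => match fintype.split i with inl j => w j | inr j => w' j end),
  (fun i => match fintype.split i with inl j => zeta j | inr j => t%:C *: zeta' j end).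
congr pair; apply/funext => n; rewrite /fam_u /fam_v /= !fctE big_split_ord /=.
  congr (_ + _); first by apply: eq_bigr => i _; rewrite (unsplitK (inl i)).
  rewrite scaler_sumr; apply: eq_bigr => i _; rewrite (unsplitK (inr i)).
  by rewrite !scalerA mulrC.
congr (_ + _); first by apply: eq_bigr => i _; rewrite (unsplitK (inl i)).
rewrite scaler_sumr; apply: eq_bigr => i _; rewrite (unsplitK (inr i)).
by rewrite bopZ.
Qed.

Hypothesis pos : positive_kernel (assoc_kernel mu S).

Lemma is_family_le x : is_family x -> ip mu x.2 x.2 <= ip mu x.1 x.1.
Proof.
move=> [k [w [zeta ->]]] /=; rewrite -(kernel_form_ip mu1 da).
exact: pos.
Qed.

Variables (f : vtx L -> M) (a : nat -> M).
Hypothesis fa : hardy_coef mu f a.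

Let A := fine (coef_norm2 mu a).
Let phi (x : (nat -> N) * (nat -> M)) : R :=
  limn (series (fun n => rin (x.2 n) (a n))).

Lemma phi_family k (w : 'I_k -> vtx L) (zeta : 'I_k -> N) :
  phi (fam_u w zeta, fam_v S w zeta) = \sum_i rin (mul_op mu S f (w i)) (zeta i).
Proof.
apply: cvg_lim; first exact: Rhausdorff.
exact: (pairing_cvg (zeta := zeta) (fun i => mul_op_cvg mu1 da (z := w i) fa)).
Qed.

Lemma phi_cvg x : is_family x -> series (fun n => rin (x.2 n) (a n)) @ \oo --> phi x.
Proof.
move=> [k [w [zeta ->]]]; rewrite phi_family.
exact: (pairing_cvg (zeta := zeta) (fun i => mul_op_cvg mu1 da (z := w i) fa)).
Qed.

Lemma phi_lin x y (t : R) : is_family x -> is_family y ->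
  phi (x + t%:C *: y) = phi x + t * phi y.
Proof.
move=> Px Py; apply: Rcvg_unique (phi_cvg (is_family_lin t Px Py)) _.
have -> : series (fun n => rin ((x + t%:C *: y).2 n) (a n)) =
  fun m => series (fun n => rin (x.2 n) (a n)) m +
           t * series (fun n => rin (y.2 n) (a n)) m.
  apply/funext => m; rewrite /series /= mulr_sumr -big_split /=.
  by apply: eq_bigr => n _; rewrite rinDl rinZl.
by apply: cvgD; [exact: phi_cvg|apply: cvgMr; exact: phi_cvg].
Qed.

Lemma phi_le x : is_family x -> 2 * phi x <= ip mu x.1 x.1 + A.
Proof.
move=> Px; have [s1 s2] := is_family_slow Px.
have h : (fun m => 2 * series (fun n => rin (x.2 n) (a n)) m) @ \oo --> 2 * phi x.
  by apply: cvgMr; exact: phi_cvg.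
apply: (cvg_le_bound h) => m; rewrite /series /= mulr_sumr.
apply: (@le_trans _ _ (wsum mu x.2 m + weighted_sum mu a m)).
  rewrite /weighted_sum /wsum -big_split /=; apply: ler_sum => n _.
  by rewrite rinC addrC; exact: young.
apply: lerD; last by case: fa => fin _; exact: weighted_sum_le.
by apply: (le_trans (wsum_le mu1 m s2)); exact: is_family_le.
Qed.

(** By [phi_family], [phi] pairs the values of [M_S f] with a kernel combination, and positivity
    bounds it by [q + A]. Riesz then produces coefficients before it is known that [M_S f] lies in
    the Hardy space; evaluation at each vertex identifies their sum with [M_S f]. *)
Lemma positive_image : exists b : nat -> N, hardy_coef mu (mul_op mu S f) b /\
  fine (coef_norm2 mu b) <= A.
Proof.
have [] := @riesz_sequence R _ is_family (fun x => ip mu x.1 x.1) phi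
  (fun x y => ip mu x.1 y.1) A (fam_u (fun i : 'I_0 => vtx0 L) (fun=> 0),
     fam_v S (fun i : 'I_0 => vtx0 L) (fun=> 0)).
- by exists 0%N, (fun i : 'I_0 => vtx0 L), (fun=> 0).
- by move=> x y t; exact: is_family_lin.
- by move=> x y t /is_family_slow[sx _] /is_family_slow[sy _]; exact: ip_expand.
- by move=> x y t; exact: phi_lin.
- by [].
- by move=> x /is_family_slow[sx _]; exact: ip_ge0.
- by move=> x; exact: phi_le.
move=> x [K [Px cau rep bnd]].
have sx k : slow mu (x k).1 := (is_family_slow (Px k)).1.
have Pd k l : is_family (x k - x l).
  rewrite -scaleN1r (_ : -1 = (-1)%:C); last by rewrite rmorphN rmorph1.
  exact: is_family_lin.
have sd k l : slow mu (x k - x l).1 := (is_family_slow (Pd k l)).1.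
have cauw k l m : wsum mu (fun n => (x k).1 n - (x l).1 n) m <= 2 / k.+1%:R + 2 / l.+1%:R.
  exact: le_trans (wsum_le mu1 m (sd k l)) (cau k l).
(* A single coefficient is dominated by a partial sum with weight [wt n], so it is a Cauchy sequence
   in the complete space [N]. *)
have /choice[U hU] : forall n, exists l : N, (fun k => (x k).1 n) @ \oo --> l.
  move=> n; apply: hcauchy => e e0.
  have w0 := wt_gt0 mu1 n.
  have [n0 hn0] := harmonic_small 4 (mulr_gt0 w0 (exprn_gt0 2 e0)).
  exists n0 => p r np nr; rewrite -(@ltr_pXn2r _ 2) // ?nnegrE ?hnorm_ge0 ?(ltW e0) //.
  rewrite -(ltr_pM2l w0); apply: (@le_lt_trans _ _ (2 / p.+1%:R + 2 / r.+1%:R)).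
    apply: le_trans (cauw p r n.+1); rewrite /wsum big_nat_recr //= lerDr.
    by apply: sumr_ge0 => i _; rewrite mulr_ge0 ?sqr_ge0 // ltW // wt_gt0.
  move: (hn0 p np) (hn0 r nr).
  by move: (p.+1%:R^-1) (r.+1%:R^-1) => e1 e2; lra.
pose b n := (wt mu n)%:C *: U n.
have wsum_lim (v : nat -> N) (F : nat -> nat -> N) m :
    (forall n, (fun k => F k n) @ \oo --> v n) -> (fun k => wsum mu (F k) m) @ \oo --> wsum mu v m.
  move=> h; apply: Rcvg_sum => n; apply: cvgMr.
  by rewrite expr2; under eq_fun do rewrite expr2; apply: cvgM; exact: hnorm_cvg.
(* For fixed [m] the partial sum is continuous in its finitely many coefficients, so the bound
   [A + D k] passes to its limit [A]. *)
have b_bound m : weighted_sum mu b m <= A.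
  rewrite weighted_scale // -[leRHS]addr0.
  have /choice[D hD] : forall k, exists D, D ^+ 2 <= K / k.+1%:R /\ ip mu (x k).1 (x k).1 <= A + D.
    by move=> k; have [D] := bnd k; exists D.
  have D0 : D @ \oo --> (0 : R).
    by apply: (@cvg_sq_harmonic R D 0 K) => k; rewrite subr0; exact: (hD k).1.
  have AD : (fun k => A + D k) @ \oo --> A + 0 by apply: cvgD => //; exact: cvg_cst.
  apply: ler_cvg_to (wsum_lim U (fun k => (x k).1) m hU) AD _.
  apply: nearW => k; exact: le_trans (wsum_le mu1 m (sx k)) (hD k).2.
have [fin_b le_b] := coef_norm2_le mu1 b_bound.
exists b; split=> //; split=> // z.
have [J J0 hJ] := coef_decay mu1 fin_b.
have [g hg] : exists g : N, series (fun n => zpow n z *: b n) @ \oo --> g.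
  have [l hl] := power_series_cvg mu1 0 z J0 hJ; exists l.
  by move: hl; rewrite (_ : (fun n => _) = fun n => zpow n z *: b n) //;
     apply/funext => n; rewrite addn0.
suff -> : mul_op mu S f z = g by [].
apply/eqP; rewrite -subr_eq0; apply/eqP/rin_nondeg => zeta.
rewrite rinDl rinNl; apply/eqP; rewrite subr_eq0; apply/eqP.
(* On a one-point family [phi] is evaluation: it equals [rin (mul_op mu S f z) zeta]. *)
pose w (i : 'I_1) := z; pose ze (i : 'I_1) := zeta.
pose y := (fam_u w ze, fam_v S w ze).
have Py : is_family y by exists 1%N, w, ze.
have sy : slow mu y.1 := (is_family_slow Py).1.
have h1 : (fun k => ip mu (x k).1 y.1) @ \oo --> rin (mul_op mu S f z) zeta.
  apply: (@cvg_sq_harmonic R _ _ (ip mu y.1 y.1 + 1)) => k.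
  by have := rep y k Py; rewrite phi_family big_ord1.
apply: Rcvg_unique h1 _.
(* The factor 2 is what remains of [cauw] as [l] tends to infinity; the other factor comes from
   [wsum_cauchy_schwarz]. *)
apply: (@cvg_sq_harmonic R _ _ (2 * (ip mu y.1 y.1 + 1))) => k.
have lim_m : (fun m => (series (fun n => wt mu n * rin ((x k).1 n) (y.1 n)) m -
    series (fun n => rin (b n) (y.1 n)) m) ^+ 2) @ \oo -->
    (ip mu (x k).1 y.1 - rin g zeta) ^+ 2.
  have h2 := pairing_u_cvg (w := w) (zeta := ze) (fun i => hg).
  rewrite big_ord1 in h2.
  have h3 := cvgB (ip_cvg mu1 (sx k) sy) h2.
  by under eq_fun do rewrite expr2; rewrite expr2; apply: cvgM; exact: h3.
apply: (cvg_le_bound lim_m) => m.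
have -> : series (fun n => wt mu n * rin ((x k).1 n) (y.1 n)) m -
    series (fun n => rin (b n) (y.1 n)) m =
    \sum_(0 <= n < m) wt mu n * rin ((x k).1 n - U n) (y.1 n).
  rewrite /series /= -sumrB; apply: eq_bigr => n _.
  by rewrite rinDl rinNl /b rinZl; ring.
apply: (le_trans (wsum_cauchy_schwarz mu1 _ _ _)).
have -> : 2 * (ip mu y.1 y.1 + 1) / k.+1%:R = 2 / k.+1%:R * (ip mu y.1 y.1 + 1).
  by rewrite mulrAC.
have w_ge0 (v : nat -> N) : 0 <= wsum mu v m.
  by apply: sumr_ge0 => i _; rewrite mulr_ge0 ?sqr_ge0 // ltW // wt_gt0.
apply: ler_pM => //; first by rewrite addr_ge0.
  have lim_l : (fun l => wsum mu (fun n => (x k).1 n - (x l).1 n) m) @ \oo -->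
      wsum mu (fun n => (x k).1 n - U n) m.
    by apply: wsum_lim => n; apply: Hcvg_sub; [exact: cvg_cst|exact: hU].
  have lim_r : (fun l : nat => 2 / k.+1%:R + 2 / l.+1%:R) @ \oo --> (2 / k.+1%:R + 2 * 0 : R).
    apply: cvgD; first exact: cvg_cst.
    by apply: cvgMr; exact: cvg_harmonic.
  rewrite mulr0 addr0 in lim_r.
  by apply: ler_cvg_to lim_l lim_r _; apply: nearW => l; exact: cauw.
by rewrite lerD2r; exact: wsum_le.
Qed.
End ContractionOfPositive.

Theorem theorem4p6 (R : realType) (L : rhombic_lattice R) (M N : hilbertType R)
    (S : vtx L -> bounded_op M N) (mu : R) :
  discrete_analytic S -> 1 < mu ->
  (positive_kernel (assoc_kernel mu S) <-> H2_contraction mu (mul_op mu S)).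
Proof.
move=> da mu1; split; last exact: contraction_positive.
move=> pos; split.
- move=> f [a fa]; have [b [Tb _]] := positive_image mu1 da pos fa.
  by exists b.
- move=> c f g [a fa] [b gb]; apply/funext => z.
  have lin := mul_op_cvg mu1 da (z := z) (hardy_coef_lin mu1 c fa gb).
  apply: Hcvg_unique lin _.
  have -> : series (fun n => op_pow S n z (c *: a n + b n)) =
      fun m => c *: series (fun n => op_pow S n z (a n)) m +
               series (fun n => op_pow S n z (b n)) m.
    apply/funext => m; rewrite /series /= scaler_sumr -big_split /=.
    by apply: eq_bigr => n _; exact: bop_linear.
  exact: Hcvg_add (Hcvg_scale (mul_op_cvg mu1 da fa)) (mul_op_cvg mu1 da gb).
- move=> f [a fa]; have [b [Tb le_ba]] := positive_image mu1 da pos fa.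
  rewrite /H2norm (hardy_hatE mu1 fa) (hardy_hatE mu1 Tb) ler_sqrt //.
  by rewrite fine_ge0 // coef_norm2_ge0.
Qed.
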